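(* Let $\mathcal{X}=(X,r,\rho,\mu)$ and $\mathcal{X}_n=(X_n,r_n,\rho_n,\mu_n)$, $n\in\mathbb{N}$, be metric finite measure spaces. Then the following are equivalent. (1) $(\mathcal{X}_n)_{n\in\mathbb{N}}$ converges in Gromov-weak topology to $\mathcal{X}$, and for all $\delta>0$, $\liminf_{n\to\infty}\mathfrak{m}_\delta(\mathcal{X}_n)>0$. (2) $\mathcal{X}$ is compact, and $(\mathcal{X}_n)_{n\in\mathbb{N}}$ converges in Gromov-Hausdorff-weak topology to $\mathcal{X}$. If $\mathcal{X}_n$ is compact for all $n\in\mathbb{N}$, the following is also equivalent: (3) $(\mathcal{X}_n)_{n\in\mathbb{N}}$ converges in Gromov-weak topology to $\mathcal{X}$, and $\{\mathcal{X}_n:n\in\mathbb{N}\}$ satisfies the global lower mass-bound property, i.e. $\inf_{n\in\mathbb{N}}\mathfrak{m}_\delta(\mathcal{X}_n)>0$ for all $\delta>0$.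
   Context: A (pointed, complete, separable) metric measure space $(X,r,\rho,\mu)$ consists of a complete separable metric space $(X,r)$, a point $\rho\in X$ (the root) and a Borel measure $\mu$ on $X$. It is a metric finite measure space if $\mu(X)<\infty$. Two metric measure spaces $(X,r,\rho,\mu)$, $(X',r',\rho',\mu')$ are equivalent if there is a (surjective) isometry $\phi\colon\operatorname{supp}(\mu)\cup\{\rho\}\to\operatorname{supp}(\mu')\cup\{\rho'\}$ with $\phi(\rho)=\rho'$ and $\phi_*\mu=\mu'$, where $\phi_*\mu=\mu\circ\phi^{-1}$. Metric measure spaces are identified with their equivalence classes; an equivalence class is called compact if it contains a representative $(X,r,\rho,\mu)$ with $\mu$ finite and $(X,r)$ compact. Gromov-weak convergence: for $m\in\mathbb{N}$ the $m$-point distance matrix distribution $\nu_m(\mathcal{X})$ of a metric finite measure space $\mathcal{X}=(X,r,\rho,\mu)$ is the image of $\mu^{\otimes m}$ under $(x_1,\dots,x_m)\mapsto (r(x_i,x_j))_{0\le i<j\le m}$, where $x_0:=\rho$. Then $\mathcal{X}_n\to\mathcal{X}$ Gromov-weakly iff $\nu_m(\mathcal{X}_n)\to\nu_m(\mathcal{X})$ weakly (as finite measures) for all $m\in\mathbb{N}$. Gromov-Hausdorff-weak convergence: $\mathcal{X}_n=(X_n,r_n,\rho_n,\mu_n)\to\mathcal{X}_\infty=(X_\infty,r_\infty,\rho_\infty,\mu_\infty)$ iff there are a pointed metric space $(E,d_E,\rho_E)$ and isometric embeddings $\varphi_n\colon\operatorname{supp}(\mu_n)\cup\{\rho_n\}\to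 E$, $n\in\mathbb{N}\cup\{\infty\}$, with $\varphi_n(\rho_n)=\rho_E$, such that $(\varphi_n)_*\mu_n\to(\varphi_\infty)_*\mu_\infty$ weakly and $d_{\mathrm H}\big(\varphi_n(\operatorname{supp}\mu_n),\varphi_\infty(\operatorname{supp}\mu_\infty)\big)\to0$. Here $d_{\mathrm H}(A,B)=\inf\{\varepsilon>0: A^\varepsilon\supseteq B,\ B^\varepsilon\supseteq A\}$ with $A^\varepsilon=\{x\in E:d_E(x,A)\le\varepsilon\}$ (so $d_{\mathrm H}(\emptyset,\emptyset)=0$ and $d_{\mathrm H}(\emptyset,B)=\infty$ for $B\ne\emptyset$). Lower mass functions: with $B_r(x,R)$, $\overline{B}_r(x,R)$ open and closed balls, $\mathfrak{m}_\delta^R((X,r,\rho,\mu)):=\inf\{\mu(\overline{B}_r(x,\delta)):x\in B_r(\rho,R)\cap\operatorname{supp}(\mu)\}$ (with $\inf\emptyset=\infty$) and $\mathfrak{m}_\delta:=\lim_{R\to\infty}\mathfrak{m}^R_\delta=\inf_{R>0}\mathfrak{m}_\delta^R$. *)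

(* Defs.v *)
From HB Require Import structures.
From mathcomp Require Import all_boot all_order all_algebra.
From mathcomp Require Import all_classical all_reals all_analysis.

Set Implicit Arguments.
Unset Strict Implicit.
Unset Printing Implicit Defensive.

Import Order.TTheory GRing.Theory Num.Theory.
Import numFieldNormedType.Exports.

Local Open Scope classical_set_scope.
Local Open Scope ring_scope.

(* In a pointed metric space, [point] is the root. *)
#[short(type="pmetricType")]
HB.structure Definition PointedMetric (K : numDomainType) :=
  { M of Metric K M & Pointed M }.

#[short(type="completeMetricType")]
HB.structure Definition CompleteMetric (K : numDomainType) :=
  { M of Metric K M & Complete M }.

Notation borel T := (g_sigma_algebraType (@open T)).

(* The library only makes the underlying arrow type pointed. *)
HB.instance Definition _ (I : Type) (T : I -> ptopologicalType) :=
  isPointed.Build (prod_topology T) (fun=> point).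

Definition separable (T : topologicalType) : Prop :=
  exists2 D : set T, countable D & dense D.

Record mfmSpace (R : realType) := MfmSpace {
  mfm_space :> completeMetricType R ;
  mfm_separable : separable mfm_space ;
  mfm_measure : {finite_measure set (borel mfm_space) -> \bar R}
}.

Section Metric.
Context {R : realType}.

(* Not [closed_ball] of the library, which is the closure of the open ball. *)
Definition cball (T : metricType R) (x : T) (d : R) : set T :=
  [set y | mdist x y <= d].

Definition isometric_on (T U : metricType R) (D : set T) (phi : T -> U) :=
  forall x y, D x -> D y -> mdist (phi x) (phi y) = mdist x y.

Definition dist_to_set (T : metricType R) (x : T) (A : set T) : \bar R :=
  ereal_inf [set (mdist x a)%:E | a in A].

Definition thickening (T : metricType R) (A : set T) (e : R) : set T :=
  [set x | (dist_to_set x A <= e%:E)%E].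

Definition hausdorff_dist (T : metricType R) (A B : set T) : \bar R :=
  ereal_inf [set e%:E | e in
    [set e : R | [/\ 0 < e, B `<=` thickening A e & A `<=` thickening B e]]].

End Metric.

Section Measure.
Context {R : realType}.

Definition support (T : ptopologicalType) (mu : set (borel T) -> \bar R) :
  set T := [set x | forall U : set T, open U -> U x -> (0 < mu U)%E].

Definition weak_cvg (T : ptopologicalType) (nu_ : (set (borel T) -> \bar R)^nat)
    (nu : set (borel T) -> \bar R) : Prop :=
  forall f : T -> R, continuous f -> (exists M : R, forall x, `|f x| <= M) ->
    (\int[nu_ n]_x (f x)%:E)%E @[n --> \oo] --> (\int[nu]_x (f x)%:E)%E.

(* Image measure under the partial map given by phi on D; the values of phi
   outside D are irrelevant. *)
Definition pushforward_on d d' (T : measurableType d) (U : measurableType d')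
    (mu : set T -> \bar R) (D : set T) (phi : T -> U) : set U -> \bar R :=
  fun A => mu (D `&` phi @^-1` A).

Fixpoint measure_power d (T : measurableType d) (mu : set T -> \bar R)
    (m : nat) : set (m.-tuple T) -> \bar R :=
  match m with
  | 0 => \d_([tuple] : 0.-tuple T)
  | k.+1 => pushforward (mu \x @measure_power d T mu k)%E
              (fun p : T * k.-tuple T => [tuple of p.1 :: p.2])
  end.

End Measure.

Arguments measure_power {R d T} mu m.

Section MetricMeasureSpaces.
Context {R : realType}.
Implicit Types X Y : mfmSpace R.

Definition supp X : set X := support (mfm_measure X).

Arguments supp X : clear implicits.

Definition rooted_supp X : set X := supp X `|` [set point].
Arguments rooted_supp X : clear implicits.

Definition image_measure X (E : pmetricType R) (phi : X -> E) :
    set (borel E) -> \bar R :=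
  pushforward_on (mfm_measure X) (rooted_supp X) (phi : borel X -> borel E).

Definition mfm_equiv X Y : Prop :=
  exists phi : X -> Y,
    [/\ isometric_on (rooted_supp X) phi,
        phi @` rooted_supp X = rooted_supp Y,
        phi point = point &
        forall A : set (borel Y), measurable A ->
          image_measure phi A = mfm_measure Y A].

Definition mfm_compact X : Prop :=
  exists2 Y : mfmSpace R, mfm_equiv X Y & compact [set: Y].

Definition index_pairs (m : nat) :=
  {ij : 'I_m.+1 * 'I_m.+1 | (ij.1 < ij.2)%N}.

Definition distances (m : nat) := {ptws index_pairs m -> R}.

Definition distance_matrix X (m : nat) (x : m.-tuple (borel X)) :
    borel (distances m) :=
  let x0 := [tuple of (point : X) :: x] in
  fun ij => mdist (tnth x0 (sval ij).1) (tnth x0 (sval ij).2).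

Definition distance_matrix_distribution X (m : nat) :
    set (borel (distances m)) -> \bar R :=
  pushforward (measure_power (mfm_measure X) m) (@distance_matrix X m).
Arguments distance_matrix_distribution X m : clear implicits.

(* Also required for m = 0, where the condition is void since both sides are
   the unit mass on a one-point space. *)
Definition gromov_weak_cvg (X_ : nat -> mfmSpace R) X : Prop :=
  forall m : nat,
    weak_cvg (fun n => distance_matrix_distribution (X_ n) m)
             (distance_matrix_distribution X m).

Definition ghw_cvg (X_ : nat -> mfmSpace R) X : Prop :=
  exists (E : pmetricType R) (phi_ : forall n, X_ n -> E) (phi : X -> E),
    [/\ forall n, isometric_on (rooted_supp (X_ n)) (phi_ n)
                  /\ phi_ n point = point,
        isometric_on (rooted_supp X) phi /\ phi point = point,
        weak_cvg (fun n => image_measure (phi_ n)) (image_measure phi) &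
        hausdorff_dist (phi_ n @` supp (X_ n)) (phi @` supp X)
          @[n --> \oo] --> 0%E].

Definition lower_mass_in (r d : R) X : \bar R :=
  ereal_inf [set mfm_measure X (cball x d)
            | x in ball (point : X) r `&` supp X].

Definition lower_mass (d : R) X : \bar R :=
  ereal_inf [set lower_mass_in r d X | r in [set r : R | 0 < r]].

Definition global_lower_mass_bound (X_ : nat -> mfmSpace R) : Prop :=
  forall d : R, 0 < d ->
    (0 < ereal_inf (range (fun n => lower_mass d (X_ n))))%E.

End MetricMeasureSpaces.

(* Main.v *)
Require Import Defs.
From HB Require Import structures.
From mathcomp Require Import all_boot all_order all_algebra.
From mathcomp Require Import all_classical all_reals all_analysis.
From mathcomp Require Import measurable_realfun.
From mathcomp Require Import ring lra.

(** Gromov-weak convergence only sees laws of finite random distance matrices;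
Gromov-Hausdorff-weak convergence asks for a common space.  The bridge between
the two is sampling.

From Gromov-weak convergence to a common space.  A lower mass bound limits the
size of separated sets in the supports by (total mass) / c, which makes the
supports of the X_ n uniformly totally bounded for large n, and the limit inherits this
(gw_totally_bounded): a tuple of support points of X has approximate copies in
the supports of the X_ n (gw_transfer).  Hence the rooted support of X is compact.
Call a tuple good if its empirical measure, scaled to the total mass, is close
to the measure when tested on bounded Lipschitz functions.  On a totally bounded
set every Lipschitz function is close to a combination of boundedly many bumps,
so that a second moment bound shows that most m-tuples are good, with m depending
only on the precision, the total mass and the size of a net (sampling).  Since
most tuples are good both in X and in X_ n, and since the laws of the distance
matrices are close, some good tuple of X and some good tuple of X_ n have nearly
the same distance matrix.  Gluing X to X_ n along these two tuples produces a
space in which both empirical measures, hence both measures, are close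
(samples_bridge, eventually_bridge).  All these spaces are amalgamated along X
(amalgam_along).  In the resulting space the image measures converge when tested
on bounded Lipschitz functions, therefore weakly (weak_cvg_lipschitz), and the
supports converge for the Hausdorff distance because a ball around a support
point carries mass that the other measure must account for (bl_close_cover).

From a common space to Gromov-weak convergence.  If the support of X is compact,
then weak convergence in E together with Hausdorff convergence is uniform over
bounded Lipschitz functions (bl_uniform), again by approximation with finitely
many bumps.  Uniformity passes to iterated integrals one variable at a time
(iter_int_uniform), and a Lipschitz function of the distance matrix is a Lipschitz
function of the tuple of points in E.  The lower mass bound holds because every
support point of X_ n is close to one of finitely many support points of X, whose
neighbourhoods have mass bounded below (ghw_mass_bound).

For compact X_ n each lower mass is positive on its own, so that a positive lower
limit and a positive infimum amount to the same thing.

Integrals over powers of the measure are handled as iterated integrals of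
functions of sequences that are Lipschitz on tuples of support points (iter_int);
integrating out one variable keeps a function Lipschitz, so that measurability on
the product space matters only once, when the distance matrix distribution is
written as an iterated integral (integral_distribution). *)

Set Implicit Arguments.
Unset Strict Implicit.
Unset Printing Implicit Defensive.
Import Order.TTheory GRing.Theory Num.Theory.
Import numFieldNormedType.Exports.
Local Open Scope classical_set_scope.
Local Open Scope ring_scope.

(** * Borel sets and Lipschitz functions *)

Lemma borel_open (T : ptopologicalType) (U : set T) :
  open U -> measurable (U : set (borel T)).
Proof. by move=> oU; apply: sub_sigma_algebra. Qed.

Lemma borel_closed (T : ptopologicalType) (C : set T) :
  closed C -> measurable (C : set (borel T)).
Proof.
move=> cC; rewrite -[C]setCK; apply: measurableC; apply: borel_open.
exact: closed_openC.
Qed.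

Lemma measurable_continuous {R : realType} (T : ptopologicalType) (f : T -> R) :
  continuous f -> measurable_fun [set: borel T] (f : borel T -> R).
Proof.
move=> cf; apply: (measurability _ (RGenOInfty.measurableE R)).
move=> _ [_ [a ->]] <-; rewrite setTI; apply: borel_open.
by move/continuousP : cf; apply; exact: rray_open.
Qed.

Section Lipschitz.
Context {R : realType}.
Implicit Types T : pmetricType R.

Lemma nbhs_mdistE (T : metricType R) (x : T) (U : set T) :
  nbhs x U <-> exists2 e : R, 0 < e & forall y, mdist x y < e -> U y.
Proof. by rewrite -metricType_numDomainType.filter_from_mdist_nbhs. Qed.

Lemma open_mball (T : metricType R) (x : T) (e : R) : open [set y | mdist x y < e].
Proof.
rewrite openE => y /= xy; apply/nbhs_mdistE; exists (e - mdist x y).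
  by rewrite subr_gt0.
by move=> z yz; have := metric_triangle x y z => /=; lra.
Qed.

Definition lipschitz_on T (S : set T) (L B : R) (f : T -> R) :=
  [/\ 0 <= L, forall x, S x -> `|f x| <= B &
      forall x y, S x -> S y -> `|f x - f y| <= L * mdist x y].

Lemma lipschitz_on_sub T (S S' : set T) L B f :
  S' `<=` S -> lipschitz_on S L B f -> lipschitz_on S' L B f.
Proof. by move=> s [l0 fB fL]; split=> // *; [apply: fB|apply: fL]; apply: s. Qed.

(** The part of S where f > a is the trace on S of an open set: f stays above a on a
ball around each of its points, of a radius given by the Lipschitz constant. *)
Lemma measurable_lipschitz_on T (S : set T) L B (f : T -> R) :
  measurable (S : set (borel T)) -> lipschitz_on S L B f ->
  measurable_fun (S : set (borel T)) (f : borel T -> R).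
Proof.
move=> mS [L0 _ fL]; apply: (measurability _ (RGenOInfty.measurableE R)).
move=> _ [_ [a ->]] <-.
have L1 : 0 < L + 1 by rewrite ltr_wpDl.
pose U : set T := [set y | exists x, [/\ S x, a < f x & (L + 1) * mdist x y < f x - a]].
suff -> : (S `&` f @^-1` `]a, +oo[%classic : set (borel T)) = S `&` U.
  apply: measurableI => //; apply: borel_open; rewrite openE => y [x [Sx ax xy]].
  apply/nbhs_mdistE; exists ((f x - a - (L + 1) * mdist x y) / (L + 1)).
    by rewrite divr_gt0// subr_gt0.
  move=> z; rewrite ltr_pdivlMr// => yz; exists x; split => //.
  have := metric_triangle x y z; nra.
apply/seteqP; split=> y [Sy] /=; rewrite ?in_itv/= ?andbT.
  by move=> ay; split => //; exists y; split => //; rewrite mdistxx mulr0 subr_gt0.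
move=> [x [Sx ax xy]]; split=> //; rewrite /= ?in_itv/= ?andbT.
have := fL _ _ Sx Sy; rewrite ler_norml => /andP[_].
have := mdist_ge0 x y; nra.
Qed.

Lemma lipschitz_on_mdist T (S : set T) (x : T) (c : R) : 0 <= c ->
  lipschitz_on S 1 c (fun y => Num.max 0 (c - mdist x y)).
Proof.
move=> c0; split => // [y _|y z _ _].
  have := mdist_ge0 x y.
  by case: (leP 0 (c - mdist x y)) => h1 h2; rewrite ler_norml; apply/andP; split; lra.
have := metric_triangle x y z; have := metric_triangle x z y.
rewrite (metric_sym z y) mul1r => h1 h2.
have := mdist_ge0 y z.
by case: (leP 0 (c - mdist x y)) => ?; case: (leP 0 (c - mdist x z)) => ? ?;
  rewrite ler_norml; apply/andP; split; lra.
Qed.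

Lemma lipschitz_continuous T L B (f : T -> R) :
  lipschitz_on setT L B f -> continuous f.
Proof.
move=> [L0 _ fL] x; apply/cvgrPdist_lt => e e0.
have L1 : 0 < L + 1 by rewrite ltr_wpDl.
apply/nbhs_mdistE; exists (e / (L + 1)); first by rewrite divr_gt0.
move=> y; rewrite ltr_pdivlMr// => xy; apply: le_lt_trans (fL _ _ I I) _.
have := mdist_ge0 x y; nra.
Qed.

End Lipschitz.

(** * Weak convergence through Lipschitz test functions *)

Section WeakLip.
Context {R : realType}.

Lemma bounded_integrable d (T : measurableType d)
    (mu : {finite_measure set T -> \bar R}) (D : set T) (B : R) (f : T -> R) :
  measurable D -> measurable_fun D f -> (forall x, D x -> `|f x| <= B) ->
  mu.-integrable D (EFin \o f).
Proof.
move=> mD mf fB; apply: measurable_bounded_integrable => //.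
  by rewrite ltey_eq fin_num_measure.
by exists B; split; [exact: num_real|move=> M BM x Dx]; apply: le_trans (fB _ Dx) (ltW BM).
Qed.

Lemma EFin_Rintegral d (T : measurableType d)
    (mu : {measure set T -> \bar R}) (D : set T) (f : T -> R) :
  measurable D -> mu.-integrable D (EFin \o f) ->
  (\int[mu]_(x in D) (f x)%:E)%E = (\int[mu]_(x in D) f x)%:E.
Proof. by move=> mD fi; rewrite /Rintegral fineK//; apply: integrable_fin_num. Qed.

Lemma cvg_EFinP (a : nat -> R) (l : R) :
  ((a n)%:E @[n --> \oo] --> l%:E)%E <->
  forall e, 0 < e -> \forall n \near \oo, `|a n - l| <= e.
Proof.
split=> [/fine_cvg/cvgrPdist_le al e e0|al].
  by apply: filterS (al _ e0) => n /=; rewrite distrC.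
apply: cvg_EFin; first exact: nearW.
by apply/cvgrPdist_le => e /al; apply: filterS => n; rewrite /= distrC.
Qed.

Variables (T : ptopologicalType) (d : T -> T -> R).
Hypothesis dxx : forall x, d x x = 0.
Hypothesis dge0 : forall x y, 0 <= d x y.
Hypothesis dtri : forall x y z, d x z <= d x y + d y z.
Hypothesis dsym : forall x y, d x y = d y x.
Hypothesis dnbhs : forall (x : T) (U : set T),
  nbhs x U <-> exists2 e : R, 0 < e & forall y, d x y < e -> U y.

Definition d_lipschitz (L B : R) (f : T -> R) :=
  [/\ 0 <= L, forall x, `|f x| <= B &
      forall x y, `|f x - f y| <= L * d x y].

Lemma d_lipschitz_continuous L B f : d_lipschitz L B f -> continuous f.
Proof.
move=> [L0 _ fL] x; apply/cvgrPdist_lt => e e0.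
have L1 : 0 < L + 1 by rewrite ltr_wpDl.
apply/dnbhs; exists (e / (L + 1)); first by rewrite divr_gt0.
move=> y; rewrite ltr_pdivlMr// => xy; apply: le_lt_trans (fL _ _) _.
have := dge0 x y; nra.
Qed.

(** Lipschitz regularisation: f_ k x is the infimum over y of f y + k d(x, y).  By
continuity of f the infimum is eventually governed by points y close to x, whence
the pointwise convergence to f from below. *)
Lemma lipschitz_below (f : T -> R) (M : R) : continuous f -> (forall x, `|f x| <= M) ->
  exists f_ : nat -> T -> R, [/\ forall k, d_lipschitz k%:R M (f_ k),
    forall k x, f_ k x <= f x & forall x, f_ k x @[k --> \oo] --> f x].
Proof.
move=> cf fM.
pose A k x := [set f y + k%:R * d x y | y in setT].
have A0 k x : A k x !=set0 by exists (f x + k%:R * d x x), x.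
have fb x : -M <= f x <= M by rewrite -ler_norml.
have Alb k x : lbound (A k x) (- M).
  move=> _ [y _ <-]; have /andP[+ _] := fb y; have : 0 <= k%:R * d x y by rewrite mulr_ge0.
  lra.
have Ah k x : has_lbound (A k x) by exists (- M); exact: Alb.
have Aub k x y : inf (A k x) <= f y + k%:R * d x y by apply: ge_inf => //; exists y.
have Aubx k x : inf (A k x) <= f x by have := Aub k x x; rewrite dxx mulr0 addr0.
have step k x y : inf (A k x) - inf (A k y) <= k%:R * d x y.
  rewrite lerBlDl -lerBlDr; apply: lb_le_inf => // _ [z _ <-].
  have := Aub k x z; have := dtri x y z.
  have : 0 <= k%:R :> R by []. nra.
exists (fun k x => inf (A k x)); split => //.
- move=> k; split => //.
    move=> x; rewrite ler_norml; apply/andP; split; first exact: lb_le_inf.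
    by rewrite (le_trans (Aubx k x))//; have /andP[] := fb x.
  move=> x y; rewrite ler_norml lerNl opprB; apply/andP; split=> //.
  by rewrite dsym.
- move=> x; apply/cvgrPdist_le => e e0.
  have /cvgrPdist_lt /(_ _ e0) /dnbhs[r r0 xr] := cf x.
  near=> k.
  rewrite ger0_norm ?subr_ge0// lerBlDr -lerBlDl; apply: lb_le_inf => // _ [y _ <-].
  have [/xr|rd] := ltP (d x y) r.
    rewrite ltr_norml => /andP[_]; have : 0 <= k%:R * d x y by rewrite mulr_ge0. lra.
  have : 2 * M / r <= k%:R by near: k; apply: nbhs_infty_ger.
  rewrite ler_pdivrMr// => Mk.
  have /andP[? ?] := fb y; have /andP[? ?] := fb x.
  have : k%:R * r <= k%:R * d x y by rewrite ler_wpM2l.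
  lra.
Unshelve. all: by end_near. Qed.

Lemma cont_integrable (mu : {finite_measure set (borel T) -> \bar R}) M (f : T -> R) :
  continuous f -> (forall x, `|f x| <= M) ->
  mu.-integrable [set: borel T] (EFin \o (f : borel T -> R)).
Proof.
move=> cf fM; apply: (@bounded_integrable _ _ mu setT M) => //.
exact: measurable_continuous.
Qed.

(** By regularisation from below, the lower limit of the integrals of a bounded
continuous f is at least its limit integral; the same for - f gives convergence.
The distance d is a parameter because the space of distance matrices carries the
product topology without a chosen metric. *)
Lemma weak_cvg_lipschitz (nu_ : nat -> {finite_measure set (borel T) -> \bar R})
    (nu : {finite_measure set (borel T) -> \bar R}) :
  (forall f L B, d_lipschitz L B f ->
     (\int[nu_ n]_x (f x)%:E)%E @[n --> \oo] --> (\int[nu]_x (f x)%:E)%E) ->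
  weak_cvg (fun n => nu_ n) nu.
Proof.
move=> H.
have half f M : continuous f -> (forall x, `|f x| <= M) ->
    forall e, 0 < e -> \forall n \near \oo,
      \int[nu]_x f x - e <= \int[nu_ n]_x f x.
  move=> cf fM e e0.
  have [f_ [fL ff fcvg]] := lipschitz_below cf fM.
  have fc k := d_lipschitz_continuous (fL k).
  have fkM k x : `|f_ k x| <= M by case: (fL k).
  have iE (mu : {finite_measure set (borel T) -> \bar R}) g :
     continuous g -> (forall x, `|g x| <= M) ->
     (\int[mu]_x (g x)%:E)%E = (\int[mu]_x g x)%:E.
    by move=> cg gM; apply: EFin_Rintegral => //; exact: cont_integrable gM.
  have dc : (\int[nu]_x (f_ k x)%:E)%E @[k --> \oo] --> (\int[nu]_x (f x)%:E)%E.
    apply: (@dominated_cvg _ _ _ nu setT measurableT _ _ (fun x => `|M|%:E)) => //.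
    - move=> k; apply/measurable_EFinP; exact: measurable_continuous.
    - by move=> x _; apply: cvg_EFin; [exact: nearW|exact: fcvg].
    - by apply: (@bounded_integrable _ _ nu setT `|M|) => // x _; rewrite normr_id.
    - by move=> k x _; rewrite /= lee_fin (le_trans (fkM k x))// ler_norm.
  move: dc; rewrite iE//; under eq_fun do rewrite iE//.
  have e20 : 0 < e / 2 by lra.
  move/cvg_EFinP/(_ _ e20) => [k _ /(_ k (leqnn k)) /= kk].
  have := H _ _ _ (fL k); rewrite iE//; under eq_fun do rewrite iE//.
  move/cvg_EFinP/(_ _ e20); apply: filterS => n kn.
  have : \int[nu_ n]_x f_ k x <= \int[nu_ n]_x f x.
    apply: le_Rintegral => [|||x _]; [by []|exact: cont_integrable (fkM k)| |exact: ff].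
    exact: cont_integrable fM.
  by move: kk kn; rewrite !ler_norml => /andP[? ?] /andP[? ?]; lra.
move=> f cf [M fM].
have cNf : continuous (fun x => - f x) by move=> x; apply: cvgN; exact: cf.
have NfM x : `|- f x| <= M by rewrite normrN.
rewrite EFin_Rintegral//; last exact: cont_integrable fM.
under eq_fun do rewrite (EFin_Rintegral _ (cont_integrable _ cf fM))//.
have fi (mu : {finite_measure set (borel T) -> \bar R}) := cont_integrable mu cf fM.
have iN (mu : {finite_measure set (borel T) -> \bar R}) : \int[mu]_x (- f x) = - \int[mu]_x f x.
  under eq_Rintegral do rewrite -mulN1r.
  by rewrite RintegralZl ?mulN1r//; exact: fi.
apply/cvg_EFinP => e e0.
near=> n.
have h1 : \int[nu]_x f x - e <= \int[nu_ n]_x f x by near: n; exact: half fM _ _.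
have : \int[nu]_x (- f x) - e <= \int[nu_ n]_x (- f x) by near: n; exact: half NfM _ _.
by rewrite !iN ler_norml => ?; apply/andP; split; lra.
Unshelve. all: by end_near. Qed.

End WeakLip.

(** * The support of a measure and integration over it *)

Lemma separable_seq {R : realType} (X : mfmSpace R) :
  exists q : nat -> X, forall (x : X) (e : R), 0 < e -> exists n, mdist x (q n) < e.
Proof.
have [D /countable_injP[f finj] dD] := mfm_separable X.
exists (fun n => xget point [set x | D x /\ f x = n]) => x e e0.
have [||d [xd Dd]] := dD (ball x e).
- by exists x; exact: ballxx.
- by rewrite ballEmdist; exact: open_mball.
exists (f d).
have [Dx fx] : [set x | D x /\ f x = f d] (xget point [set x | D x /\ f x = f d]).
  by apply: xgetPex; exists d.
rewrite (finj _ _ _ _ fx) ?inE//.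
by move: xd; rewrite ballEmdist.
Qed.

Section Support.
Context {R : realType} (X : mfmSpace R).
Local Notation mu := (mfm_measure X).
Local Notation S := (@supp R X).

Lemma closed_supp : closed S.
Proof.
rewrite -[S]setCK; apply: open_closedC; rewrite openE => x /= Sx.
have : exists U : set X, [/\ open U, U x & (mu U = 0)%E].
  apply: contrapT => nU; apply: Sx => U oU Ux.
  rewrite lt0e measure_ge0 andbT; apply/eqP => U0.
  by apply: nU; exists U.
move=> [U [oU Ux U0]]; apply: filterS (open_nbhs_nbhs (conj oU Ux)) => y Uy Sy.
by have := Sy _ oU Uy; rewrite U0 ltxx.
Qed.

Lemma measurable_supp : measurable (S : set (borel X)).
Proof. by apply: borel_closed; exact: closed_supp. Qed.

Lemma measurable_cball (x : X) (e : R) : measurable (cball x e : set (borel X)).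
Proof.
apply: borel_closed; rewrite -[cball x e]setCK; apply: open_closedC.
rewrite openE => y /=; rewrite /cball/= => /negP; rewrite -ltNge => xy.
apply/nbhs_mdistE; exists (mdist x y - e); first by rewrite subr_gt0.
move=> z yz /=; apply/negP; rewrite -ltNge.
by have := metric_triangle x z y => /=; rewrite (metric_sym z y); lra.
Qed.

(** The complement of the support is a union of null balls whose centres run through
a countable dense family and whose radii are inverses of integers. *)
Lemma supp_full : mu (~` S) = 0%E.
Proof.
have [q qd] := separable_seq X.
pose F n k : set (borel X) := [set y | mdist (q n) y < k.+1%:R^-1 /\
   mu [set y | mdist (q n) y < k.+1%:R^-1] = 0%E].
have mF n k : mu.-negligible (F n k).
  have [m0|m0] := pselect (mu [set y | mdist (q n) y < k.+1%:R^-1] = 0%E).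
    have sub : F n k `<=` [set y | mdist (q n) y < k.+1%:R^-1] by move=> y [].
    apply: negligibleS sub _.
    by apply/negligibleP => //; apply: borel_open; exact: open_mball.
  have -> : F n k = set0 by apply/seteqP; split=> [y [_ /m0]|].
  exact: negligible_set0.
have : mu.-negligible (\bigcup_n \bigcup_k F n k).
  by apply: negligible_bigcup => n; apply: negligible_bigcup.
move=> hn.
apply/(negligibleP _ (measurableC measurable_supp)); apply: negligibleS hn => x Sx.
have [U [oU Ux U0]] : exists U : set X, [/\ open U, U x & (mu U = 0)%E].
  apply: contrapT => nU; apply: Sx => U oU Ux.
  rewrite lt0e measure_ge0 andbT; apply/eqP => U0.
  by apply: nU; exists U.
have /nbhs_mdistE[e e0 eU] := open_nbhs_nbhs (conj oU Ux).
have [k ke] : exists k : nat, k.+1%:R^-1 < e / 2.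
  exists (Num.truncn (2 / e)).
  have e2 : 0 < 2 / e by rewrite divr_gt0.
  rewrite invf_plt ?posrE ?divr_gt0// invf_div.
  by have /andP[] := truncn_itv (ltW e2).
have [|n xn] := qd x k.+1%:R^-1; first by rewrite invr_gt0.
exists n => //; exists k => //; split; first by rewrite /= metric_sym.
apply/eqP; rewrite eq_le measure_ge0 andbT -U0; apply: le_measure; rewrite ?inE.
- by apply: borel_open; exact: open_mball.
- exact: borel_open.
- by move=> y /= qy; apply: eU; apply: le_lt_trans (metric_triangle x (q n) y) _;
    rewrite (splitr e) ltrD// ?(lt_trans xn)// (lt_trans qy).
Qed.

(** The complement of the support is null. *)
Lemma measure_suppI (A : set (borel X)) : measurable A -> mu (A `&` S) = mu A.
Proof.
move=> mA; have mS := measurable_supp.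
rewrite -[in RHS](setIT A) -(setUv S) setIUr measureU//.
- rewrite [X in (_ + X)%E](_ : _ = 0)%E ?adde0//.
  apply/eqP; rewrite eq_le measure_ge0 andbT -supp_full.
  by apply: le_measure; rewrite ?inE//; [apply: measurableI => //|]; exact: measurableC.
- exact: measurableI.
- by apply: measurableI => //; exact: measurableC.
- by rewrite setIACA setICr setI0.
Qed.

End Support.

Section SupportIntegral.
Context {R : realType} (X : mfmSpace R).
Local Notation mu := (mfm_measure X).
Local Notation S := (@supp R X).

Definition mass : R := fine (mu setT).

Lemma mass_ge0 : 0 <= mass.
Proof. by rewrite fine_ge0. Qed.

(** Integration is restricted to the support because the functions of interest are
often Lipschitz only there. *)
Definition supp_int (f : X -> R) : R := \int[mu]_(x in S) f x.

Definition lipfun (f : X -> R) := exists L B, lipschitz_on S L B f.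

Lemma lipfun_integrable f : lipfun f -> mu.-integrable S (EFin \o (f : borel X -> R)).
Proof.
move=> [L [B Lf]]; apply: (@bounded_integrable _ _ _ mu S B).
- exact: measurable_supp.
- by apply: measurable_lipschitz_on Lf; exact: measurable_supp.
- by case: Lf.
Qed.
Hint Resolve lipfun_integrable : core.
Let mS := @measurable_supp R X.

Lemma eq_supp_int f g : (forall x, S x -> f x = g x) -> supp_int f = supp_int g.
Proof. by move=> fg; apply: eq_Rintegral => x; rewrite inE => /fg. Qed.

Lemma supp_intD f g : lipfun f -> lipfun g ->
  supp_int (fun x => f x + g x) = supp_int f + supp_int g.
Proof. by move=> lf lg; apply: RintegralD => //; exact: lipfun_integrable. Qed.

Lemma supp_intB f g : lipfun f -> lipfun g ->
  supp_int (fun x => f x - g x) = supp_int f - supp_int g.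
Proof. by move=> lf lg; apply: RintegralB => //; exact: lipfun_integrable. Qed.

Lemma supp_intZ c f : lipfun f -> supp_int (fun x => c * f x) = c * supp_int f.
Proof. by move=> lf; apply: RintegralZl => //; exact: lipfun_integrable. Qed.

Lemma supp_int_cst c : supp_int (fun=> c) = c * mass.
Proof.
have := @measure_suppI R X setT measurableT; rewrite setTI => muS.
by rewrite /supp_int Rintegral_cst//; congr (_ * fine _).
Qed.

Lemma le_supp_int f g : lipfun f -> lipfun g -> (forall x, S x -> f x <= g x) ->
  supp_int f <= supp_int g.
Proof. by move=> lf lg fg; apply: le_Rintegral => //; exact: lipfun_integrable. Qed.

Lemma supp_int_indic c (A : set (borel X)) : measurable A ->
  mu.-integrable S (EFin \o (fun x : borel X => c * \1_A x)) /\
  \int[mu]_(x in S) (c * \1_A x) = c * fine (mu A).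
Proof.
move=> mA; split.
  apply: (@bounded_integrable _ _ _ mu S `|c|) => // [|x _].
    by apply: measurable_funM => //; exact: measurable_indic.
  by rewrite indicE; case: (x \in A); rewrite ?mulr1 ?mulr0 ?normr0.
rewrite RintegralZl//; last first.
  apply: (@bounded_integrable _ _ _ mu S 1) => // x _.
  by rewrite indicE; case: (x \in A); rewrite ?normr1 ?normr0.
by rewrite /Rintegral integral_indic//; congr (_ * fine _); exact: measure_suppI.
Qed.

Lemma supp_int_ge_ball f c (A : set (borel X)) : lipfun f -> measurable A ->
  (forall x, S x -> 0 <= f x) -> (forall x, S x -> A x -> c <= f x) ->
  c * fine (mu A) <= supp_int f.
Proof.
move=> lf mA f0 fc; have [ci <-] := supp_int_indic c mA.
apply: le_Rintegral => //; first exact: lipfun_integrable.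
move=> x Sx; rewrite indicE; case: (boolP (x \in A)) => [|_].
  by rewrite inE mulr1 => /fc; exact.
by rewrite mulr0 f0.
Qed.

Lemma supp_int_le_ball f c (A : set (borel X)) : lipfun f -> measurable A ->
  (forall x, S x -> A x -> f x <= c) -> (forall x, S x -> ~ A x -> f x <= 0) ->
  supp_int f <= c * fine (mu A).
Proof.
move=> lf mA fc f0; have [ci <-] := supp_int_indic c mA.
apply: le_Rintegral => //; first exact: lipfun_integrable.
move=> x Sx; rewrite indicE; case: (boolP (x \in A)) => [|/negP].
  by rewrite inE mulr1 => /fc; exact.
by rewrite inE mulr0 => /f0; exact.
Qed.

Lemma lipfunD f g : lipfun f -> lipfun g -> lipfun (fun x => f x + g x).
Proof.
move=> [L [B [L0 fB fL]]] [L' [B' [L'0 gB gL]]]; exists (L + L'), (B + B'); split.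
- exact: addr_ge0.
- by move=> x Sx; apply: le_trans (ler_normD _ _) _; apply: lerD; [exact: fB|exact: gB].
- move=> x y Sx Sy; rewrite opprD addrACA mulrDl.
  by apply: le_trans (ler_normD _ _) _; apply: lerD; [exact: fL|exact: gL].
Qed.

Lemma lipfun_cst c : lipfun (fun=> c).
Proof. by exists 0, `|c|; split => // x y _ _; rewrite subrr normr0 mul0r. Qed.

Lemma lipfunM f g : lipfun f -> lipfun g -> lipfun (fun x => f x * g x).
Proof.
move=> [L [B [L0 fB fL]]] [L' [B' [L'0 gB gL]]].
exists (`|B'| * L + `|B| * L'), (`|B| * `|B'|); split.
- by rewrite addr_ge0// mulr_ge0.
- move=> x Sx; rewrite normrM ler_pM// ?(le_trans (fB x Sx)) ?(le_trans (gB x Sx))//;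
  exact: ler_norm.
- move=> x y Sx Sy.
  rewrite [X in `|X|](_ : _ = (f x - f y) * g x + f y * (g x - g y)); last by ring.
  rewrite [leRHS]mulrDl; apply: le_trans (ler_normD _ _) _; rewrite !normrM.
  apply: lerD; last first.
    rewrite -mulrA; apply: ler_pM => //; last exact: gL.
    by rewrite (le_trans (fB _ Sy))// ler_norm.
  rewrite -mulrA mulrC; apply: ler_pM => //; last exact: fL.
  by rewrite (le_trans (gB _ Sx))// ler_norm.
Qed.

Lemma lipfunZ c f : lipfun f -> lipfun (fun x => c * f x).
Proof. by move=> lf; apply: lipfunM => //; exact: lipfun_cst. Qed.

Lemma lipfunB f g : lipfun f -> lipfun g -> lipfun (fun x => f x - g x).
Proof.
move=> lf lg; under eq_fun do rewrite -mulN1r.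
by apply: lipfunD => //; exact: lipfunZ.
Qed.

Lemma supp_int_dist f g c : lipfun f -> lipfun g ->
  (forall x, S x -> `|f x - g x| <= c) -> `|supp_int f - supp_int g| <= c * mass.
Proof.
move=> lf lg fg; rewrite -supp_intB// -supp_int_cst ler_norml; apply/andP; split; last first.
  apply: le_supp_int; [exact: lipfunB|exact: lipfun_cst|].
  by move=> x /fg; rewrite ler_norml => /andP[].
rewrite -mulN1r -supp_intZ; last exact: lipfun_cst.
apply: le_supp_int; [exact: lipfun_cst|exact: lipfunB|].
by move=> x /fg; rewrite ler_norml mulN1r => /andP[].
Qed.

(** Around x the function is at least f x / 2 on a ball, which has positive mass. *)
Lemma supp_int_gt0 f x : lipfun f -> (forall y, S y -> 0 <= f y) -> S x -> 0 < f x ->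
  0 < supp_int f.
Proof.
move=> lf f0 Sx fx; have [L [B [L0 fB fL]]] := lf.
have L1 : 0 < L + 1 by rewrite ltr_wpDl.
pose r := f x / 2 / (L + 1).
have r0 : 0 < r by rewrite !divr_gt0.
have oB := open_mball x r.
have mB := borel_open oB.
apply: (@lt_le_trans _ _ (f x / 2 * fine (mu [set y | mdist x y < r]))).
  rewrite mulr_gt0 ?divr_gt0// fine_gt0//.
  rewrite ltey_eq fin_num_measure// andbT.
  by apply: Sx => //=; rewrite mdistxx.
apply: supp_int_ge_ball => //.
move=> y Sy /= xy; have := fL _ _ Sx Sy; rewrite ler_norml => /andP[_].
have : (L + 1) * mdist x y <= f x / 2 by rewrite mulrC -ler_pdivlMr// ltW.
have := mdist_ge0 x y; nra.
Qed.

End SupportIntegral.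
Arguments mass {R} X.
Arguments supp_int {R} X f.
Arguments lipfun {R} X f.

(** * Iterated integrals over tuples of support points *)

Section Seqs.
Context {R : realType}.

(** Sequences of length m with entries in S, by recursion so that membership
unfolds along with iter_int. *)
Fixpoint seqs (T : Type) (S : set T) (m : nat) (z : seq T) : Prop :=
  match m, z with
  | 0, [::] => True
  | k.+1, x :: z' => S x /\ seqs S k z'
  | _, _ => False
  end.

Fixpoint dsum (T : metricType R) (z w : seq T) : R :=
  match z, w with
  | x :: z', y :: w' => mdist x y + dsum z' w'
  | _, _ => 0
  end.

Lemma dsum_ge0 (T : metricType R) (z w : seq T) : 0 <= dsum z w.
Proof. by elim: z w => [|x z IH] [|y w] //=; rewrite addr_ge0 ?mdist_ge0. Qed.

Lemma dsumxx (T : metricType R) (z : seq T) : dsum z z = 0.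
Proof. by elim: z => //= x z ->; rewrite mdistxx addr0. Qed.

Lemma seqs_size T (S : set T) m z : seqs S m z -> size z = m.
Proof. by elim: m z => [|m IH] [|x z] //= [_ /IH ->]. Qed.

Lemma seqs_mem (T : eqType) (S : set T) m z x : seqs S m z -> x \in z -> S x.
Proof.
elim: m z => [|m IH] [|y z] //= [Sy zm]; rewrite inE => /orP[/eqP -> //|].
exact: IH.
Qed.

Lemma seqsP (T : eqType) (S : set T) z : (forall x, x \in z -> S x) -> seqs S (size z) z.
Proof.
elim: z => //= x z IH zS; split; first by apply: zS; rewrite mem_head.
by apply: IH => y yz; apply: zS; rewrite inE yz orbT.
Qed.

End Seqs.

Section IteratedIntegral.
Context {R : realType} (X : mfmSpace R).
Local Notation S := (@supp R X).
Implicit Types (F G : seq X -> R) (m : nat).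

Definition lipschitz_seq m (L B : R) F :=
  [/\ 0 <= L, 0 <= B, forall z, seqs S m z -> `|F z| <= B &
      forall z w, seqs S m z -> seqs S m w -> `|F z - F w| <= L * dsum z w].

Definition lipseq m F := exists L B, lipschitz_seq m L B F.

Fixpoint iter_int m F : R :=
  if m is k.+1 then supp_int X (fun x => iter_int k (fun z => F (x :: z))) else F [::].

Lemma lipschitz_seq_cons m L B F x : S x -> lipschitz_seq m.+1 L B F ->
  lipschitz_seq m L B (fun z => F (x :: z)).
Proof.
move=> Sx [L0 B0 FB FL]; split=> // [z zS|z w zS wS]; first exact: FB.
by have := FL (x :: z) (x :: w) (conj Sx zS) (conj Sx wS) => /=; rewrite mdistxx add0r.
Qed.

Lemma lipseq_cons m F x : S x -> lipseq m.+1 F -> lipseq m (fun z => F (x :: z)).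
Proof. by move=> Sx [L [B FLB]]; exists L, B; exact: lipschitz_seq_cons. Qed.

Lemma lipseq_cst m c : lipseq m (fun=> c).
Proof. by exists 0, `|c|; split=> // z w _ _; rewrite subrr normr0 mul0r. Qed.

Lemma massX_ge0 m : 0 <= mass X ^+ m.
Proof. by rewrite exprn_ge0// mass_ge0. Qed.

Lemma lipseqD m F G : lipseq m F -> lipseq m G -> lipseq m (fun z => F z + G z).
Proof.
move=> [L [B [L0 B0 FB FL]]] [L' [B' [L'0 B'0 GB GL]]]; exists (L + L'), (B + B').
split; [exact: addr_ge0|exact: addr_ge0|move=> z zS|move=> z w zS wS].
  by apply: le_trans (ler_normD _ _) _; apply: lerD; [exact: FB|exact: GB].
rewrite opprD addrACA mulrDl.
by apply: le_trans (ler_normD _ _) _; apply: lerD; [exact: FL|exact: GL].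
Qed.

Lemma lipseqM m F G : lipseq m F -> lipseq m G -> lipseq m (fun z => F z * G z).
Proof.
move=> [L [B [L0 B0 FB FL]]] [L' [B' [L'0 B'0 GB GL]]].
exists (B' * L + B * L'), (B * B').
split; [by rewrite addr_ge0 ?mulr_ge0|exact: mulr_ge0|move=> z zS|move=> z w zS wS].
  by rewrite normrM; apply: ler_pM => //; [exact: FB|exact: GB].
rewrite [X in `|X|](_ : _ = (F z - F w) * G z + F w * (G z - G w)); last by ring.
rewrite [leRHS]mulrDl; apply: le_trans (ler_normD _ _) _; rewrite !normrM.
apply: lerD; last first.
  by rewrite -mulrA; apply: ler_pM => //; [exact: FB|exact: GL].
by rewrite -mulrA mulrC; apply: ler_pM => //; [exact: GB|exact: FL].
Qed.

Lemma lipseqZ m c F : lipseq m F -> lipseq m (fun z => c * F z).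
Proof. by move=> lF; apply: lipseqM => //; exact: lipseq_cst. Qed.

Lemma iter_int_cst m c : iter_int m (fun=> c) = c * mass X ^+ m.
Proof.
elim: m => [|m IH] /=; first by rewrite expr0 mulr1.
by rewrite IH supp_int_cst exprSr mulrA.
Qed.

Let dist_bound m := forall F G c, 0 <= c -> lipseq m F -> lipseq m G ->
  (forall z, seqs S m z -> `|F z - G z| <= c) ->
  `|iter_int m F - iter_int m G| <= c * mass X ^+ m.

Let dist_bound_lipschitz m L B F : dist_bound m -> lipschitz_seq m.+1 L B F ->
  lipschitz_on S (L * mass X ^+ m) (B * mass X ^+ m)
    (fun x => iter_int m (fun z => F (x :: z))).
Proof.
move=> dist FLB; have [L0 B0 FB FL] := FLB.
have lF : lipseq m.+1 F by exists L, B.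
split; first by rewrite mulr_ge0 ?massX_ge0.
- move=> x Sx; rewrite -[X in `|X|]subr0 -[X in _ - X](mul0r (mass X ^+ m)) -iter_int_cst.
  apply: dist => //; [exact: lipseq_cons|exact: lipseq_cst|].
  by move=> z zS; rewrite subr0; apply: FB.
- move=> x y Sx Sy; rewrite mulrAC; apply: dist.
  + by rewrite mulr_ge0 ?mdist_ge0.
  + exact: lipseq_cons.
  + exact: lipseq_cons.
  + move=> z zS; have := FL (x :: z) (y :: z) (conj Sx zS) (conj Sy zS).
    by rewrite /= dsumxx addr0.
Qed.

(** The Lipschitz bound on the inner integral, without which the next integration
would be meaningless, comes out of the same induction through dist_bound_lipschitz. *)
Lemma iter_int_dist m F G c : 0 <= c -> lipseq m F -> lipseq m G ->
  (forall z, seqs S m z -> `|F z - G z| <= c) ->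
  `|iter_int m F - iter_int m G| <= c * mass X ^+ m.
Proof.
elim: m F G c => [|m IH] F G c c0 lF lG FG /=; first by rewrite expr0 mulr1 FG.
have lip H : lipseq m.+1 H -> lipfun X (fun x => iter_int m (fun z => H (x :: z))).
  by move=> [L [B HLB]]; eexists; eexists; exact: dist_bound_lipschitz IH HLB.
rewrite exprSr mulrA; apply: supp_int_dist; [exact: lip|exact: lip|] => x Sx.
apply: IH => //; [exact: lipseq_cons|exact: lipseq_cons|].
by move=> z zS; apply: FG.
Qed.

Lemma iter_int_lipschitz m L B F : lipschitz_seq m.+1 L B F ->
  lipschitz_on S (L * mass X ^+ m) (B * mass X ^+ m)
    (fun x => iter_int m (fun z => F (x :: z))).
Proof. exact: dist_bound_lipschitz (@iter_int_dist m). Qed.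

Lemma lipfun_iter_int m F : lipseq m.+1 F -> lipfun X (fun x => iter_int m (fun z => F (x :: z))).
Proof. by move=> [L [B /iter_int_lipschitz h]]; eexists; eexists; exact: h. Qed.

Lemma eq_iter_int m F G : (forall z, seqs S m z -> F z = G z) -> iter_int m F = iter_int m G.
Proof.
elim: m F G => [|m IH] F G FG /=; first exact: FG.
by apply: eq_supp_int => x Sx; apply: IH => z zS; apply: FG.
Qed.

Lemma iter_intD m F G : lipseq m F -> lipseq m G ->
  iter_int m (fun z => F z + G z) = iter_int m F + iter_int m G.
Proof.
elim: m F G => [//|m IH] F G lF lG /=.
rewrite -supp_intD; [|exact: lipfun_iter_int..].
by apply: eq_supp_int => x Sx; apply: IH; exact: lipseq_cons.
Qed.

Lemma iter_intZ m c F : lipseq m F -> iter_int m (fun z => c * F z) = c * iter_int m F.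
Proof.
elim: m F => [//|m IH] F lF /=.
rewrite -supp_intZ; last exact: lipfun_iter_int.
by apply: eq_supp_int => x Sx; apply: IH; exact: lipseq_cons.
Qed.

Lemma le_iter_int m F G : lipseq m F -> lipseq m G ->
  (forall z, seqs S m z -> F z <= G z) -> iter_int m F <= iter_int m G.
Proof.
elim: m F G => [|m IH] F G lF lG FG /=; first exact: FG.
apply: le_supp_int; [exact: lipfun_iter_int..|] => x Sx.
by apply: IH; [exact: lipseq_cons..|] => z zS; apply: FG.
Qed.

(** By induction the inner integral is positive at the first entry of z, and it is a
Lipschitz function of that entry. *)
Lemma iter_int_gt0 m F z : lipseq m F -> (forall w, seqs S m w -> 0 <= F w) ->
  seqs S m z -> 0 < F z -> 0 < iter_int m F.
Proof.
elim: m F z => [|m IH] F [|x z] //= lF F0 [Sx zS] Fz.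
apply: (@supp_int_gt0 _ _ _ x) => //; first exact: lipfun_iter_int.
  move=> y Sy; rewrite -(mul0r (mass X ^+ m)) -iter_int_cst; apply: le_iter_int.
  - exact: lipseq_cst.
  - exact: lipseq_cons.
  - by move=> w wS; apply: F0.
by apply: (IH _ z) => //; [exact: lipseq_cons|move=> w wS; apply: F0].
Qed.

Lemma lipseq_sum (I : Type) (r : seq I) (F : I -> seq X -> R) m :
  (forall i, lipseq m (F i)) -> lipseq m (fun z => \sum_(i <- r) F i z).
Proof.
move=> lF; elim: r => [|i r IH].
  by under eq_fun do rewrite big_nil; exact: lipseq_cst.
by under eq_fun do rewrite big_cons; exact: lipseqD.
Qed.

Lemma iter_int_sum (I : Type) (r : seq I) (F : I -> seq X -> R) m :
  (forall i, lipseq m (F i)) ->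
  iter_int m (fun z => \sum_(i <- r) F i z) = \sum_(i <- r) iter_int m (F i).
Proof.
move=> lF; elim: r => [|i r IH].
  rewrite big_nil -[RHS](mul0r (mass X ^+ m)) -iter_int_cst.
  by apply: eq_iter_int => z _; rewrite big_nil.
rewrite big_cons -IH -iter_intD//; last exact: lipseq_sum.
by apply: eq_iter_int => z _; rewrite big_cons.
Qed.

End IteratedIntegral.
Arguments iter_int {R} X m F.
Arguments lipschitz_seq {R} X m L B F.
Arguments lipseq {R} X m F.

Section SecondMoment.
Context {R : realType} (X : mfmSpace R).
Local Notation S := (@supp R X).
Variables (g : X -> R) (C : R).
Hypotheses (lg : lipfun X g) (gC : forall x, S x -> `|g x| <= C) (g0 : supp_int X g = 0).
Hypothesis C0 : 0 <= C.

Definition sumg (z : seq X) : R := \sum_(x <- z) g x.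

Lemma lipseq_sumg m : lipseq X m sumg.
Proof.
have [L [B [L0 gB gL]]] := lg.
exists L, (C * m%:R); split=> //; first exact: mulr_ge0.
  move=> z; elim: m z => [|m IH] [|x z] //= h; rewrite /sumg ?big_nil ?normr0 ?mulr_ge0//.
  case: h => Sx zS; rewrite big_cons; apply: le_trans (ler_normD _ _) _.
  by rewrite -natr1 mulrDr mulr1 addrC lerD ?gC// IH.
move=> z w; elim: m z w => [|m IH] [|x z] [|y w] //=.
  by move=> _ _; rewrite subrr normr0 mulr0.
move=> [Sx zS] [Sy wS]; rewrite /sumg !big_cons opprD addrACA mulrDr.
apply: le_trans (ler_normD _ _) _; apply: lerD; first exact: gL.
exact: IH.
Qed.

Lemma iter_int_sumg m : iter_int X m sumg = 0.
Proof.
elim: m => [|m IH]; first by rewrite /= /sumg big_nil.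
rewrite /= -[RHS](mul0r (mass X ^+ m)) -g0 mulrC -supp_intZ//.
apply: eq_supp_int => x Sx; rewrite -[RHS]addr0 -IH mulrC -iter_int_cst -iter_intD.
- by apply: eq_iter_int => z _; rewrite /sumg big_cons.
- exact: lipseq_cst.
- exact: lipseq_sumg.
Qed.

(** Variance of a sum of m independent centred variables: the mixed terms vanish
because g integrates to 0. *)
Lemma iter_int_sumg2 m : iter_int X m (fun z => sumg z * sumg z) <= m%:R * C ^+ 2 * mass X ^+ m.
Proof.
elim: m => [|m IH]; first by rewrite /= /sumg big_nil !mul0r.
have ls := lipseq_sumg m; have lss := lipseqM ls ls.
rewrite [iter_int _ _ _]/=.
set J := iter_int X m (fun z => sumg z * sumg z) in IH *.
have -> : supp_int X (fun x => iter_int X m (fun z => sumg (x :: z) * sumg (x :: z))) =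
    supp_int X (fun x => g x * g x * mass X ^+ m + J).
  apply: eq_supp_int => x Sx; rewrite -iter_int_cst /J -iter_intD//; last exact: lipseq_cst.
  rewrite -[RHS]addr0 -[X in _ + X](mulr0 (2 * g x)) -(iter_int_sumg m) -iter_intZ// -iter_intD//.
  - by apply: eq_iter_int => z _; rewrite /sumg big_cons; ring.
  - by apply: lipseqD => //; exact: lipseq_cst.
  - exact: lipseqZ.
apply: (@le_trans _ _ (supp_int X (fun=> C ^+ 2 * mass X ^+ m + m%:R * C ^+ 2 * mass X ^+ m))).
  apply: le_supp_int.
  - apply: lipfunD; last exact: lipfun_cst.
    by apply: lipfunM; [exact: lipfunM|exact: lipfun_cst].
  - exact: lipfun_cst.
  - move=> x Sx; apply: lerD => //; apply: ler_wpM2r; first exact: massX_ge0.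
    rewrite -expr2 -[_ ^+ 2]ger0_norm ?sqr_ge0// normrX ler_sqr ?nnegrE//; exact: gC.
by rewrite supp_int_cst -natr1 [mass X ^+ m.+1]exprSr le_eqVlt; apply/orP; left; apply/eqP; ring.
Qed.

End SecondMoment.

(** * Finite image and product measures, and the space of distance matrices *)

Section FiniteMeasurePack.
Context {R : realType} d (T : measurableType d) (f : set T -> \bar R).
Hypotheses (f0 : f set0 = 0%E) (f_ge0 : forall A, (0 <= f A)%E).
Hypotheses (fs : semi_sigma_additive f) (fT : f setT \is a fin_num).

Let g of f set0 = 0%E & (forall A, (0 <= f A)%E) & semi_sigma_additive f := f.
Local Notation h := (g f0 f_ge0 fs).
HB.instance Definition _ := isMeasure.Build _ _ _ h f0 f_ge0 fs.

Let finh : fin_num_fun h.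
Proof.
move=> A mA; rewrite ge0_fin_numE//; apply: (@le_lt_trans _ _ (h setT)).
  by apply: le_measure; rewrite ?inE.
by rewrite -ge0_fin_numE.
Qed.
HB.instance Definition _ := @Measure_isFinite.Build _ T R h finh.

(** Makes the theory of bundled finite measures available for a bare set function. *)
Lemma finite_measure_pack :
  exists nu : {finite_measure set T -> \bar R}, (nu : set T -> \bar R) = f.
Proof. by exists h. Qed.

End FiniteMeasurePack.

(** The values of f outside D do not matter, so that measurability on D suffices. *)
Lemma finite_pushforward_on {R : realType} d1 d2 (T1 : measurableType d1)
    (T2 : measurableType d2) (m : {finite_measure set T1 -> \bar R}) (D : set T1)
    (f : T1 -> T2) : measurable D -> measurable_fun D f ->
  exists nu : {finite_measure set T2 -> \bar R},
    (nu : set T2 -> \bar R) = pushforward_on m D f.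
Proof.
move=> mD mf; apply: finite_measure_pack.
- by rewrite /pushforward_on preimage_set0 setI0 measure0.
- by move=> A; exact: measure_ge0.
- move=> F mF tF mUF; rewrite /pushforward_on preimage_bigcup setI_bigcupr.
  apply: measure_semi_sigma_additive.
  + by move=> n; exact: mf.
  + apply/trivIsetP => /= i j _ _ ij; rewrite setIACA setIid -preimage_setI.
    by move/trivIsetP : tF => /(_ _ _ _ _ ij) ->//; rewrite preimage_set0 setI0.
  + by rewrite -setI_bigcupr -preimage_bigcup; exact: mf.
- by rewrite /pushforward_on preimage_setT setIT fin_num_measure.
Qed.

Lemma finite_pushforward {R : realType} d1 d2 (T1 : measurableType d1)
    (T2 : measurableType d2) (m : {finite_measure set T1 -> \bar R}) (f : T1 -> T2) :
  measurable_fun setT f ->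
  exists nu : {finite_measure set T2 -> \bar R}, (nu : set T2 -> \bar R) = pushforward m f.
Proof.
move=> mf; have [nu nuE] := finite_pushforward_on m measurableT mf.
by exists nu; rewrite nuE; apply/funext => A; rewrite /pushforward_on setTI.
Qed.

Lemma finite_product {R : realType} d1 d2 (T1 : measurableType d1)
    (T2 : measurableType d2) (m1 : {finite_measure set T1 -> \bar R})
    (m2 : {finite_measure set T2 -> \bar R}) :
  exists nu : {finite_measure set (T1 * T2)%type -> \bar R},
    (nu : set (T1 * T2)%type -> \bar R) = (m1 \x m2)%E.
Proof.
apply: finite_measure_pack.
- exact: measure0.
- by move=> A; exact: measure_ge0.
- exact: measure_semi_sigma_additive.
- by rewrite -setXTT product_measure1E//; apply: fin_numM; exact: fin_num_measure.
Qed.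

Section MeasurableDistances.
Context {R : realType} (X : mfmSpace R).

(** By separability the distance is the countable infimum over n of
mdist (q n) x + mdist (q n) y, with q dense, and is thus measurable for the
product of the Borel sigma-algebras. *)
Lemma measurable_mdist d (T : measurableType d) (f g : T -> borel X) :
  measurable_fun setT f -> measurable_fun setT g ->
  measurable_fun setT (fun t => mdist (f t : X) (g t : X)).
Proof.
move=> mf mg; have [q qd] := separable_seq X.
have mq n (h : T -> borel X) : measurable_fun setT h ->
    measurable_fun setT (fun t => mdist (q n) (h t : X)).
  move=> mh; apply: (measurableT_comp (f := (mdist (q n) : borel X -> R))) => //.
  apply: measurable_continuous => x; apply/cvgrPdist_lt => e e0.
  apply/nbhs_mdistE; exists e => // y xy.
  have := metric_triangle (q n) x y; have := metric_triangle (q n) y x.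
  by rewrite (metric_sym y x) ltr_norml => *; apply/andP; split; lra.
rewrite (_ : (fun t => _) =
    fun t => infs (fun n => mdist (q n) (f t : X) + mdist (q n) (g t : X)) 0).
  apply: measurable_fun_infs.
  - by move=> t _; exists 0 => _ [n _ <-]; rewrite addr_ge0 ?mdist_ge0.
  - by move=> n; apply: measurable_funD; exact: mq.
apply/funext => t; apply/eqP; rewrite eq_le; apply/andP; split.
  apply: lb_le_inf; first by exists (mdist (q 0) (f t : X) + mdist (q 0) (g t : X)), 0.
  move=> _ [n _ <-]; rewrite (metric_sym (q n) (f t)); exact: metric_triangle.
apply/ler_addgt0Pr => e e0.
have [|n fn] := qd (f t) (e / 2); first by rewrite divr_gt0.
apply: (@le_trans _ _ (mdist (q n) (f t : X) + mdist (q n) (g t : X))).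
  apply: ge_inf; last by exists n.
  by exists 0 => _ [k _ <-]; rewrite addr_ge0 ?mdist_ge0.
have := metric_triangle (q n) (f t) (g t); rewrite (metric_sym (q n) (f t)); lra.
Qed.

End MeasurableDistances.

Section DistanceSpace.
Context {R : realType} (m : nat).
Implicit Types a b : distances (R := R) m.

(** Among the equivalent metrics, the sum makes the triangle inequality immediate. *)
Definition ddist a b : R := \sum_(i : index_pairs m) `|a i - b i|.

Lemma ddistxx a : ddist a a = 0.
Proof. by rewrite /ddist big1// => i _; rewrite subrr normr0. Qed.

Lemma ddist_ge0 a b : 0 <= ddist a b.
Proof. by apply: sumr_ge0. Qed.

Lemma ddist_sym a b : ddist a b = ddist b a.
Proof. by apply: eq_bigr => i _; rewrite distrC. Qed.

Lemma ddist_triangle a b c : ddist a c <= ddist a b + ddist b c.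
Proof. by rewrite -big_split; apply: ler_sum => i _; exact: ler_distD. Qed.

Lemma ddist_coord a b i : `|a i - b i| <= ddist a b.
Proof. by rewrite /ddist (bigD1 i)//= lerDl sumr_ge0. Qed.

Lemma ddist_le a b e : (forall i, `|a i - b i| <= e) -> ddist a b <= e * #|{: index_pairs m}|%:R.
Proof.
move=> abe; rewrite mulr_natr -sumr_const; apply: ler_sum => i _; exact: abe.
Qed.

Lemma ddist_nbhs a (U : set (distances m)) :
  nbhs a U <-> exists2 e : R, 0 < e & forall b, ddist a b < e -> U b.
Proof.
split=> [aU|[e e0 eU]].
  pose F : set_system (distances m) :=
    filter_from [set e : R | 0 < e] (fun e => [set b | ddist a b < e]).
  have FF : Filter F.
    apply: filter_from_filter; first by exists 1 => /=.
    move=> e e' /= e0 e'0; exists (Num.min e e'); first by rewrite /= lt_min e0.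
    by move=> b /=; rewrite lt_min => /andP[].
  suff /(_ U aU) [e e0 eU] : F --> a by exists e.
  apply/(@pointwise_cvgP (discrete_topology (index_pairs m)) R F a) => i.
  apply/cvgrPdist_lt => e e0.
  by exists e => // b /= ab; apply: le_lt_trans ab; exact: ddist_coord.
pose N := #|{: index_pairs m}|%:R : R.
have N1 : 0 < N + 1 by rewrite ltr_wpDl.
pose P i : set (distances m) := [set b | `|a i - b i| < e / (N + 1)].
have FN : Filter (nbhs a) := nbhs_filter a.
have pr i : (fun g : distances m => g i) @ nbhs a --> nbhs (a i).
  by apply: (@proj_continuous (index_pairs m) (fun=> R) i a).
have nP i : nbhs a (P i).
  have e1 : 0 < e / (N + 1) by rewrite divr_gt0.
  exact: (cvgrPdist_lt _ _).1 (pr i) _ e1.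
have : nbhs a (fun b => forall i, P i b) by exact: (@filter_forall _ _ P (nbhs a) FN nP).
apply: filterS => b ab; apply: eU; apply: le_lt_trans (ddist_le (fun i => ltW (ab i))) _.
by rewrite mulrAC ltr_pdivrMr// -/N; lra.
Qed.

End DistanceSpace.

(** * Product measures and the distance matrix distribution as iterated integrals *)

Lemma sub_seqs (T : Type) (S S' : set T) m z : S `<=` S' -> seqs S m z -> seqs S' m z.
Proof. by move=> sub; elim: m z => [|m IH] [|x z] //= [/sub Sx /IH]. Qed.

Section MeasurableDistanceMatrix.
Context {R : realType} (m : nat).

Let N : R := #|{: index_pairs m}|%:R.

Local Notation DD := (distances (R := R) m).

(** An open set of distance matrices is the union of the rational boxes that it
contains, of which there are countably many. *)
Lemma measurable_coord d (T : measurableType d) (h : T -> DD) :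
  (forall i, measurable_fun setT (fun t => h t i)) ->
  measurable_fun setT (h : T -> borel DD).
Proof.
move=> mh; apply: (@measurability _ _ T (borel DD) setT h (@open DD) erefl).
move=> _ [U oU <-]; rewrite setTI.
pose box (p : {ffun index_pairs m -> rat} * rat) : set DD :=
  [set b | forall i, `|b i - ratr (p.1 i)| < ratr p.2].
pose G p : set T := [set t | box p (h t) /\ box p `<=` U].
rewrite (_ : h @^-1` U = \bigcup_p G p).
  apply: countable_bigcupT_measurable; first exact: countableP.
  move=> p.
  have [pU|pU] := pselect (box p `<=` U); last first.
    by rewrite (_ : G p = set0) //; apply/seteqP; split=> [t []|].
  rewrite (_ : G p = \bigcap_(i in [set: index_pairs m])
     ((fun t => h t i) @^-1` `]ratr (p.1 i) - ratr p.2, ratr (p.1 i) + ratr p.2[%classic));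
     last first.
    apply/seteqP; split=> t /=.
      by move=> [bt _] i _ /=; rewrite in_itv/= -ltr_distl; exact: bt.
    by move=> bt; split=> // i; have := bt i I; rewrite /= in_itv/= -ltr_distl.
  apply: fin_bigcap_measurable; first exact: finite_finset.
  move=> i _.
  by rewrite -[X in measurable X]setTI; apply: mh.
apply/seteqP; split=> [t /= Ut|t [p _ [bt pU]]]; last exact: pU.
have /ddist_nbhs[e e0 eU] : nbhs (h t) U by apply: open_nbhs_nbhs.
have N1 : 0 < N + 1 by rewrite ltr_wpDl.
pose r := e / (N + 1) / 2.
have r0 : 0 < r by rewrite !divr_gt0.
have [q] : exists q : rat, (0 < ratr q :> R) /\ (ratr q < r).
  have [q] := @rat_in_itvoo R 0 r r0.
  by rewrite in_itv/= => /andP[q0 qr]; exists q.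
move=> [q0 qr].
have /choice[f fP] : forall i, exists s : rat, `|h t i - ratr s| < ratr q.
  move=> i; have [|s] := @rat_in_itvoo R (h t i - ratr q) (h t i + ratr q).
    by lra.
  by rewrite in_itv/= -ltr_distl distrC => ?; exists s.
exists ([ffun i => f i], q) => //; split.
  by move=> i /=; rewrite ffunE; exact: fP.
move=> b bb; apply: eU.
apply: le_lt_trans (ddist_le (e := 2 * r) _) _.
  move=> i; have := bb i; rewrite /= ffunE => bi; have hi := fP i.
  rewrite (le_trans (ler_distD (ratr (f i)) _ _))// (distrC _ (b i)).
  lra.
rewrite -/N /r mulrCA divff// mulr1 mulrAC ltr_pdivrMr//; nra.
Qed.

End MeasurableDistanceMatrix.

Section PowerMeasure.
Context {R : realType} (X : mfmSpace R).
Local Notation mu := (mfm_measure X).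

Lemma integral_supp_int (f : X -> R) L B : lipschitz_on setT L B f ->
  (\int[mu]_x (f x)%:E)%E = (supp_int X f)%:E.
Proof.
move=> Lf; have [L0 fB fL] := Lf.
have fi : mu.-integrable setT (EFin \o (f : borel X -> R)).
  apply: (@bounded_integrable _ _ _ mu setT B) => //.
  exact: measurable_lipschitz_on Lf.
rewrite (@negligible_integral _ _ _ mu _ (~` @supp R X)) //; last first.
  - exact: supp_full.
  - by apply: measurableC; exact: measurable_supp.
rewrite setTD setCK EFin_Rintegral//; first exact: measurable_supp.
by apply: integrableS fi => //; exact: measurable_supp.
Qed.

(** Fubini, one coordinate at a time.  The inner integral is Lipschitz in the outer
variable. *)
Lemma measure_powerP k : exists nu : {finite_measure set (k.-tuple (borel X)) -> \bar R},
  (nu : set (k.-tuple (borel X)) -> \bar R) = measure_power mu k /\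
  forall (F : seq X -> R) L B,
    measurable_fun setT (fun z : k.-tuple (borel X) => F (tval z)) ->
    0 <= L -> 0 <= B -> (forall z, seqs setT k z -> `|F z| <= B) ->
    (forall z w, seqs setT k z -> seqs setT k w -> `|F z - F w| <= L * dsum z w) ->
    (\int[nu]_z (F (tval z))%:E)%E = (iter_int X k F)%:E.
Proof.
elim: k => [|k [nu [nuE IH]]].
  exists (\d_([tuple] : 0.-tuple (borel X))); split => // F L B mF _ _ _ _ /=.
  by rewrite integral_dirac// ?diracT ?mul1e//; exact/measurable_EFinP.
pose c : borel X * k.-tuple (borel X) -> k.+1.-tuple (borel X) :=
  fun p => [tuple of p.1 :: p.2].
have mc : measurable_fun setT c.
  by apply: measurable_cons; [exact: measurable_fst|exact: measurable_snd].
have [pr prE] := finite_product mu nu.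
have [nu' nu'E] := finite_pushforward pr mc.
exists nu'; split; first by rewrite nu'E prE nuE.
move=> F L B mF L0 B0 FB FL.
have tS j (z : j.-tuple (borel X)) : seqs setT j (tval z).
  by rewrite -[X in seqs _ X](size_tuple z); apply: seqsP.
rewrite nu'E prE.
have mFc : measurable_fun setT (fun p => F (tval (c p))) by exact: measurableT_comp mF mc.
have iFc : (mu \x nu)%E.-integrable setT (fun p => (F (tval (c p)))%:E).
  rewrite -prE; apply: (@bounded_integrable _ _ _ pr setT B) => //.
  by move=> p _; apply: FB; exact: tS.
rewrite (@integral_pushforward _ _ _ _ R c mc (mu \x nu)%E setT (fun z => (F (tval z))%:E)) //.
- rewrite preimage_setT -(integral12_prod_meas1 iFc) /=.
  rewrite -(integral_supp_int (L := L * mass X ^+ k) (B := B * mass X ^+ k)); last first.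
    have lF x : lipseq X k (fun z => F (x :: z)).
      exists L, B; split=> // [z zS|z w zS wS].
        by apply: FB; split=> //; exact: sub_seqs zS.
      have zT := sub_seqs (@subsetT _ _) zS; have wT := sub_seqs (@subsetT _ _) wS.
      have := FL (x :: z) (x :: w) (conj I zT) (conj I wT).
      by rewrite /= mdistxx add0r.
    split; first by rewrite mulr_ge0 ?massX_ge0.
      move=> x _; rewrite -[X in `|X|]subr0 -[X in _ - X](mul0r (mass X ^+ k)) -iter_int_cst.
      apply: iter_int_dist => //; first exact: lipseq_cst.
      by move=> z zS; rewrite subr0; apply: FB; split=> //; exact: sub_seqs zS.
    move=> x y _ _; rewrite mulrAC; apply: iter_int_dist => //.
      by rewrite mulr_ge0 ?mdist_ge0.
    move=> z zS; have zT := sub_seqs (@subsetT _ _) zS.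
    by have := FL (x :: z) (y :: z) (conj I zT) (conj I zT); rewrite /= dsumxx addr0.
  apply: eq_integral => x _; rewrite /fubini_F /=; apply: (IH (fun z => F (x :: z)) L B) => //.
  + exact: (measurable_fun_pair2 x mFc).
  + by move=> z zS; apply: FB.
  + move=> z w zS wS; have := FL (x :: z) (x :: w) (conj I zS) (conj I wS).
    by rewrite /= mdistxx add0r.
- exact/measurable_EFinP.
Qed.

End PowerMeasure.

Section DistancesOfTuple.
Context {R : realType} (T : pmetricType R).

(** The distance matrix of a rooted tuple, as a function of a bare sequence in any
pointed metric space: the default value of nth is the root. *)
Definition distances_of (m : nat) (z : seq T) : distances (R := R) m :=
  fun ij => mdist (nth (point : T) ((point : T) :: z) (sval ij).1)
                  (nth (point : T) ((point : T) :: z) (sval ij).2).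

Arguments distances_of : clear implicits.

Lemma dist_nth_le (p : T) (z w : seq T) i : size z = size w ->
  mdist (nth p z i) (nth p w i) <= dsum z w.
Proof.
elim: z w i => [|x z IH] [|y w] i //=; first by rewrite nth_nil mdistxx.
move=> [/IH zw]; case: i => [|i] /=; first by rewrite lerDl dsum_ge0.
by apply: le_trans (zw i) _; rewrite lerDr mdist_ge0.
Qed.

Lemma distances_of_coord_dist m (z w : seq T) ij : size z = size w ->
  `|distances_of m z ij - distances_of m w ij| <= 2 * dsum z w.
Proof.
move=> zw; rewrite /distances_of.
set p := point; set i := (sval ij).1 : nat; set j := (sval ij).2 : nat.
have hi := @dist_nth_le p (p :: z) (p :: w) i (congr1 S zw).
have hj := @dist_nth_le p (p :: z) (p :: w) j (congr1 S zw).
move: hi hj; rewrite [dsum (p :: z) (p :: w)]/= mdistxx add0r.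
move: (nth p (p :: z) i) (nth p (p :: z) j) (nth p (p :: w) i) (nth p (p :: w) j).
move=> a b a' b' hi hj.
have h1 := metric_triangle a a' b; have h2 := metric_triangle a' b' b.
have h3 := metric_triangle a' a b'; have h4 := metric_triangle a b b'.
move: h2 h3; rewrite (metric_sym b' b) (metric_sym a' a) => h2 h3.
by rewrite ler_norml; apply/andP; split; lra.
Qed.

Lemma distances_of_lipschitz m (z w : seq T) : size z = size w ->
  ddist (distances_of m z) (distances_of m w) <= 2 * #|{: index_pairs m}|%:R * dsum z w.
Proof.
move=> zw; rewrite mulrAC; apply: ddist_le => ij; exact: distances_of_coord_dist.
Qed.

End DistancesOfTuple.
Arguments distances_of {R T} m z.

Section DistanceMatrix.
Context {R : realType} (X : mfmSpace R).
Local Notation mu := (mfm_measure X).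

Lemma distance_matrixE m (z : m.-tuple (borel X)) :
  distance_matrix z = distances_of m (tval z : seq X).
Proof.
by apply/funext => ij; rewrite /distance_matrix /distances_of !(tnth_nth (point : X)).
Qed.

Lemma measurable_distance_matrix m :
  measurable_fun setT (@distance_matrix R X m).
Proof.
apply: measurable_coord => ij; rewrite /distance_matrix.
apply: measurable_mdist.
  case: (unliftP ord0 (sval ij).1) => [i|] ->.
    by under eq_fun do rewrite tnthS; exact: measurable_tnth.
  by under eq_fun do rewrite tnth0; exact: measurable_cst.
case: (unliftP ord0 (sval ij).2) => [i|] ->.
  by under eq_fun do rewrite tnthS; exact: measurable_tnth.
by under eq_fun do rewrite tnth0; exact: measurable_cst.
Qed.

Lemma lipschitz_seq_distances_of m f L B : d_lipschitz (@ddist R m) L B f ->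
  lipschitz_seq X m (L * (2 * #|{: index_pairs m}|%:R)) B (fun z => f (distances_of m z)).
Proof.
move=> [L0 fB fL]; split.
- by rewrite !mulr_ge0.
- exact: le_trans (normr_ge0 _) (fB point).
- by move=> z _; exact: fB.
- move=> z w /seqs_size zs /seqs_size ws; apply: le_trans (fL _ _) _.
  by rewrite -mulrA; apply: ler_wpM2l => //; apply: distances_of_lipschitz; rewrite zs.
Qed.

Lemma distribution_finite m : exists nu : {finite_measure set (borel (distances m)) -> \bar R},
  (nu : set (borel (distances m)) -> \bar R) = distance_matrix_distribution X (m := m).
Proof.
have [nu [nuE _]] := measure_powerP X m.
rewrite /distance_matrix_distribution -nuE.
exact: finite_pushforward (@measurable_distance_matrix m).
Qed.

Lemma integral_distribution m f L B : d_lipschitz (@ddist R m) L B f ->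
  (\int[distance_matrix_distribution X (m := m)]_a (f a)%:E)%E =
  (iter_int X m (fun z => f (distances_of m z)))%:E.
Proof.
move=> fL; have [nu [nuE nuI]] := measure_powerP X m.
have cf : continuous f.
  exact: d_lipschitz_continuous (@ddist_ge0 R m) (@ddist_nbhs R m) _ _ _ fL.
have mf : measurable_fun setT (f : borel (distances m) -> R) by exact: measurable_continuous.
have mD := @measurable_distance_matrix m.
have mfD := measurableT_comp mf mD.
have [L0 fB fLip] := fL.
have [K0 B0 KB KL] := lipschitz_seq_distances_of fL.
have eqD : (f \o @distance_matrix R X m) =
    fun z : m.-tuple (borel X) => f (distances_of m (tval z)).
  by apply/funext => z /=; rewrite distance_matrixE.
rewrite -(nuI (fun z => f (distances_of m z)) (L * (2 * #|{: index_pairs m}|%:R)) B) //.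
- rewrite /distance_matrix_distribution -nuE.
  rewrite (@integral_pushforward _ _ _ _ R _ mD nu setT (fun a => (f a)%:E)) //.
  + rewrite preimage_setT; apply: eq_integral => z _ /=.
    by rewrite distance_matrixE.
  + exact/measurable_EFinP.
  + rewrite preimage_setT.
    by apply: (@bounded_integrable _ _ _ nu setT B) => // z _; exact: fB.
- by rewrite -eqD.
- move=> z w /seqs_size zs /seqs_size ws; apply: le_trans (fLip _ _) _.
  by rewrite -mulrA; apply: ler_wpM2l => //; apply: distances_of_lipschitz; rewrite zs.
Qed.

End DistanceMatrix.

(** Lipschitz test functions suffice, and their integrals are iterated integrals. *)
Lemma gromov_weakP {R : realType} (X_ : nat -> mfmSpace R) (X : mfmSpace R) :
  gromov_weak_cvg X_ X <->
  forall m f L B, d_lipschitz (@ddist R m) L B f -> forall e, 0 < e ->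
    \forall n \near \oo, `|iter_int (X_ n) m (fun z => f (distances_of m z)) -
                           iter_int X m (fun z => f (distances_of m z))| <= e.
Proof.
split=> [gw m f L B fL|H m].
  have cf : continuous f.
    exact: d_lipschitz_continuous (@ddist_ge0 R m) (@ddist_nbhs R m) _ _ _ fL.
  have := gw m f cf; rewrite (integral_distribution X fL).
  move=> h; apply/cvg_EFinP.
  rewrite (_ : (fun n => _) =
    fun n => (\int[distance_matrix_distribution (X_ n) (m := m)]_a (f a)%:E)%E).
    by apply: h; exists B => a; case: fL.
  by apply/funext => n; rewrite (integral_distribution _ fL).
have [nu nuE] := distribution_finite X m.
have /choice[nu_ nu_E] : forall n, exists nu : {finite_measure set (borel (distances m)) -> \bar R},
  (nu : set (borel (distances m)) -> \bar R) = distance_matrix_distribution (X_ n) (m := m).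
  by move=> n; exact: distribution_finite.
rewrite -nuE.
rewrite (_ : (fun n => _) = (fun n => nu_ n : set (borel (distances m)) -> \bar R)); last first.
  by apply/funext => n; rewrite nu_E.
apply: (weak_cvg_lipschitz (@ddistxx R m) (@ddist_ge0 R m) (@ddist_triangle R m)
  (@ddist_sym R m) (@ddist_nbhs R m)) => f L B fL.
rewrite nuE (integral_distribution X fL).
rewrite (_ : (fun n => _) = fun n => (iter_int (X_ n) m (fun z => f (distances_of m z)))%:E).
  by apply/cvg_EFinP; exact: H fL.
by apply/funext => n; rewrite nu_E (integral_distribution _ fL).
Qed.

(** * Gluing metric spaces *)

Section MetricIdentification.
Context {R : realType} (Z : Type) (z0 : Z) (d : Z -> Z -> R).
Hypotheses (dxx : forall x, d x x = 0) (dsym : forall x y, d x y = d y x).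
Hypothesis dtri : forall x y z, d x z <= d x y + d y z.

Let zero_class z := [set z' | d z z' = 0].
Let identification := {C : set Z | exists z, C = zero_class z}.
Let class_of z : identification := exist _ (zero_class z) (ex_intro _ z erefl).
Let repr (p : identification) : Z := projT1 (cid (svalP p)).

Let reprE p : sval p = zero_class (repr p).
Proof. by rewrite /repr; case: cid. Qed.

Let d_repr z : d z (repr (class_of z)) = 0.
Proof.
have : zero_class (repr (class_of z)) (repr (class_of z)) by rewrite /zero_class /= dxx.
by rewrite -reprE.
Qed.

Let d0_eq x y z : d x y = 0 -> d x z = d y z.
Proof.
move=> xy; apply/eqP; rewrite eq_le; apply/andP; split.
  by have := dtri x y z; rewrite xy add0r.
by have := dtri y x z; rewrite (dsym y x) xy add0r.
Qed.

HB.instance Definition _ := gen_eqMixin identification.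
HB.instance Definition _ := gen_choiceMixin identification.

Let dist p q := d (repr p) (repr q).

Let dist_pos p q : dist p q = 0 -> p = q.
Proof.
move=> pq; have : sval p = sval q.
  by rewrite !reprE; apply/seteqP; split=> z; rewrite /zero_class /= (d0_eq _ pq).
by case: p q {pq} => [C c] [C' c'] /= CC'; exact: eq_exist.
Qed.

HB.instance Definition _ := @isMetric.Build R identification dist
  (fun p => dxx _) dist_pos (fun p q => dsym _ _) (fun p q r => dtri _ _ _).
HB.instance Definition _ := isPointed.Build identification (class_of z0).

(** The quotient of a pseudometric space by the relation of being at distance 0,
realised as the type of its classes. *)
Lemma metric_identification : exists (E : pmetricType R) (f : Z -> E),
  [/\ forall x y, mdist (f x) (f y) = d x y, f z0 = point &
      forall p, exists z, f z = p].
Proof.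
exists identification, class_of; split => // [x y|p].
  rewrite /mdist /= /dist -(d0_eq _ (d_repr x)) dsym.
  by rewrite -(d0_eq _ (d_repr y)) dsym.
by exists (repr p); apply: dist_pos; rewrite /dist dsym d_repr.
Qed.

End MetricIdentification.

Section Bridge.
Context {R : realType}.

(** The mixed distances of a pseudometric on the disjoint union of two pointed
metric spaces that extends both metrics and identifies the roots. *)
Record bridge (X Y : pmetricType R) (D : X -> Y -> R) : Prop := {
  bridge_ge0 : forall x y, 0 <= D x y ;
  bridge_root : D point point = 0 ;
  bridge_l : forall x x' y, D x y <= mdist x x' + D x' y ;
  bridge_r : forall x y y', D x y <= D x y' + mdist y' y ;
  bridge_ll : forall x x' y, mdist x x' <= D x y + D x' y ;
  bridge_rr : forall x y y', mdist y y' <= D x y + D x y' }.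

Lemma bridge_mdist (X : pmetricType R) : bridge (fun x y : X => mdist x y).
Proof.
split.
- exact: mdist_ge0.
- exact: mdistxx.
- by move=> *; exact: metric_triangle.
- by move=> *; exact: metric_triangle.
- by move=> x x' y; rewrite (metric_sym x' y); exact: metric_triangle.
- by move=> x y y'; rewrite (metric_sym x y); exact: metric_triangle.
Qed.

(** Joining the points a j and b j by segments of length w j creates no
shortcut inside either space as soon as the distortion of the correspondence
is at most w i + w j. *)
Lemma bridge_glue (X Y : pmetricType R) (J : Type) (j0 : J) (a : J -> X)
    (b : J -> Y) (w : J -> R) :
  (forall j, 0 <= w j) -> w j0 = 0 -> a j0 = point -> b j0 = point ->
  (forall i j, `|mdist (a i) (a j) - mdist (b i) (b j)| <= w i + w j) ->
  exists2 D : X -> Y -> R, bridge D & forall j, D (a j) (b j) <= w j.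
Proof.
move=> w0 wj0 aj0 bj0 ab.
pose P x y := [set mdist x (a j) + w j + mdist (b j) y | j in [set: J]].
have P0 x y : P x y !=set0 by exists (mdist x (a j0) + w j0 + mdist (b j0) y), j0.
have Pge x y t : P x y t -> 0 <= t.
  by move=> [j _ <-]; rewrite !addr_ge0 ?mdist_ge0.
have Plb x y : has_lbound (P x y) by exists 0 => t /Pge.
have infle x y j : inf (P x y) <= mdist x (a j) + w j + mdist (b j) y.
  by apply: ge_inf => //; exists j.
have abl i j : mdist (a i) (a j) <= mdist (b i) (b j) + (w i + w j).
  by have := ab i j; rewrite ler_norml => /andP[_]; lra.
have abr i j : mdist (b i) (b j) <= mdist (a i) (a j) + (w i + w j).
  by have := ab i j; rewrite ler_norml => /andP[]; lra.
have le_inf2 t x y x' y' : (forall j k,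
   t <= (mdist x (a j) + w j + mdist (b j) y) + (mdist x' (a k) + w k + mdist (b k) y')) ->
   t <= inf (P x y) + inf (P x' y').
  move=> h; rewrite -lerBlDr; apply: lb_le_inf => // _ [j _ <-].
  by rewrite lerBlDr -lerBlDl; apply: lb_le_inf => // _ [k _ <-]; rewrite lerBlDl.
exists (fun x y => inf (P x y)); last first.
  by move=> j; have := infle (a j) (b j) j; rewrite !mdistxx add0r addr0.
split.
- by move=> x y; apply: lb_le_inf => // t /Pge.
- apply/eqP; rewrite eq_le; apply/andP; split; last by apply: lb_le_inf => // t /Pge.
  by have := infle point point j0; rewrite aj0 bj0 wj0 !mdistxx !addr0.
- move=> x x' y; rewrite -lerBlDl; apply: lb_le_inf => // _ [j _ <-].
  by have := infle x y j; have := metric_triangle x x' (a j); lra.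
- move=> x y y'; rewrite -lerBlDr; apply: lb_le_inf => // _ [j _ <-].
  by have := infle x y j; have := metric_triangle (b j) y' y; lra.
- move=> x x' y; apply: le_inf2 => j k.
  have := metric_triangle x (a j) x'; have := metric_triangle (a j) (a k) x'.
  have := metric_triangle (b j) y (b k); have := abl j k.
  rewrite (metric_sym (a k) x') (metric_sym y (b k)); lra.
- move=> x y y'; apply: le_inf2 => j k.
  have := metric_triangle y (b j) y'; have := metric_triangle (b j) (b k) y'.
  have := metric_triangle (a j) x (a k); have := abr j k.
  rewrite (metric_sym y (b j)) (metric_sym (a j) x); lra.
Qed.

Lemma bridge_wedge (X Y : pmetricType R) : exists D : X -> Y -> R, bridge D.
Proof.
have h (_ _ : unit) : `|mdist (point : X) point - mdist (point : Y) point| <= 0 + 0 :> R.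
  by rewrite !mdistxx subrr normr0 addr0.
have [D Db _] := @bridge_glue X Y unit tt (fun=> point) (fun=> point) (fun=> 0)
  (fun=> lexx 0) erefl erefl erefl h.
by exists D.
Qed.

End Bridge.

Section Amalgam.
Context {R : realType} (X : pmetricType R) (I : choiceType) (W : I -> pmetricType R).
Variables (D : forall i, X -> W i -> R) (i0 : I).
Hypothesis bD : forall i, bridge (@D i).

Let Z := {i : I & W i}.
Let hub (p : Z) x := @D (tag p) x (tagged p).
(** A point is joined to another either inside their common piece or through a point
x of the hub X; dZ is the infimum of the lengths of these routes. *)
Let routes (p q : Z) : set R := [set t |
  (tag p = tag q /\ t = mdist (tagged p) (tagged_as p q)) \/
  exists x, t = hub p x + hub q x].
Let dZ p q := inf (routes p q).

Let routes_ge0 p q t : routes p q t -> 0 <= t.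
Proof.
by case=> [[_ ->]|[x ->]]; rewrite ?addr_ge0 ?mdist_ge0//; exact: bridge_ge0.
Qed.

Let routes0 p q : routes p q !=set0.
Proof. by exists (hub p point + hub q point); right; exists point. Qed.

Let routes_lb p q : has_lbound (routes p q).
Proof. by exists 0 => t /routes_ge0. Qed.

Let routes_sym p q t : routes p q t -> routes q p t.
Proof.
case=> [[pq ->]|[x ->]]; last by right; exists x; rewrite addrC.
left; split=> //; case: p q pq => [i y] [j y'] /= ij; case: _ / ij y' => y'.
by rewrite !tagged_asE metric_sym.
Qed.

Let routes_tri p q s t u : routes p q t -> routes q s u ->
  exists2 v, routes p s v & v <= t + u.
Proof.
case: p q s => [i y] [j y'] [k y''].
case=> [[/= ij ->]|[x ->]].
  case: _ / ij y' => y'; rewrite tagged_asE.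
  case=> [[/= ik ->]|[x ->]].
    case: _ / ik y'' => y''; rewrite tagged_asE.
    exists (mdist y y''); last exact: metric_triangle.
    by left; rewrite tagged_asE.
  exists (hub (existT _ i y) x + hub (existT _ k y'') x); first by right; exists x.
  rewrite /hub /= addrA lerD2r addrC (metric_sym y y').
  exact: (bridge_r (bD i)).
case=> [[/= jk ->]|[x' ->]].
  case: _ / jk y'' => y''; rewrite tagged_asE.
  exists (hub (existT _ i y) x + hub (existT _ j y'') x); first by right; exists x.
  by rewrite /hub /= -addrA lerD2l; exact: (bridge_r (bD j)).
exists (hub (existT _ i y) x + hub (existT _ k y'') x); first by right; exists x.
rewrite /hub /=.
have := bridge_l (bD k) x x' y''; have := bridge_ll (bD j) x x' y'; lra.
Qed.

Let dZxx p : dZ p p = 0.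
Proof.
apply/eqP; rewrite eq_le; apply/andP; split; last by apply: lb_le_inf => // t /routes_ge0.
by apply: ge_inf => //; left; case: p => i y; rewrite tagged_asE mdistxx.
Qed.

Let dZsym p q : dZ p q = dZ q p.
Proof. by congr inf; apply/seteqP; split=> t; exact: routes_sym. Qed.

Let dZtri p q s : dZ p s <= dZ p q + dZ q s.
Proof.
rewrite -lerBlDr; apply: lb_le_inf => // t pt.
rewrite lerBlDr -lerBlDl; apply: lb_le_inf => // u qu.
have [v sv vtu] := routes_tri pt qu.
by rewrite lerBlDl; apply: le_trans vtu; apply: ge_inf.
Qed.

(** Routes can be concatenated without becoming longer (routes_tri), and a detour
through the hub never shortens a distance inside one piece (bridge_rr). *)
Lemma amalgam : exists (E : pmetricType R) (f : forall i, W i -> E),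
  [/\ forall i y y', mdist (f i y) (f i y') = mdist y y',
      forall i, f i point = point &
      forall i j y y' x, mdist (f i y) (f j y') <= @D i x y + @D j x y'].
Proof.
have [E [f [fd f0 _]]] := metric_identification (existT W i0 point : Z) dZxx dZsym dZtri.
exists E, (fun i y => f (existT _ i y)); split.
- move=> i y y'; rewrite fd; apply/eqP; rewrite eq_le; apply/andP; split.
    by apply: ge_inf => //; left; rewrite tagged_asE.
  apply: lb_le_inf => // t [[_ ->]|[x ->]]; first by rewrite tagged_asE.
  exact: (bridge_rr (bD i)).
- move=> i; rewrite -f0; apply: mdist_positivity; rewrite fd.
  apply/eqP; rewrite eq_le; apply/andP; split; last by apply: lb_le_inf => // t /routes_ge0.
  apply: ge_inf => //; right; exists point.
  by rewrite /hub /= (bridge_root (bD i)) (bridge_root (bD i0)) addr0.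
- by move=> i j y y' x; rewrite fd; apply: ge_inf => //; right; exists x.
Qed.

End Amalgam.

(** The case of amalgam in which the hub is itself one of the pieces, at index None. *)
Lemma amalgam_along {R : realType} (X : pmetricType R) (Y : nat -> pmetricType R)
    (D : forall n, X -> Y n -> R) : (forall n, bridge (@D n)) ->
  exists (E : pmetricType R) (f : X -> E) (g : forall n, Y n -> E),
  [/\ forall x x', mdist (f x) (f x') = mdist x x',
      forall n y y', mdist (g n y) (g n y') = mdist y y',
      f point = point, forall n, g n point = point &
      forall n x y, mdist (f x) (g n y) <= D n x y].
Proof.
move=> bD.
pose W (o : option nat) : pmetricType R := if o is Some n then Y n else X.
pose D' (o : option nat) : X -> W o -> R :=
  match o return X -> W o -> R with Some n => @D n | None => fun x y => mdist x y end.
have bD' o : bridge (D' o) by case: o => [n|]; [exact: bD|exact: bridge_mdist].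
have [E [f [fi f0 fD]]] := amalgam None bD'.
exists E, (f None), (fun n => f (Some n)); split.
- exact: (fi None).
- by move=> n; exact: (fi (Some n)).
- exact: (f0 None).
- by move=> n; exact: (f0 (Some n)).
- by move=> n x y; have := fD None (Some n) x y x; rewrite /D'/= mdistxx add0r.
Qed.

(** * Nets, packings and compactness *)

Section Nets.
Context {R : realType}.

Definition net (T : metricType R) (S : set T) (e : R) (s : seq T) :=
  (forall c, c \in s -> S c) /\
  forall x, S x -> exists2 c, c \in s & mdist x c <= e.

Definition totally_bounded (T : metricType R) (S : set T) :=
  forall e, 0 < e -> exists s, net S e s.

Definition separated (T : metricType R) (e : R) (s : seq T) :=
  pairwise (fun x y => e < mdist x y) s.

(** A separated set of maximal size is a net, since any point far from all of its
members could be added. *)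
Lemma packing_net (T : metricType R) (S : set T) (e : R) (K : nat) :
  (forall s, (forall c, c \in s -> S c) -> separated e s -> (size s <= K)%N) ->
  exists s, net S e s /\ (size s <= K)%N.
Proof.
move=> HK; pose P n := `[< exists s : seq T,
  [/\ forall c, c \in s -> S c, separated e s & size s = n] >].
have P0 : exists n, P n by exists 0; apply/asboolP; exists [::].
have PK n : P n -> (n <= K)%N by move=> /asboolP[s [sS ss <-]]; exact: HK.
have [n /asboolP[s [sS ss sn]] nmax] := ex_maxnP P0 PK.
exists s; split; last exact: HK.
split=> // x Sx; apply: contrapT => nx.
have : P n.+1.
  apply/asboolP; exists (x :: s); split; last by rewrite /= sn.
    by move=> c; rewrite inE => /orP[/eqP ->|/sS].
  rewrite /separated pairwise_cons; apply/andP; split=> //.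
  by apply/allP => c cs; rewrite ltNge; apply/negP => xc; apply: nx; exists c.
by move=> /nmax; rewrite ltnn.
Qed.

Lemma positive_lower_bound (T : eqType) (s : seq T) (g : T -> R) :
  (forall c, c \in s -> 0 < g c) -> exists2 e, 0 < e & forall c, c \in s -> e <= g c.
Proof.
elim: s => [|x s IH] gs; first by exists 1.
have [|e e0 es] := IH; first by move=> c cs; apply: gs; rewrite inE cs orbT.
exists (Num.min (g x) e).
  by rewrite lt_min e0 andbT; apply: gs; rewrite mem_head.
move=> c; rewrite inE => /orP[/eqP ->|/es ec]; first by rewrite ge_min lexx.
by rewrite ge_min ec orbT.
Qed.

(** The centres in t need not lie in the image of S: each ball that meets the image
is recentred at a point of S, at the price of doubling its radius. *)
Lemma net_pullback (T U : metricType R) (S : set T) (f : T -> U) (e : R) (t : seq U) :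
  isometric_on S f ->
  exists2 s : seq T, (forall c, c \in s -> S c) &
    forall x, S x -> (exists2 u, u \in t & mdist (f x) u <= e / 2) ->
      exists2 c, c \in s & mdist x c <= e.
Proof.
move=> fS; elim: t => [|u t [s sS st]].
  by exists [::] => // x _ [].
have [[x0 [Sx0 x0u]]|nx] := pselect (exists x, S x /\ mdist (f x) u <= e / 2).
  exists (x0 :: s); first by move=> c; rewrite inE => /orP[/eqP ->|/sS].
  move=> x Sx [v]; rewrite inE => /orP[/eqP -> xu|vt xv].
    exists x0; first by rewrite mem_head.
    rewrite -(fS _ _ Sx Sx0) (le_trans (metric_triangle _ u _))// (metric_sym u).
    by rewrite (splitr e) lerD.
  have [|c cs xc] := st x Sx; first by exists v.
  by exists c => //; rewrite inE cs orbT.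
exists s => // x Sx [v]; rewrite inE => /orP[/eqP -> xu|vt xv].
  by exfalso; apply: nx; exists x.
by apply: st => //; exists v.
Qed.

Lemma compact_net (T : pmetricType R) (e : R) : compact [set: T] -> 0 < e ->
  exists t : seq T, forall x, exists2 u, u \in t & mdist x u <= e.
Proof.
move=> cT e0; move: (cT); rewrite compact_cover => /(_ T setT (fun x => [set y | mdist x y < e])).
case=> [x _|x _|t _ tc].
- exact: open_mball.
- by exists x => //=; rewrite mdistxx.
exists (finmap.enum_fset t) => x; have [u ut /= ux] := tc x I.
by exists u => //; rewrite metric_sym ltW.
Qed.

Lemma isometric_on_preimage_open (T E : pmetricType R) (S : set T) (f : T -> E) (U : set E) :
  isometric_on S f -> open U ->
  exists2 V : set T, open V & S `&` f @^-1` U = S `&` V.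
Proof.
move=> fS oU.
exists [set y | exists x r, [/\ S x, (forall z, mdist (f x) z < r -> U z) & mdist x y < r]].
  rewrite openE => y [x [r [Sx xU xy]]].
  apply/nbhs_mdistE; exists (r - mdist x y); first by rewrite subr_gt0.
  by move=> z yz; exists x, r; split=> //; have := metric_triangle x y z; lra.
apply/seteqP; split=> x [Sx] /=.
  move=> Ufx; split=> //.
  have /nbhs_mdistE[r r0 rU] : nbhs (f x) U by apply: open_nbhs_nbhs.
  by exists x, r; split=> //; rewrite mdistxx.
by move=> [y [r [Sy yU yx]]]; split=> //; apply: yU; rewrite fS.
Qed.

Lemma measurable_isometric_on (T E : pmetricType R) (S : set T) (f : T -> E) :
  measurable (S : set (borel T)) -> isometric_on S f ->
  measurable_fun (S : set (borel T)) (f : borel T -> borel E).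
Proof.
move=> mS fS; apply: (@measurability _ _ (borel T) (borel E) S f (@open E) erefl).
move=> _ [U oU <-]; have [V oV ->] := isometric_on_preimage_open fS oU.
by apply: measurableI => //; exact: borel_open.
Qed.

(** An ultrafilter contains one of finitely many balls of any given radius that cover
the space; hence it is Cauchy, and converges by completeness. *)
Lemma totally_bounded_compact (T : completeMetricType R) :
  totally_bounded [set: T] -> compact [set: T].
Proof.
move=> tb; rewrite compact_ultra => F FU FT.
suff : cauchy F by move=> /cauchy_cvg; exists (lim F).
apply: cauchy_exP => e e0.
have [s [_ sT]] := tb (e / 2) (divr_gt0 e0 (ltr0Sn _ 1)).
have : F [set x | exists2 c, c \in s & mdist x c <= e / 2] by apply: filterS FT => x _; exact: sT.
elim: s {sT} => [|c s IH] Fs.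
  by have [x []] := filter_ex Fs.
have [Fc|Fc] := in_ultra_setVsetC (ball c e) FU; first by exists c.
apply: IH; apply: filterS (filterI Fs Fc) => x [[d]].
rewrite inE => /orP[/eqP ->|ds] xd; last by exists d.
rewrite ballEmdist /= metric_sym => /negP; rewrite -leNgt => ex.
by exfalso; move: xd; rewrite leNgt (lt_le_trans _ ex)// ltr_pdivrMr//; lra.
Qed.

Lemma totally_bounded_separable (T : completeMetricType R) :
  totally_bounded [set: T] -> separable T.
Proof.
move=> tb.
have /choice[s sP] : forall k : nat, exists s : seq T, net [set: T] k.+1%:R^-1 s.
  by move=> k; apply: tb; rewrite invr_gt0.
exists (\bigcup_k [set` s k]).
  apply: bigcup_countable => [|k _]; first exact: countableP.
  exact: finite_set_countable (finite_seq _).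
move=> U [x Ux] oU; have /nbhs_mdistE[e e0 eU] : nbhs x U by apply: open_nbhs_nbhs.
have [k ke] : exists k : nat, k.+1%:R^-1 < e.
  have e1 : 0 < e^-1 by rewrite invr_gt0.
  exists (Num.truncn e^-1); rewrite invf_plt ?posrE//.
  by have /andP[] := truncn_itv (ltW e1).
have [_ /(_ x I)[c cs xc]] := sP k.
exists c; split; last by exists k.
by apply: eU; exact: le_lt_trans xc ke.
Qed.

End Nets.

(** * Lower mass bounds *)

Section MassBound.
Context {R : realType} (X : mfmSpace R).
Local Notation mu := (mfm_measure X).
Local Notation S := (@supp R X).

Definition mass_bound (d c : R) := forall x, S x -> c <= fine (mu (cball x d)).

Lemma cball_fineE (x : X) (d : R) : mu (cball x d) = (fine (mu (cball x d)))%:E.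
Proof. by rewrite fineK// fin_num_measure//; exact: measurable_cball. Qed.

Lemma lower_massP d c : (c%:E <= lower_mass d X)%E <-> mass_bound d c.
Proof.
split=> [cl x Sx|cS].
  rewrite -lee_fin -cball_fineE; apply: le_trans cl _.
  apply: (@le_trans _ _ (lower_mass_in (mdist (point : X) x + 1) d X)).
    by apply: ereal_inf_lbound; exists (mdist (point : X) x + 1); rewrite //= ltr_wpDl ?mdist_ge0.
  apply: ereal_inf_lbound; exists x => //; split=> //.
  by rewrite ballEmdist /= ltrDl.
apply: le_ereal_inf_tmp => _ [r r0 <-]; apply: le_ereal_inf_tmp => _ [x [_ Sx] <-].
by rewrite cball_fineE lee_fin; exact: cS.
Qed.

(** Every ball of radius d around a support point contains a ball of radius d / 2
around one of the finitely many points of a d / 2-net, and these have positive mass. *)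
Lemma totally_bounded_mass_bound d : totally_bounded S -> 0 < d ->
  exists2 c, 0 < c & mass_bound d c.
Proof.
move=> tb d0; have [s [sS sn]] := tb (d / 2) (divr_gt0 d0 (ltr0Sn _ 1)).
have [|c c0 cs] := @positive_lower_bound R _ s (fun c => fine (mu (cball c (d / 2)))).
  move=> c /sS Sc; rewrite fine_gt0// ltey_eq fin_num_measure ?andbT//; last first.
    exact: measurable_cball.
  apply: lt_le_trans (Sc _ (open_mball c (d / 2)) _) _; first by rewrite /= mdistxx divr_gt0.
  apply: le_measure; rewrite ?inE.
  - by apply: borel_open; exact: open_mball.
  - exact: measurable_cball.
  - by move=> y /= /ltW.
exists c => // x Sx; have [a /cs ca xa] := sn x Sx.
apply: le_trans ca _; apply: fine_le.
- by apply: fin_num_measure; exact: measurable_cball.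
- by apply: fin_num_measure; exact: measurable_cball.
apply: le_measure; rewrite ?inE; [exact: measurable_cball..|].
move=> y; rewrite /cball /= => ay; rewrite (le_trans (metric_triangle x a y))//.
by rewrite (splitr d) lerD.
Qed.

(** The balls of radius d around 2d-separated points are disjoint. *)
Lemma separated_mass d c s : mass_bound d c -> (forall x, x \in s -> S x) ->
  separated (2 * d) s -> (size s)%:R * c <= mass X.
Proof.
move=> cS sS ss.
pose U (s : seq X) : set (borel X) := [set y | exists2 x, x \in s & mdist x y <= d].
have mU t : measurable (U t).
  elim: t => [|x t IH]; first by rewrite (_ : U [::] = set0)//; apply/seteqP; split=> y [].
  rewrite (_ : U (x :: t) = cball x d `|` U t).
    by apply: measurableU => //; exact: measurable_cball.
  apply/seteqP; split=> y.
    by move=> [z]; rewrite inE => /orP[/eqP ->|zt] zy; [left|right; exists z].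
  by move=> [xy|[z zt zy]]; [exists x; rewrite ?mem_head|exists z; rewrite ?inE ?zt ?orbT].
suff : (size s)%:R * c <= fine (mu (U s)).
  move/le_trans; apply; apply: fine_le; [exact: fin_num_measure..|].
  by apply: le_measure; rewrite ?inE.
elim: s sS ss => [|x s IH] sS; first by rewrite mul0r fine_ge0.
rewrite /separated pairwise_cons => /andP[xs ss].
have -> : U (x :: s) = cball x d `|` U s.
  apply/seteqP; split=> y.
    by move=> [z]; rewrite inE => /orP[/eqP ->|zt] zy; [left|right; exists z].
  by move=> [xy|[z zt zy]]; [exists x; rewrite ?mem_head|exists z; rewrite ?inE ?zt ?orbT].
rewrite measureU//; [|exact: measurable_cball|]; last first.
  apply/seteqP; split=> // y [xy [z zs zy]].
  have := allP xs _ zs; have := metric_triangle x y z.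
  rewrite (metric_sym y z); move: xy; rewrite /cball /=; lra.
rewrite fineD; [|apply: fin_num_measure; exact: measurable_cball|exact: fin_num_measure].
rewrite /= -natr1 mulrDl mul1r addrC lerD//; first by apply: cS; apply: sS; rewrite mem_head.
by apply: IH => // y ys; apply: sS; rewrite inE ys orbT.
Qed.

Lemma mass_bound_net d c K : mass_bound d c -> 0 < c -> mass X <= K%:R * c ->
  exists s, net S (2 * d) s /\ (size s <= K)%N.
Proof.
move=> cS c0 MK; apply: packing_net => s sS ss.
rewrite -(@ler_nat R) -(ler_pM2r c0); apply: le_trans MK.
exact: separated_mass ss.
Qed.

End MassBound.

Section Compactness.
Context {R : realType}.

Lemma closed_rooted_supp (X : mfmSpace R) : closed (@rooted_supp R X).
Proof.
apply: closedU; first exact: closed_supp.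
exact: accessible_closed_set1 (hausdorff_accessible (@metric_hausdorff _ X)) _.
Qed.

Lemma mfm_compact_totally_bounded (X : mfmSpace R) :
  mfm_compact X -> totally_bounded (@supp R X).
Proof.
move=> [Y [phi [iso _ _ _]] cY] e e0.
have [t tY] := @compact_net R Y (e / 2) cY (divr_gt0 e0 (ltr0Sn _ 1)).
have iS : isometric_on (@supp R X) phi.
  by move=> x y Sx Sy; apply: iso; left.
have [s sS st] := net_pullback e t iS.
by exists s; split=> // x Sx; apply: st.
Qed.

Section CompletePack.
Variables (E : pmetricType R).
Hypothesis cE : forall F : set_system E, ProperFilter F -> cauchy F -> cvg F.
Let completed of (forall F : set_system E, ProperFilter F -> cauchy F -> cvg F) : Type := E.
HB.instance Definition _ := PointedMetric.copy (completed cE) E.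
HB.instance Definition _ := Uniform_isComplete.Build (completed cE) cE.

(** Turns a proof of completeness into a structure, for a space constructed inside a
proof. *)
Lemma complete_metric_pack : exists (Y : completeMetricType R) (g : E -> Y),
  [/\ forall x y, mdist (g x) (g y) = mdist x y, forall y, exists x, g x = y &
    g point = point].
Proof. by exists (completed cE), id; split=> // y; exists y. Qed.
End CompletePack.

(** The compact representative is the rooted support itself, with the restricted
metric and the image of the measure.  It is closed in a complete space, hence
complete, and it is totally bounded. *)
Lemma support_compact (X : mfmSpace R) :
  totally_bounded (@supp R X) -> mfm_compact X.
Proof.
move=> tb; pose K : set X := rooted_supp (X := X).
have cK : closed K by exact: closed_rooted_supp.
have mK := borel_closed cK.
pose Z := {x : X | K x}.
pose z0 : Z := exist _ (point : X) (or_intror erefl).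
have [E [f [fd f0 fs]]] := @metric_identification R Z z0
  (fun z w => mdist (sval z) (sval w)) (fun z => mdistxx _)
  (fun z w => metric_sym _ _) (fun x y z => metric_triangle _ _ _).
have /choice[h hf] := fs.
pose g e : X := sval (h e).
have gK e : K (g e) by exact: svalP.
have gi e e' : mdist (g e) (g e') = mdist e e' by rewrite -fd !hf.
have gs x : K x -> exists e, g e = x.
  move=> Kx; exists (f (exist _ x Kx)); apply: mdist_positivity.
  by rewrite -[x in mdist _ x]/(sval (exist _ x Kx : Z)) -fd hf mdistxx.
have cE : forall F : set_system E, ProperFilter F -> cauchy F -> cvg F.
  move=> F PF /cauchyP cF.
  have cG : cauchy (g @ F).
    apply: cauchy_exP => e e0; have [x Fx] := cF e e0; exists (g x).
    suff : F (g @^-1` ball (g x) e) by [].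
    by apply: filterS Fx => y; rewrite /= !ballEmdist /= gi.
  have PG : ProperFilter (g @ F) := fmap_proper_filter g PF.
  have gl := @cauchy_cvg X (g @ F) PG cG.
  have nK : \forall e \near F, K (g e) by exact: nearW.
  have Kl := @closed_cvg _ X F PF g K cK nK _ gl.
  have [l gle] := gs _ Kl.
  apply/cvg_ex; exists l; move=> U /nbhs_mdistE[r r0 rU].
  have : nbhs (lim (g @ F)) [set y | mdist (g l) y < r].
    by apply/nbhs_mdistE; exists r => // y; rewrite gle.
  move=> /gl gF; suff : F U by [].
  have {}gF : F [set e | mdist (g l) (g e) < r] by exact: gF.
  by apply: filterS gF => e /=; rewrite gi; exact: rU.
have [Y0 [i [ii is_ i0]]] := complete_metric_pack cE.
pose p x : Y0 := i (if pselect (K x) is left Kx then f (exist _ x Kx) else point).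
have pE x (Kx : K x) : p x = i (f (exist _ x Kx)).
  by rewrite /p; case: pselect => // Kx'; congr (i (f _)); exact: eq_exist.
have piso : isometric_on K p.
  by move=> x y Kx Ky; rewrite !pE ii fd.
have p0 : p point = point.
  by rewrite (pE _ (or_intror erefl)) -[X in i (f X)]/z0 f0.
have ps y : exists2 x, K x & p x = y.
  have [e ey] := is_ y; exists (g e); first exact: gK.
  rewrite (pE _ (gK e)) -ey; congr i; rewrite -[RHS]hf; congr f.
  by move: (gK e); rewrite /g; case: (h e) => x Kx Kx'; exact: eq_exist.
have tY : totally_bounded [set: Y0].
  move=> e e0; have [s [sS sn]] := tb e e0.
  exists (p point :: map p s); split=> // y _; have [x Kx <-] := ps y.
  case: Kx => [Sx|->]; last by exists (p point); rewrite ?mem_head// mdistxx ltW.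
  have [c cs xc] := sn x Sx; exists (p c); first by rewrite inE map_f ?orbT.
  by rewrite piso //; left => //; exact: sS.
have cY := totally_bounded_compact tY.
have sepY := totally_bounded_separable tY.
have [nu nuE] := finite_pushforward_on (mfm_measure X) mK (measurable_isometric_on mK piso).
pose Y := MfmSpace sepY nu.
exists Y => //; exists p; split => //.
- apply/seteqP; split=> [y _|y _]; last by have [x Kx <-] := ps y; exists x.
  have [x Kx <-] := ps y; case: (Kx) => [Sx|->]; last by right.
  left => U oU Ux; rewrite /Y /= nuE /pushforward_on.
  have [V oV VU] : exists2 V : set X, open V & K `&` p @^-1` U = K `&` V.
    exact: isometric_on_preimage_open.
  have Vx : V x by suff : (K `&` V) x by [case]; rewrite -VU.
  apply: lt_le_trans (Sx V oV Vx) _; rewrite -(measure_suppI (borel_open oV)).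
  apply: le_measure; rewrite ?inE.
  + by apply: measurableI; [exact: borel_open|exact: measurable_supp].
  + suff : measurable (K `&` p @^-1` U : set (borel X)) by [].
    by rewrite VU; apply: measurableI => //; exact: borel_open.
  + by move=> z [Vz Sz]; suff : (K `&` p @^-1` U) z by []; rewrite VU; split=> //; left.
- by move=> A mA; rewrite /Y /= nuE.
Qed.

End Compactness.

(** * Partitions of unity and sampling *)

Section PartitionOfUnity.
Context {R : realType} (T : pmetricType R) (s : seq T) (eta : R).
Hypothesis eta0 : 0 < eta.

Let hat (c x : T) : R := Num.max 0 (2 * eta - mdist c x).
Let total (x : T) : R := \sum_(c <- s) hat c x.
Let height x := Num.max eta (total x).

(** Hats of radius 2 eta around the centres in s, divided by their total.  The lower
bound eta on the denominator keeps the quotient Lipschitz everywhere, and is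
inactive within eta of the centres, where the bumps add up to 1. *)
Definition bump (c x : T) : R := hat c x / height x.

Let hat_ge0 c x : 0 <= hat c x. Proof. by rewrite /hat le_max lexx. Qed.

Let hat_lip c x y : `|hat c x - hat c y| <= mdist x y.
Proof.
have e0 : 0 <= 2 * eta by rewrite mulr_ge0// ltW.
have [_ _ /(_ x y I I)] := @lipschitz_on_mdist R T setT c (2 * eta) e0.
by rewrite mul1r.
Qed.

Let hat_total c x : c \in s -> hat c x <= total x.
Proof.
rewrite /total; elim: (s) => // b t IH; rewrite inE big_cons => /orP[/eqP ->|/IH ct].
  by rewrite lerDl sumr_ge0.
by apply: le_trans ct _; rewrite lerDr.
Qed.

Let total_lip x y : `|total x - total y| <= (size s)%:R * mdist x y.
Proof.
rewrite /total; elim: (s) => [|b t IH]; first by rewrite !big_nil subrr normr0 mul0r.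
rewrite !big_cons opprD addrACA; apply: le_trans (ler_normD _ _) _.
rewrite /= -natr1 mulrDl mul1r [leRHS]addrC; apply: lerD IH; exact: hat_lip.
Qed.

Let height_gt0 x : 0 < height x.
Proof. by rewrite /height lt_max eta0. Qed.

Let height_lip x y : `|height x - height y| <= (size s)%:R * mdist x y.
Proof.
apply: le_trans (total_lip x y); rewrite /height.
case: (leP eta (total x)) => h1; case: (leP eta (total y)) => h2 //.
- by rewrite !ger0_norm ?subr_ge0//; lra.
- by rewrite !ler0_norm ?subr_le0//; lra.
- by rewrite subrr normr0.
Qed.

Lemma bump_ge0 c x : 0 <= bump c x.
Proof. by rewrite divr_ge0// ltW. Qed.

Lemma bump_le1 c x : c \in s -> bump c x <= 1.
Proof.
by move=> cs; rewrite ler_pdivrMr// mul1r le_max hat_total ?orbT.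
Qed.

Lemma bump_far c x : 2 * eta <= mdist c x -> bump c x = 0.
Proof. by move=> h; rewrite /bump /hat max_l ?mul0r// subr_le0. Qed.

Lemma sum_bump x : (exists2 c, c \in s & mdist x c <= eta) ->
  \sum_(c <- s) bump c x = 1.
Proof.
move=> [c cs xc]; have {}xc : mdist c x <= eta by rewrite metric_sym.
have hc : eta <= hat c x by rewrite le_max; apply/orP; right; lra.
have tot := le_trans hc (hat_total x cs).
by rewrite -mulr_suml /height max_r// divff// lt0r_neq0// (lt_le_trans eta0).
Qed.

Lemma bump_lipschitz c : c \in s ->
  lipschitz_on setT ((1 + (size s)%:R) / eta) 1 (bump c).
Proof.
move=> cs; split.
- by rewrite divr_ge0 ?addr_ge0// ltW.
- by move=> x _; rewrite ger0_norm ?bump_ge0// bump_le1.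
move=> x y _ _.
have hx := height_gt0 x; have hy := height_gt0 y.
rewrite [X in `|X|](_ : _ = (hat c x - hat c y) / height x +
    bump c y * ((height y - height x) / height x)); last first.
  by rewrite /bump; field; rewrite !lt0r_neq0.
apply: le_trans (ler_normD _ _) _.
rewrite normrM [X in _ + X]normrM [X in _ + _ * X]normrM normfV (ger0_norm (ltW hx)).
have bn : `|bump c y| <= 1 by rewrite ger0_norm ?bump_ge0// bump_le1.
have ix : (height x)^-1 <= eta^-1 by rewrite lef_pV2 ?posrE// le_max lexx.
have ix0 : 0 <= (height x)^-1 by rewrite invr_ge0 ltW.
rewrite [leRHS](_ : _ = mdist x y / eta + 1 * ((size s)%:R * mdist x y / eta)); last by ring.
apply: lerD; first by apply: ler_pM => //; exact: hat_lip.
apply: ler_pM => //; first by rewrite mulr_ge0.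
by apply: ler_pM => //; rewrite distrC; exact: height_lip.
Qed.

End PartitionOfUnity.

Lemma convex_approx {R : realType} (T : eqType) (s : seq T) (p a : T -> R) (v e : R) :
  (forall c, 0 <= p c) -> \sum_(c <- s) p c = 1 ->
  (forall c, c \in s -> p c != 0 -> `|v - a c| <= e) ->
  `|v - \sum_(c <- s) a c * p c| <= e.
Proof.
move=> p0 p1 ve; rewrite -[v]mulr1 -p1 mulr_sumr -sumrB.
apply: le_trans (ler_norm_sum _ _ _) _.
rewrite -[e]mulr1 -p1 mulr_sumr big_seq [leRHS]big_seq; apply: ler_sum => c cs.
have [->|pc] := eqVneq (p c) 0; first by rewrite !mulr0 subrr normr0.
by rewrite -mulrBl normrM (ger0_norm (p0 c)) ler_wpM2r// ve.
Qed.

Section Sampling.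
Context {R : realType}.

(** The tuple z, with weight mass X / size z at each entry, is within e of the measure
for the bounded Lipschitz distance. *)
Definition good_sample (X : mfmSpace R) (e : R) (z : seq X) :=
  forall f, lipschitz_on (@supp R X) 1 1 f ->
    `|supp_int X f - mass X / (size z)%:R * \sum_(x <- z) f x| <= e.

Lemma supp_int_sum (X : mfmSpace R) (I : Type) (s : seq I) (f : I -> X -> R) :
  (forall i, lipfun X (f i)) ->
  lipfun X (fun x => \sum_(i <- s) f i x) /\
  supp_int X (fun x => \sum_(i <- s) f i x) = \sum_(i <- s) supp_int X (f i).
Proof.
move=> lf; elim: s => [|i s [l IH]].
  split; first by under eq_fun do rewrite big_nil; exact: lipfun_cst.
  by under eq_supp_int do rewrite big_nil; rewrite big_nil supp_int_cst mul0r.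
split; first by under eq_fun do rewrite big_cons; exact: lipfunD.
by rewrite big_cons -IH -supp_intD//; apply: eq_supp_int => x _; rewrite big_cons.
Qed.

(** Q z is the sum of the squared sampling errors, in units of th, of the bumps
attached to a net.  Its iterated integral is at most K M^2 / (m th^2) times
mass X ^+ m.  When Q z < 1 every bump is sampled with an error of at most th, and
the combinations of bumps, which include every Lipschitz function up to 2 eta, are
sampled accurately as well.  The length m depends on X only through M and K.  The
conclusion is phrased with Q rather than with the measure of the set of good
tuples, whose measurability is not clear. *)
Lemma sampling (e M eta : R) (K : nat) : 0 < e -> 0 < eta -> 0 <= M ->
  8 * eta * M <= e -> exists m : nat, (0 < m)%N /\
  forall X : mfmSpace R, mass X <= M ->
    (exists s, net (@supp R X) eta s /\ (size s <= K)%N) ->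
    exists Q : seq X -> R, [/\ forall z, 0 <= Q z, lipseq X m Q,
      iter_int X m Q <= mass X ^+ m / 4 &
      forall z, seqs (@supp R X) m z -> Q z < 1 -> good_sample e z].
Proof.
move=> e0 eta0 M0 etaM.
pose th := e / (2 * (K%:R + 1)).
have K1 : 0 < K%:R + 1 :> R by rewrite ltr_wpDl.
have th0 : 0 < th by rewrite divr_gt0// mulr_gt0.
pose m := (Num.truncn (4 * K%:R * M ^+ 2 / th ^+ 2)).+1.
have mK : 4 * K%:R * M ^+ 2 <= m%:R * th ^+ 2.
  have h0 : 0 <= 4 * K%:R * M ^+ 2 / th ^+ 2.
    by apply: divr_ge0; [apply: mulr_ge0; [exact: mulr_ge0|exact: sqr_ge0]|exact: sqr_ge0].
  rewrite -ler_pdivrMr ?exprn_gt0// ltW//.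
  by have /andP[] := truncn_itv h0.
exists m; split=> // X XM [s [[sS sn] sK]].
have Ms := mass_ge0 X.
have m0 : 0 < m%:R :> R by [].
pose p c x : R := if c \in s then bump s eta c x else 0.
have lp c : lipfun X (p c).
  have [cs|cs] := boolP (c \in s); last first.
    rewrite (_ : p c = fun=> 0); first exact: lipfun_cst.
    by apply/funext => x; rewrite /p (negbTE cs).
  rewrite (_ : p c = bump s eta c); last by apply/funext => x; rewrite /p cs.
  have /(lipschitz_on_sub (@subsetT _ (@supp R X))) h := bump_lipschitz eta0 cs.
  by eexists; eexists; exact: h.
have p0 c x : 0 <= p c x by rewrite /p; case: ifPn => // _; exact: bump_ge0.
have p1 c x : p c x <= 1 by rewrite /p; case: ifPn => // cs; exact: bump_le1.
have psum x : @supp R X x -> \sum_(c <- s) p c x = 1.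
  move=> Sx; rewrite -(sum_bump eta0 (sn x Sx)) big_seq [RHS]big_seq.
  by apply: eq_bigr => c cs; rewrite /p cs.
pose g c x := mass X * p c x - supp_int X (p c).
have lg c : lipfun X (g c) by apply: lipfunB; [exact: lipfunZ|exact: lipfun_cst].
have supp_intp c : 0 <= supp_int X (p c) <= mass X.
  apply/andP; split.
    by rewrite -(mul0r (mass X)) -supp_int_cst; apply: le_supp_int => //; exact: lipfun_cst.
  by rewrite -[leRHS]mul1r -supp_int_cst; apply: le_supp_int => //; exact: lipfun_cst.
have g0 c : supp_int X (g c) = 0.
  rewrite supp_intB; [|exact: lipfunZ|exact: lipfun_cst].
  by rewrite supp_intZ// supp_int_cst mulrC subrr.
have gM c x : @supp R X x -> `|g c x| <= mass X.
  move=> _; have /andP[a0 aM] := supp_intp c; rewrite /g ler_norml.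
  have : 0 <= mass X * p c x by rewrite mulr_ge0.
  have : mass X * p c x <= mass X by rewrite -[leRHS]mulr1 ler_wpM2l.
  by move=> *; apply/andP; split; lra.
have lss c : lipseq X m (fun z => sumg (g c) z * sumg (g c) z).
  by apply: lipseqM; exact: (lipseq_sumg (lg c) (gM c) Ms).
have c0 : 0 <= (m%:R * th)^-1 ^+ 2 by exact: sqr_ge0.
exists (fun z => (m%:R * th)^-1 ^+ 2 * \sum_(c <- s) sumg (g c) z * sumg (g c) z).
split.
- by move=> z; rewrite mulr_ge0// sumr_ge0// => c _; rewrite -expr2 sqr_ge0.
- by apply: lipseqZ; exact: lipseq_sum.
- rewrite iter_intZ; last exact: lipseq_sum.
  rewrite iter_int_sum//.
  apply: (@le_trans _ _ ((m%:R * th)^-1 ^+ 2 *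
      (\sum_(c <- s) m%:R * mass X ^+ 2 * mass X ^+ m))).
    apply: ler_wpM2l => //; apply: ler_sum => c _.
    exact: (iter_int_sumg2 (lg c) (gM c) (g0 c) Ms).
  rewrite big_const_seq count_predT iter_addr_0 -mulr_natl.
  have sKR : (size s)%:R <= K%:R :> R by rewrite ler_nat.
  have MM : mass X ^+ 2 <= M ^+ 2 by rewrite ler_sqr ?nnegrE.
  have Mm := massX_ge0 X m.
  have h : (size s)%:R * mass X ^+ 2 * 4 <= m%:R * th ^+ 2.
    apply: le_trans mK; rewrite mulrC mulrA ler_pM ?mulr_ge0 ?sqr_ge0//.
    by rewrite ler_wpM2l.
  rewrite [leLHS](_ : _ = ((size s)%:R * mass X ^+ 2 * 4) / (m%:R * th ^+ 2) * (mass X ^+ m / 4)).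
    rewrite -[leRHS]mul1r ler_wpM2r ?divr_ge0//.
    by rewrite ler_pdivrMr ?mul1r// mulr_gt0// exprn_gt0.
  by field; rewrite !lt0r_neq0.
- move=> z zS Q1 f lf.
  have [_ fB fL] := lf.
  have zm := seqs_size zS.
  have gz c : c \in s -> `|mass X / m%:R * \sum_(x <- z) p c x - supp_int X (p c)| <= th.
    move=> cs.
    have : sumg (g c) z * sumg (g c) z <= (m%:R * th) ^+ 2.
      apply: (@le_trans _ _ (\sum_(c <- s) sumg (g c) z * sumg (g c) z)).
        rewrite (big_rem c)//= lerDl sumr_ge0// => b _.
        by rewrite -expr2 sqr_ge0.
      by move: Q1; rewrite exprVn mulrC ltr_pdivrMr ?mul1r ?exprn_gt0 ?mulr_gt0// => /ltW.
    rewrite -expr2 => sq.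
    have mth : 0 <= m%:R * th by rewrite mulr_ge0// ltW.
    have : `|sumg (g c) z| <= m%:R * th by rewrite -ler_sqr ?nnegrE// real_normK ?num_real.
    have -> : sumg (g c) z = m%:R * (mass X / m%:R * \sum_(x <- z) p c x - supp_int X (p c)).
      rewrite /sumg /g sumrB -mulr_sumr big_const_seq count_predT iter_addr_0 zm -mulr_natl.
      by field; rewrite lt0r_neq0.
    by rewrite normrM ger0_norm// ler_pM2l.
  have approx x : @supp R X x -> `|f x - \sum_(c <- s) f c * p c x| <= 2 * eta.
    move=> Sx; apply: convex_approx => //; first exact: psum.
    move=> b bs; rewrite /p bs => bc.
    rewrite (le_trans (fL _ _ Sx (sS b bs)))// mul1r metric_sym leNgt.
    by apply: contra bc => h; rewrite bump_far// ltW.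
  have lf' : lipfun X f by exists 1, 1.
  have [ls avs] := supp_int_sum s (fun c => lipfunZ (f c) (lp c)).
  have h1 : `|supp_int X f - \sum_(c <- s) f c * supp_int X (p c)| <= 2 * eta * mass X.
    rewrite (_ : \sum_(c <- s) _ = supp_int X (fun x => \sum_(c <- s) f c * p c x)).
      exact: supp_int_dist.
    by rewrite avs; apply: eq_bigr => b _; rewrite supp_intZ.
  have h2 : `|\sum_(c <- s) f c * supp_int X (p c) -
      \sum_(c <- s) f c * (mass X / m%:R * \sum_(x <- z) p c x)| <= e / 2.
    rewrite -sumrB; apply: le_trans (ler_norm_sum _ _ _) _.
    apply: (@le_trans _ _ (\sum_(c <- s) th)).
      rewrite big_seq [leRHS]big_seq; apply: ler_sum => b bs.
      rewrite -mulrBr normrM distrC -[th]mul1r ler_pM//; first exact: fB (sS b bs).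
      exact: gz.
    rewrite big_const_seq count_predT iter_addr_0 -[th *+ _]mulr_natl.
    apply: (@le_trans _ _ ((K%:R + 1) * th)).
      rewrite ler_wpM2r ?(ltW th0)//.
      have : (size s)%:R <= K%:R :> R by rewrite ler_nat.
      lra.
    rewrite [leLHS](_ : _ = e / 2)// /th; field; by rewrite lt0r_neq0.
  have h3 : `|mass X / m%:R * \sum_(x <- z) \sum_(c <- s) f c * p c x -
      mass X / m%:R * \sum_(x <- z) f x| <= 2 * eta * mass X.
    rewrite -mulrBr normrM ger0_norm ?divr_ge0// -sumrB.
    have h : `|\sum_(x <- z) (\sum_(c <- s) f c * p c x - f x)| <= m%:R * (2 * eta).
      apply: le_trans (ler_norm_sum _ _ _) _.
      rewrite -zm mulr_natl -[X in _ *+ X](count_predT z) -iter_addr_0 -big_const_seq.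
      rewrite big_seq [leRHS]big_seq; apply: ler_sum => x xz.
      by rewrite distrC; apply: approx; exact: seqs_mem zS xz.
    apply: (@le_trans _ _ (mass X / m%:R * (m%:R * (2 * eta)))).
      by rewrite ler_wpM2l ?divr_ge0.
    by rewrite le_eqVlt; apply/orP; left; apply/eqP; field; rewrite lt0r_neq0.
  rewrite zm.
  have e3 : \sum_(c <- s) f c * (mass X / m%:R * \sum_(x <- z) p c x) =
     mass X / m%:R * \sum_(x <- z) \sum_(c <- s) f c * p c x.
    rewrite exchange_big mulr_sumr; apply: eq_bigr => b _.
    by rewrite mulr_sumr mulr_sumr mulr_sumr; apply: eq_bigr => x _; ring.
  rewrite e3 in h2.
  have h4 : eta * mass X <= eta * M by rewrite ler_wpM2l// ltW.
  move: h1 h2 h3.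
  set a := supp_int X f; set b := \sum_(c <- s) _.
  set c' := mass X / _ * _; set d := mass X / _ * _.
  rewrite !ler_norml => /andP[? ?] /andP[? ?] /andP[? ?]; apply/andP; split; lra.
Qed.

End Sampling.

(** * Consequences of Gromov-weak convergence *)

(** The lower limit is the supremum of the tail infima, so it is positive exactly when
some tail is bounded away from 0. *)
Lemma limn_einf_gt0P {R : realType} (u : nat -> \bar R) :
  (0 < limn_einf u)%E <->
  exists2 c : R, 0 < c & \forall n \near \oo, (c%:E <= u n)%E.
Proof.
rewrite limn_einf_lim (cvg_lim _ (@cvg_einfs_sup _ u))//.
split=> [/ereal_sup_gt[_ [n _ <-]] l0|[c c0 [n _ nc]]].
  have [c c0 cl] : exists2 c : R, 0 < c & (c%:E <= einfs u n)%E.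
    move: l0; case: (einfs u n) => [r|_|//]; last by exists 1 => //; rewrite leey.
    by rewrite lte_fin => r0; exists r.
  exists c => //; exists n => // k /= nk; apply: le_trans cl _.
  by apply: ereal_inf_lbound; exists k.
apply: (@lt_le_trans _ _ c%:E); first by rewrite lte_fin.
apply: (@le_trans _ _ (einfs u n)); last by apply: ereal_sup_ubound; exists n.
by apply: le_ereal_inf_tmp => _ [k /= nk <-]; exact: nc.
Qed.

Section FromGromovWeak.
Context {R : realType} (X_ : nat -> mfmSpace R) (X : mfmSpace R).
Hypothesis gw : gromov_weak_cvg X_ X.

(** The total mass of the m-th power is the integral of the constant function 1 of
the distance matrix. *)
Lemma gw_mass m e : 0 < e -> \forall n \near \oo, `|mass (X_ n) ^+ m - mass X ^+ m| <= e.
Proof.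
move=> e0; have c1 : d_lipschitz (@ddist R m) 0 1 (fun=> 1).
  by split=> // *; rewrite ?normr1// subrr normr0 mul0r.
have := (gromov_weakP X_ X).1 gw m _ _ _ c1 e e0.
by apply: filterS => n; rewrite !iter_int_cst !mul1r.
Qed.

Lemma gw_mass1 e : 0 < e -> \forall n \near \oo, `|mass (X_ n) - mass X| <= e.
Proof. by move=> /(gw_mass 1). Qed.

(** The test function that singles out the matrices within r of a0. *)
Lemma hat_ddist m (a0 : distances m) (r : R) : 0 < r ->
  d_lipschitz (@ddist R m) 1 r (fun a => Num.max 0 (r - ddist a a0)).
Proof.
move=> r0; split=> // [a|a b].
  have := ddist_ge0 a a0.
  by case: (leP 0 (r - ddist a a0)) => h1 h2; rewrite ler_norml; apply/andP; split; lra.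
have := ddist_triangle a b a0; have := ddist_triangle b a a0.
rewrite (ddist_sym b a) mul1r => h1 h2; have := ddist_ge0 a b.
by case: (leP 0 (r - ddist a a0)) => ?; case: (leP 0 (r - ddist b a0)) => ? ?;
  rewrite ler_norml; apply/andP; split; lra.
Qed.

(** A tuple of support points of X charges every neighbourhood of its distance
matrix, so that approximate copies of it appear in the supports of X_ n. *)
Lemma gw_transfer m (z : seq X) (r : R) : 0 < r -> seqs (@supp R X) m z ->
  \forall n \near \oo, exists2 w : seq (X_ n), seqs (@supp R (X_ n)) m w &
    forall ij, `|distances_of m w ij - distances_of m z ij| < r.
Proof.
move=> r0 zS; pose f a := Num.max 0 (r - ddist a (distances_of m z)).
have fL := hat_ddist (distances_of m z) r0.
have lX (Y : mfmSpace R) : lipseq Y m (fun w => f (distances_of m w)).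
  by eexists; eexists; exact: lipschitz_seq_distances_of fL.
have f0 a : 0 <= f a by rewrite /f le_max lexx.
have I0 : 0 < iter_int X m (fun w => f (distances_of m w)).
  by apply: (@iter_int_gt0 _ _ _ _ z) => //; rewrite /f ddistxx subr0 lt_max r0 orbT.
have := (gromov_weakP X_ X).1 gw m _ _ _ fL _ (divr_gt0 I0 (ltr0Sn _ 1)).
apply: filterS => n; rewrite -/f ler_norml => /andP[In _].
apply: contrapT => nw.
have : iter_int (X_ n) m (fun w => f (distances_of m w)) <= iter_int (X_ n) m (fun=> 0).
  apply: le_iter_int => //; first exact: lipseq_cst.
  move=> w wS; rewrite /f ge_max lexx /= leNgt; apply/negP => fw.
  apply: nw; exists w => // ij; apply: le_lt_trans (ddist_coord _ _ ij) _.
  by rewrite -subr_gt0.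
rewrite iter_int_cst mul0r; move: In; lra.
Qed.

(** A separated tuple of X is approximated by separated tuples of the X_ n, whose
size is limited by their mass and the lower mass bound. *)
Lemma gw_totally_bounded :
  (forall d, 0 < d -> exists2 c : R, 0 < c & \forall n \near \oo, mass_bound (X_ n) d c) ->
  totally_bounded (@supp R X).
Proof.
move=> lm e e0; have [|c c0 cn] := lm (e / 4); first by rewrite divr_gt0.
pose K := (Num.truncn ((mass X + 1) / c)).+1.
have M1 : 0 <= (mass X + 1) / c by rewrite divr_ge0 ?addr_ge0 ?mass_ge0// ltW.
have [|s [sn _]] := @packing_net R X (@supp R X) e K; last by exists s.
move=> s sS ss; rewrite leqNgt; apply/negP => Ks.
have e2 : 0 < e / 2 by rewrite divr_gt0.
near \oo => n.
have [w wS wd] : exists2 w : seq (X_ n), seqs (@supp R (X_ n)) (size s) w &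
    forall ij, `|distances_of (size s) w ij - distances_of (size s) s ij| < e / 2.
  by near: n; apply: gw_transfer => //; exact: seqsP.
have nc : mass_bound (X_ n) (e / 4) c by near: n.
have nM : `|mass (X_ n) - mass X| <= 1 by near: n; exact: gw_mass1.
have ws := seqs_size wS.
have : (size w)%:R * c <= mass (X_ n).
  apply: (separated_mass nc); first by move=> x; exact: seqs_mem wS.
  apply/(pairwiseP (point : X_ n)) => i j; rewrite !inE ws => il jl ij.
  have ltij : ((inord i.+1 : 'I_(size s).+1) < (inord j.+1 : 'I_(size s).+1))%N.
    by rewrite !inordK.
  have := wd (exist _ (inord i.+1, inord j.+1) ltij).
  rewrite /distances_of /= !inordK//= ltr_norml => /andP[+ _].
  have := (pairwiseP (point : X) ss) i j il jl ij.
  lra.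
have : (mass X + 1) / c < K%:R by have /andP[] := truncn_itv M1.
rewrite ltr_pdivrMr// => MK.
have : K%:R * c <= (size w)%:R * c.
  by rewrite ler_wpM2r ?(ltW c0)// ler_nat ws ltnW.
move: nM; rewrite ler_norml => /andP[_]; lra.
Unshelve. all: by end_near. Qed.

End FromGromovWeak.

(** * Bridges between samples with similar distance matrices *)

Section Matching.
Context {R : realType}.

(** The bounded Lipschitz distance of the two measures in the space glued along D is at
most e: on the supports, such pairs f, g are the restrictions of Lipschitz functions
on that space. *)
Definition bl_close (X Y : mfmSpace R) (D : X -> Y -> R) (e : R) :=
  forall (f : X -> R) (g : Y -> R), lipschitz_on (@supp R X) 1 1 f ->
    lipschitz_on (@supp R Y) 1 1 g -> (forall x y, `|f x - g y| <= D x y) ->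
    `|supp_int X f - supp_int Y g| <= e.

Lemma supp_int_le_mass (X : mfmSpace R) f :
  lipschitz_on (@supp R X) 1 1 f -> `|supp_int X f| <= mass X.
Proof.
move=> lf; have [_ fB _] := lf.
rewrite -[leRHS]mul1r -[X in `|X|]subr0 -[X in _ - X](mul0r (mass X)) -supp_int_cst.
apply: supp_int_dist; [by exists 1, 1|exact: lipfun_cst|].
by move=> x Sx; rewrite subr0 fB.
Qed.

Section Near.
Variables (m : nat) (A : set (distances (R := R) m)) (r : R).
Hypothesis r0 : 0 < r.

(** A Lipschitz bump equal to 1 on A and vanishing at distance r from A. *)
Definition near_set (a : distances m) : R :=
  sup ([set 0] `|` [set 1 - ddist a b / r | b in A]).

Let pieces_ub a : ubound ([set 0] `|` [set 1 - ddist a b / r | b in A]) 1.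
Proof.
move=> _ [->//|[b _ <-]].
by rewrite gerBl divr_ge0 ?ddist_ge0// ltW.
Qed.

Let pieces_has_ub a : has_ubound ([set 0] `|` [set 1 - ddist a b / r | b in A]).
Proof. by exists 1; exact: pieces_ub. Qed.

Let pieces0 a : ([set 0] `|` [set 1 - ddist a b / r | b in A]) !=set0.
Proof. by exists 0; left. Qed.

Lemma near_set_ge0 a : 0 <= near_set a.
Proof. by apply: ub_le_sup => //; left. Qed.

Lemma near_set_le1 a : near_set a <= 1.
Proof. exact: ge_sup. Qed.

Lemma near_set1 a : A a -> near_set a = 1.
Proof.
move=> Aa; apply/eqP; rewrite eq_le near_set_le1 /=; apply: ub_le_sup => //.
by right; exists a => //; rewrite ddistxx mul0r subr0.
Qed.

Lemma near_set_gt0 a : 0 < near_set a -> exists2 b, A b & ddist a b < r.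
Proof.
move=> a0; apply: contrapT => nb; move: a0; rewrite ltNge => /negP; apply.
apply: ge_sup => // _ [->//|[b Ab <-]]; rewrite subr_le0 ler_pdivlMr// mul1r leNgt.
by apply/negP => ab; apply: nb; exists b.
Qed.

Lemma near_set_lipschitz : d_lipschitz (@ddist R m) r^-1 1 near_set.
Proof.
have step a b : near_set a - near_set b <= r^-1 * ddist a b.
  rewrite lerBlDl; apply: ge_sup => // _ [->|[c Ac <-]].
    by rewrite addr_ge0 ?near_set_ge0// mulr_ge0 ?ddist_ge0// invr_ge0 ltW.
  apply: (@le_trans _ _ ((1 - ddist b c / r) + r^-1 * ddist a b)).
    have ri : 0 <= r^-1 by rewrite invr_ge0 ltW.
    have := ler_wpM2r ri (ddist_triangle b a c).
    by rewrite (ddist_sym b a) mulrDl [r^-1 * _]mulrC; lra.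
  by rewrite lerD2r; apply: ub_le_sup => //; right; exists c.
split; first by rewrite invr_ge0 ltW.
  by move=> a; rewrite ger0_norm ?near_set_ge0// near_set_le1.
move=> a b; rewrite ler_norml lerNl opprB; apply/andP; split=> //.
by rewrite ddist_sym.
Qed.

End Near.

(** Along the bridge that joins x to y entry by entry, the sum of f over x and the sum
of g over y differ by at most m * e2; the other terms of the bound are the two
sampling errors and the difference of the total masses. *)
Lemma samples_bridge (X Y : mfmSpace R) m (x : seq X) (y : seq Y) (e1 e2 : R) :
  (0 < m)%N -> seqs (@supp R X) m x -> seqs (@supp R Y) m y -> 0 <= e2 ->
  good_sample e1 x -> good_sample e1 y ->
  ddist (distances_of m y) (distances_of m x) <= e2 ->
  exists2 D : X -> Y -> R, bridge D &
    bl_close D (e1 + mass X * e2 + `|mass X - mass Y| + e1).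
Proof.
move=> m0 xS yS e20 gx gy xy; have xm := seqs_size xS; have ym := seqs_size yS.
pose a (i : 'I_m.+1) : X := nth point (point :: x) i.
pose b (i : 'I_m.+1) : Y := nth point (point :: y) i.
(* The roots get weight 0, so that gluing identifies them; this is allowed
   because a distortion of e2 is at most w i + w j whenever i or j is not the root. *)
pose w (i : 'I_m.+1) : R := if i == ord0 then 0 else e2.
have coord (i j : 'I_m.+1) : `|mdist (a i) (a j) - mdist (b i) (b j)| <= e2.
  have lt_case (k l : 'I_m.+1) : (k < l)%N -> `|mdist (a k) (a l) - mdist (b k) (b l)| <= e2.
    move=> kl; apply: le_trans xy; rewrite distrC.
    exact: (ddist_coord (distances_of m y) (distances_of m x) (exist _ (k, l) kl)).
  case: (ltngtP i j) => [ij|ji|/val_inj ->]; first exact: lt_case.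
    by rewrite (metric_sym (a i)) (metric_sym (b i)); exact: lt_case.
  by rewrite !mdistxx subrr normr0.
have [||||i j|D bD Dw] := @bridge_glue R X Y 'I_m.+1 ord0 a b w.
- by move=> j; rewrite /w; case: ifP.
- by rewrite /w eqxx.
- by [].
- by [].
- rewrite /w; case: eqP => [->|_]; case: eqP => [->|_];
    rewrite ?mdistxx ?subrr ?normr0 ?addr0 ?add0r//.
  by rewrite ler_wpDr.
exists D => // f g lf lg fg.
have fgj j : (j < m)%N -> `|nth 0 (map f x) j - nth 0 (map g y) j| <= e2.
  move=> jm; rewrite (nth_map point) ?xm// (nth_map point) ?ym//.
  apply: le_trans (fg _ _) _.
  have := Dw (inord j.+1); rewrite /a /b inordK//= => /le_trans; apply.
  by rewrite /w; case: ifP.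
have sfg : `|\sum_(t <- x) f t - \sum_(t <- y) g t| <= m%:R * e2.
  rewrite -(big_map f xpredT id) -(big_map g xpredT id).
  rewrite (big_nth 0) [X in _ - X](big_nth 0) !size_map xm ym -sumrB.
  apply: le_trans (ler_norm_sum _ _ _) _.
  apply: (@le_trans _ _ (\sum_(0 <= i < m) e2)).
    by rewrite big_nat [leRHS]big_nat; apply: ler_sum => j /andP[_ jm]; exact: fgj.
  by rewrite sumr_const_nat subn0 mulr_natl.
have [_ gB _] := lg.
have gm : `|\sum_(t <- y) g t| <= m%:R.
  apply: le_trans (ler_norm_sum _ _ _) _.
  apply: (@le_trans _ _ (\sum_(t <- y) 1)); last first.
    by rewrite big_const_seq count_predT iter_addr_0 ym.
  rewrite big_seq [leRHS]big_seq; apply: ler_sum => t ty.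
  by apply: gB; exact: seqs_mem yS ty.
have := gx f lf; have := gy g lg; rewrite xm ym.
have mR : 0 < m%:R :> R by rewrite ltr0n.
have h2 : `|mass X / m%:R * \sum_(t <- x) f t - mass X / m%:R * \sum_(t <- y) g t| <= mass X * e2.
  have Mm : 0 <= mass X / m%:R by rewrite divr_ge0 ?mass_ge0.
  rewrite -mulrBr normrM ger0_norm//.
  apply: le_trans (ler_wpM2l Mm sfg) _.
  by rewrite mulrA divfK ?lt0r_neq0.
have h3 : `|mass X / m%:R * \sum_(t <- y) g t - mass Y / m%:R * \sum_(t <- y) g t| <=
    `|mass X - mass Y|.
  rewrite -mulrBl -mulrBl normrM normrM normfV (ger0_norm (ltW mR)).
  by rewrite -[leRHS]mulr1 -mulrA ler_wpM2l// mulrC ler_pdivrMr// mul1r.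
move: h2 h3; set Sf := _ * \sum_(t <- x) f t; set Sg := _ * \sum_(t <- y) g t.
set Tg := _ / _ * \sum_(t <- y) g t; set d := `|mass X - mass Y|; set p := mass X * e2.
move: (supp_int X f) (supp_int Y g) Sf Sg Tg d p => af ag Sf Sg Tg d p.
by rewrite !ler_norml => /andP[? ?] /andP[? ?] /andP[? ?] /andP[? ?]; apply/andP; split; lra.
Qed.

End Matching.

(** * A sequence of bridges along which the measures converge *)

Section EventuallyClose.
Context {R : realType} (X_ : nat -> mfmSpace R) (X : mfmSpace R).
Hypothesis gw : gromov_weak_cvg X_ X.
Hypothesis lm : forall d, 0 < d ->
  exists2 c : R, 0 < c & \forall n \near \oo, mass_bound (X_ n) d c.

(** Let f be the test function near_set for the distance matrices of good tuples of X.
Its integral for X is at least 3/4 of the mass, and so it is at least 5/8 of it for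
X_ n.  Since Q_n has integral at most 1/4 of the mass of X_ n, some tuple y of X_ n
has Q_n y < f y: it is good, and its distance matrix is close to that of a good
tuple of X.  A limit of mass 0 is treated apart: any bridge will do. *)
Lemma eventually_bridge e : 0 < e -> \forall n \near \oo,
  exists2 D : X -> X_ n -> R, bridge D & bl_close D e.
Proof.
move=> e0; have e4 : 0 < e / 4 by rewrite divr_gt0.
have M0 := mass_ge0 X.
have [X0|X0] := eqVneq (mass X) 0.
  apply: filterS (gw_mass1 gw (divr_gt0 e0 (ltr0Sn R 0))) => n.
  rewrite divr1 X0 subr0 => nM; have [D bD] := bridge_wedge X (X_ n).
  exists D => // f g lf lg _; apply: le_trans (ler_normB _ _) _.
  apply: le_trans (lerD (supp_int_le_mass lf) (supp_int_le_mass lg)) _.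
  by rewrite X0 add0r (le_trans _ nM)// ler_norm.
have Mgt0 : 0 < mass X by rewrite lt0r X0.
pose M := mass X + 1; have Mp : 0 < M by rewrite addr_gt0.
pose eta := e / 4 / (8 * M).
have eta0 : 0 < eta by rewrite divr_gt0// mulr_gt0.
have etaM : 8 * eta * M <= e / 4.
  by rewrite le_eqVlt; apply/orP; left; apply/eqP; rewrite /eta; field; rewrite lt0r_neq0.
have [s0 s0X] := gw_totally_bounded gw lm eta0.
have [|c c0 cn] := lm (d := eta / 2); first by rewrite divr_gt0.
pose K := maxn (size s0) (Num.truncn (M / c)).+1.
have MK : M <= K%:R * c.
  rewrite -ler_pdivrMr//.
  have h0 : 0 <= M / c by rewrite divr_ge0// ltW.
  have /andP[_ /ltW h1] := truncn_itv h0.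
  by apply: le_trans h1 _; rewrite ler_nat leq_maxr.
have [m [m0 samp]] := @sampling R (e / 4) M eta K e4 eta0 (ltW Mp) etaM.
have [||Q [Q0 lQ IQ gQ]] := samp X.
- by rewrite lerDl.
- by exists s0; split=> //; exact: leq_maxl.
pose r := e / (4 * M); have r0 : 0 < r by rewrite divr_gt0// mulr_gt0.
pose A : set (distances m) := [set a | exists z,
  [/\ seqs (@supp R X) m z, good_sample (e / 4) z & a = distances_of m z]].
have fL := near_set_lipschitz A r0.
have lX (Y : mfmSpace R) : lipseq Y m (fun w => near_set A r (distances_of m w)).
  by eexists; eexists; exact: lipschitz_seq_distances_of fL.
have Mm0 : 0 < mass X ^+ m by rewrite exprn_gt0.
(* near_set is at least 1 - Q: it is 1 at good tuples, and 1 - Q <= 0 at the others. *)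
have IX : 3 / 4 * mass X ^+ m <= iter_int X m (fun z => near_set A r (distances_of m z)).
  have : iter_int X m (fun z => 1 + (-1) * Q z) <=
      iter_int X m (fun z => near_set A r (distances_of m z)).
    apply: le_iter_int => //.
      by apply: lipseqD; [exact: lipseq_cst|exact: lipseqZ].
    move=> z zS; rewrite mulN1r; have [Q1|Q1] := ltP (Q z) 1.
      by rewrite near_set1 ?gerBl//; exists z; split=> //; exact: gQ.
    by apply: le_trans (near_set_ge0 A r0 _); rewrite subr_le0.
  rewrite iter_intD; [|exact: lipseq_cst|exact: lipseqZ].
  by rewrite iter_int_cst iter_intZ//; move: IQ; lra.
near=> n.
have nM : `|mass (X_ n) - mass X| <= Num.min (e / 4) 1.
  by near: n; apply: gw_mass1 => //; rewrite lt_min e4 ltr01.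
have nMm : `|mass (X_ n) ^+ m - mass X ^+ m| <= mass X ^+ m / 2.
  by near: n; apply: gw_mass => //; rewrite divr_gt0.
have nI : `|iter_int (X_ n) m (fun z => near_set A r (distances_of m z)) -
    iter_int X m (fun z => near_set A r (distances_of m z))| <= mass X ^+ m / 8.
  by near: n; apply: (gromov_weakP X_ X).1 => //; rewrite ?divr_gt0//; exact: fL.
have nc : mass_bound (X_ n) (eta / 2) c by near: n.
have /andP[nMe nM1] : (`|mass (X_ n) - mass X| <= e / 4) && (`|mass (X_ n) - mass X| <= 1).
  by rewrite -le_min.
have nMM : mass (X_ n) <= M by move: nM1; rewrite ler_norml /M => /andP[_]; lra.
have [||Qn [Qn0 lQn IQn gQn]] := samp (X_ n).
- exact: nMM.
- have [s [sn sK]] := mass_bound_net nc c0 (le_trans nMM MK).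
  by exists s; split=> //; rewrite -[eta](divfK (lt0r_neq0 (ltr0Sn R 1))) mulrC.
have [y yS yQ] : exists2 y, seqs (@supp R (X_ n)) m y & Qn y < near_set A r (distances_of m y).
  apply: contrapT => ny.
  have : iter_int (X_ n) m (fun z => near_set A r (distances_of m z)) <= iter_int (X_ n) m Qn.
    apply: le_iter_int => // z zS; rewrite leNgt; apply/negP => zQ.
    by apply: ny; exists z.
  move: nI nMm IX IQn; rewrite !ler_norml => /andP[? ?] /andP[? ?]; lra.
have gy : good_sample (e / 4) y.
  by apply: gQn => //; apply: lt_le_trans yQ _; exact: near_set_le1.
have [_ [x [xS gx ->]] yx] := near_set_gt0 r0 (le_lt_trans (Qn0 y) yQ).
have [D bD DC] := samples_bridge m0 xS yS (ltW r0) gx gy (ltW yx).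
exists D => // f g lf lg fg; apply: le_trans (DC f g lf lg fg) _.
have : mass X * r <= e / 4.
  rewrite [leRHS](_ : _ = M * r); last by rewrite /r; field; rewrite lt0r_neq0.
  by rewrite ler_wpM2r ?(ltW r0)// lerDl.
move: nMe; rewrite distrC; lra.
Unshelve. all: by end_near. Qed.

Lemma bl_closeW (Y Z : mfmSpace R) (D : Y -> Z -> R) e e' :
  e <= e' -> bl_close D e -> bl_close D e'.
Proof. by move=> ee DC f g lf lg fg; apply: le_trans ee; exact: DC. Qed.

(** For each n a bridge is chosen whose quality is optimal up to 1 / (n + 1). *)
Lemma bridge_sequence : exists D : forall n, X -> X_ n -> R,
  (forall n, bridge (@D n)) /\
  forall e, 0 < e -> \forall n \near \oo, bl_close (@D n) e.
Proof.
pose A n := [set e : R | 0 < e /\ exists2 D : X -> X_ n -> R, bridge D & bl_close D e].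
have Alb n : has_lbound (A n) by exists 0 => e [/ltW].
have DP n : exists D : X -> X_ n -> R, bridge D /\
    forall e, A n e -> bl_close D (e + n.+1%:R^-1).
  have [[e0 Ae0]|nA] := pselect (A n !=set0); last first.
    have [D bD] := bridge_wedge X (X_ n); exists D; split=> // e Ae.
    by exfalso; apply: nA; exists e.
  have n0 : 0 < n.+1%:R^-1 :> R by rewrite invr_gt0.
  have [|e [e1 [D bD DC]] en] := inf_adherent n0 (E := A n).
    by split=> //; exists e0.
  exists D; split=> // e' Ae'; apply: bl_closeW DC.
  by rewrite (le_trans (ltW en))// lerD2r; exact: ge_inf.
pose D n : X -> X_ n -> R := projT1 (cid (DP n)).
have DQ n : bridge (D n) /\ forall e, A n e -> bl_close (D n) (e + n.+1%:R^-1).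
  by rewrite /D; case: cid.
exists D; split=> [n|e e0]; first by case: (DQ n).
have e2 : 0 < e / 2 by rewrite divr_gt0.
near=> n.
have nA : A n (e / 2) by split=> //; near: n; exact: eventually_bridge.
have [_ /(_ _ nA)] := DQ n; apply: bl_closeW.
rewrite [leRHS]splitr lerD2l ltW//; near: n.
exact: near_infty_natSinv_lt (PosNum e2).
Unshelve. all: by end_near. Qed.

End EventuallyClose.

(** * Images in a common space: weak and Hausdorff convergence *)

Section BridgeCover.
Context {R : realType}.

Lemma bridge_swap (X Y : pmetricType R) (D : X -> Y -> R) :
  bridge D -> bridge (fun y x => D x y).
Proof.
move=> bD; split.
- by move=> y x; exact: bridge_ge0.
- exact: bridge_root bD.
- by move=> y y' x; rewrite addrC (metric_sym y); exact: bridge_r.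
- by move=> y x x'; rewrite addrC (metric_sym x'); exact: bridge_l.
- by move=> y y' x; exact: bridge_rr.
- by move=> y x x'; exact: bridge_ll.
Qed.

Lemma bl_close_swap (X Y : mfmSpace R) (D : X -> Y -> R) e :
  bl_close D e -> bl_close (fun y x => D x y) e.
Proof.
move=> DC f g lf lg fg; rewrite distrC; apply: DC => // x y.
by rewrite distrC.
Qed.

(** A support point y far from the support of X is detected by the Lipschitz
bump around y, since the ball around y carries mass at least c. *)
Lemma bl_close_cover (X Y : mfmSpace R) (D : X -> Y -> R) (e r c : R) :
  bridge D -> bl_close D e -> 0 < r -> r <= 1 -> mass_bound Y (r / 2) c ->
  e < r / 2 * c -> forall y, @supp R Y y -> exists2 x, @supp R X x & D x y <= r.
Proof.
move=> bD DC r0 r1 cY ec y Sy; apply: contrapT => nx.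
pose f x := Num.max 0 (r - D x y).
pose g y' := Num.max 0 (r - mdist y y').
have lg : lipschitz_on (@supp R Y) 1 1 g.
  have [L0 gB gL] := @lipschitz_on_mdist R Y (@supp R Y) y r (ltW r0).
  by split=> // y' Sy'; apply: le_trans r1; exact: gB.
have f0 x : @supp R X x -> f x = 0.
  move=> Sx; rewrite /f max_l// subr_le0 leNgt; apply/negP => xr.
  by apply: nx; exists x => //; exact: ltW.
have lf : lipschitz_on (@supp R X) 1 1 f.
  split=> // [x Sx|x x' Sx Sx']; first by rewrite f0// normr0.
  by rewrite !f0// subrr normr0 mul1r mdist_ge0.
have fg x y' : `|f x - g y'| <= D x y'.
  rewrite /f /g; have := bridge_r bD x y y'; have := bridge_rr bD x y y'.
  have := bridge_r bD x y' y; have := bridge_ge0 bD x y'.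
  rewrite (metric_sym y' y) => d0 d1 d2 d3.
  by case: (leP 0 (r - D x y)) => ?; case: (leP 0 (r - mdist y y')) => ?;
    rewrite ler_norml; apply/andP; split; lra.
have := DC f g lf lg fg.
rewrite (eq_supp_int (g := fun=> 0)) ?supp_int_cst ?mul0r ?sub0r ?normrN//.
have lgf : lipfun Y g by exists 1, 1.
have : r / 2 * c <= supp_int Y g.
  apply: (@le_trans _ _ (r / 2 * fine (mfm_measure Y (cball y (r / 2))))).
    by rewrite ler_wpM2l ?divr_ge0 ?(ltW r0)//; exact: cY.
  apply: supp_int_ge_ball => //.
  - exact: measurable_cball.
  - by move=> x _; rewrite /g le_max lexx.
  - by move=> x _; rewrite /cball /= => xr; rewrite /g le_max; apply/orP; right; lra.
move=> h1 h2; have := le_trans h1 (le_trans (ler_norm _) h2).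
by rewrite leNgt ec.
Qed.

End BridgeCover.

Section ImageMeasure.
Context {R : realType} (X : mfmSpace R) (E : pmetricType R) (phi : X -> E).
Hypothesis iso : isometric_on (@rooted_supp R X) phi.
Local Notation mu := (mfm_measure X).
Local Notation K := (@rooted_supp R X).

Let mK : measurable (K : set (borel X)) := borel_closed (@closed_rooted_supp R X).

Lemma image_measure_finite : exists nu : {finite_measure set (borel E) -> \bar R},
  (nu : set (borel E) -> \bar R) = image_measure phi.
Proof. exact: (finite_pushforward_on mu mK (measurable_isometric_on mK iso)). Qed.

(** The map phi is controlled on the rooted support only; redefining it as constant
elsewhere makes it measurable and does not change the image measure of a Borel set,
since the support has full measure. *)
Lemma integral_image_measure (f : E -> R) B : continuous f -> (forall x, `|f x| <= B) ->
  (\int[image_measure phi]_x (f x)%:E)%E = (supp_int X (f \o phi))%:E.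
Proof.
move=> cf fB; have [nu nuE] := image_measure_finite.
pose psi : borel X -> borel E := fun x => if x \in K then phi x else point.
have psiE A : psi @^-1` A = (K `&` phi @^-1` A) `|` (~` K `&` [set x | A point]).
  apply/seteqP; split=> x /=; rewrite /psi; case: ifPn => [/set_mem|/negP] Kx.
  - by left.
  - by move=> Ap; right; split=> // Kx'; apply: Kx; rewrite inE.
  - by case=> -[].
  - by case=> -[// Kx' _]; exfalso; apply: Kx; rewrite inE.
have mphi := measurable_isometric_on mK iso.
have mpsi : measurable_fun setT psi.
  move=> _ A mA; rewrite setTI psiE; apply: measurableU; first exact: mphi.
  apply: measurableI; first exact: measurableC.
  have [Ap|Ap] := pselect (A point).
    by rewrite (_ : [set _ | _] = setT)//; apply/seteqP; split.
  by rewrite (_ : [set _ | _] = set0)//; apply/seteqP; split.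
have [nu' nu'E] := finite_pushforward mu mpsi.
have mf := measurable_continuous cf.
rewrite -nuE (eq_measure_integral nu'); last first.
  move=> A mA _.
  have mKA : measurable (K `&` phi @^-1` A : set (borel X)) by exact: mphi.
  have mpA : measurable (psi @^-1` A) by rewrite -[X in measurable X]setTI; exact: mpsi.
  have h : mu (K `&` phi @^-1` A) = mu (psi @^-1` A).
    rewrite -(measure_suppI mKA) -(measure_suppI mpA) psiE; congr (mu _).
    apply/seteqP; split=> x; first by case=> h Sx; split=> //; left.
    by case=> -[//|[nK _]] Sx; exfalso; apply: nK; left.
  exact: (etrans (congr1 (@^~ A) nuE) (etrans h (esym (congr1 (@^~ A) nu'E)))).
have -> : (\int[nu']_x (f x)%:E)%E = (\int[pushforward mu psi]_x (f x)%:E)%E by rewrite -nu'E.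
have ifpsi : mu.-integrable setT (fun x => (f (psi x))%:E).
  apply: (@bounded_integrable _ _ _ mu setT B) => //; exact: measurableT_comp mf mpsi.
rewrite (@integral_pushforward _ _ _ _ R psi mpsi mu setT (fun x => (f x)%:E)) //; last first.
  exact/measurable_EFinP.
rewrite preimage_setT (@negligible_integral _ _ _ mu _ (~` @supp R X)) //; last first.
  - exact: supp_full.
  - by apply: measurableC; exact: measurable_supp.
rewrite setTD setCK /= EFin_Rintegral; [|exact: measurable_supp|]; last first.
  by apply: integrableS ifpsi => //; exact: measurable_supp.
congr EFin; apply: eq_supp_int => x Sx /=; rewrite /psi ifT// inE; by left.
Qed.

End ImageMeasure.

Section WeakImage.
Context {R : realType} (X_ : nat -> mfmSpace R) (X : mfmSpace R) (E : pmetricType R).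
Variables (phi_ : forall n, X_ n -> E) (phi : X -> E).
Hypothesis iso_ : forall n, isometric_on (@rooted_supp R (X_ n)) (@phi_ n).
Hypothesis iso : isometric_on (@rooted_supp R X) phi.

Lemma weak_cvg_image_supp_int f B :
  weak_cvg (fun n => image_measure (@phi_ n)) (image_measure phi) ->
  continuous f -> (forall x, `|f x| <= B) ->
  forall e, 0 < e -> \forall n \near \oo,
    `|supp_int (X_ n) (f \o @phi_ n) - supp_int X (f \o phi)| <= e.
Proof.
move=> wc cf fB; have := wc f cf (ex_intro _ B fB).
rewrite (integral_image_measure iso cf fB) => h; apply/cvg_EFinP.
rewrite (_ : (fun n => _) = fun n => (\int[image_measure (@phi_ n)]_x (f x)%:E)%E) //.
by apply/funext => n; rewrite (integral_image_measure (@iso_ n) cf fB).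
Qed.

Lemma weak_cvg_image :
  (forall f L B, lipschitz_on setT L B f -> forall e, 0 < e -> \forall n \near \oo,
    `|supp_int (X_ n) (f \o @phi_ n) - supp_int X (f \o phi)| <= e) ->
  weak_cvg (fun n => image_measure (@phi_ n)) (image_measure phi).
Proof.
move=> H; have [nu nuE] := image_measure_finite iso.
pose nu_ n := projT1 (cid (image_measure_finite (@iso_ n))).
have nu_E n : (nu_ n : set (borel E) -> \bar R) = image_measure (@phi_ n).
  by rewrite /nu_; case: cid.
rewrite -nuE (_ : (fun n => _) = (fun n => nu_ n : set (borel E) -> \bar R)); last first.
  by apply/funext => n; rewrite nu_E.
apply: (weak_cvg_lipschitz (d := fun x y : E => mdist x y)).
- exact: mdistxx.
- exact: mdist_ge0.
- by move=> *; exact: metric_triangle.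
- exact: metric_sym.
- by move=> x U; exact: nbhs_mdistE.
move=> f L B [L0 fB fL].
have lf : lipschitz_on setT L B f by split=> // *; exact: fL.
have cf := lipschitz_continuous lf.
rewrite nuE (integral_image_measure iso cf fB).
rewrite (_ : (fun n => _) = fun n => (supp_int (X_ n) (f \o @phi_ n))%:E).
  by apply/cvg_EFinP; exact: H lf.
by apply/funext => n; rewrite nu_E (integral_image_measure (@iso_ n) cf fB).
Qed.

End WeakImage.

Section Hausdorff.
Context {R : realType} (E : pmetricType R).
Implicit Types A B : set E.

Lemma hausdorff_dist_le A B (e : R) : 0 < e ->
  (forall a, A a -> exists2 b, B b & mdist a b <= e) ->
  (forall b, B b -> exists2 a, A a & mdist b a <= e) ->
  (hausdorff_dist A B <= e%:E)%E.
Proof.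
move=> e0 AB BA; apply: ereal_inf_lbound; exists e => //; split=> // x.
  move=> /BA[a Aa xa]; apply: (@le_trans _ _ (mdist x a)%:E); last by rewrite lee_fin.
  by apply: ereal_inf_lbound; exists a.
move=> /AB[b Bb xb]; apply: (@le_trans _ _ (mdist x b)%:E); last by rewrite lee_fin.
by apply: ereal_inf_lbound; exists b.
Qed.

Lemma hausdorff_dist_ge0 A B : (0 <= hausdorff_dist A B)%E.
Proof.
by apply: le_ereal_inf_tmp => _ [e [e0 _ _] <-]; rewrite lee_fin ltW.
Qed.

Lemma hausdorff_dist_lt A B (e : R) : (hausdorff_dist A B < e%:E)%E ->
  (forall a, A a -> exists2 b, B b & mdist a b < e) /\
  (forall b, B b -> exists2 a, A a & mdist b a < e).
Proof.
move=> /ereal_inf_lt[_ [d [d0 BA AB] <-]]; rewrite lte_fin => de.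
split=> [a /AB|b /BA] h; have := le_lt_trans h (_ : (d%:E < e%:E)%E);
  rewrite lte_fin => /(_ de)/ereal_inf_lt[_ [c Cc <-]]; rewrite lte_fin; by exists c.
Qed.

(** The early terms may be infinite, as is the distance of an empty set to a nonempty one. *)
Lemma cvge0P (u : nat -> \bar R) : (forall n, (0 <= u n)%E) ->
  (u n @[n --> \oo] --> 0%E) <-> forall e : R, 0 < e -> \forall n \near \oo, (u n <= e%:E)%E.
Proof.
move=> u0; split.
  move/fine_cvgP => [fu /cvgrPdist_le cu] e e0.
  near=> n; have un : u n \is a fin_num by near: n.
  rewrite -(fineK un) lee_fin; apply: le_trans (ler_norm _) _.
  by rewrite -normrN -[X in `|X|]add0r; near: n; exact: cu.
move=> H; apply/fine_cvgP; split.
  apply: filterS (H 1 ltr01) => n un.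
  by rewrite ge0_fin_numE// (le_lt_trans un)// ltry.
apply/cvgrPdist_le => e e0; apply: filterS (H e e0) => n un /=.
have fn : u n \is a fin_num by rewrite ge0_fin_numE// (le_lt_trans un)// ltry.
by rewrite sub0r normrN ger0_norm ?fine_ge0// -lee_fin fineK.
Unshelve. all: by end_near. Qed.

End Hausdorff.

(** * The equivalences *)

Section GHWFromGW.
Context {R : realType} (X_ : nat -> mfmSpace R) (X : mfmSpace R).
Hypothesis gw : gromov_weak_cvg X_ X.
Hypothesis lm : forall d, 0 < d ->
  exists2 c : R, 0 < c & \forall n \near \oo, mass_bound (X_ n) d c.

(** In the amalgam the distance between f x and g n y is at most D n x y, so that
restrictions of a Lipschitz function on E to X and X_ n are admissible in bl_close. *)
Lemma ghw_from_gromov_weak : ghw_cvg X_ X.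
Proof.
have tb := gw_totally_bounded gw lm.
have [D [bD DC]] := bridge_sequence gw lm.
have [E [f [g [fi gi f0 g0 fgD]]]] := amalgam_along (Y := fun n => X_ n) bD.
have isof : isometric_on (@rooted_supp R X) f by move=> x y _ _; exact: fi.
have isog n : isometric_on (@rooted_supp R (X_ n)) (g n) by move=> x y _ _; exact: gi.
exists E, g, f; split=> //.
  apply: weak_cvg_image => // h L B [L0 hB hL] e e0.
  have B0 : 0 <= B := le_trans (normr_ge0 _) (hB point I).
  (* Dividing by L + B + 1 makes h 1-Lipschitz and bounded by 1. *)
  have k0 : 0 < L + B + 1 by rewrite ltr_wpDl// addr_ge0.
  have scaled : lipschitz_on setT 1 1 (fun x => (L + B + 1)^-1 * h x).
    split=> // [x _|x y _ _].
      rewrite normrM gtr0_norm ?invr_gt0// mulrC ler_pdivrMr// mul1r.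
      by rewrite (le_trans (hB x I))//; lra.
    rewrite -mulrBr normrM gtr0_norm ?invr_gt0// mulrC ler_pdivrMr// mul1r.
    rewrite (le_trans (hL x y I I))// mulrC ler_wpM2l ?mdist_ge0//; lra.
  have [_ sB sL] := scaled.
  have ek : 0 < e / (L + B + 1) by rewrite divr_gt0.
  apply: filterS (DC _ ek) => n nC.
  have lf : lipschitz_on (@supp R X) 1 1 (fun x => (L + B + 1)^-1 * h (f x)).
    by split=> // [x _|x y _ _]; [exact: sB|rewrite -fi; exact: sL].
  have lg : lipschitz_on (@supp R (X_ n)) 1 1 (fun x => (L + B + 1)^-1 * h (g n x)).
    by split=> // [x _|x y _ _]; [exact: sB|rewrite -gi; exact: sL].
  have := nC _ _ lf lg _.
  have -> : supp_int X (fun x => (L + B + 1)^-1 * h (f x)) = (L + B + 1)^-1 * supp_int X (h \o f).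
    apply: supp_intZ; exists L, B; split=> // [x _|x y _ _] /=; first exact: hB.
    by rewrite -fi; exact: hL.
  have -> : supp_int (X_ n) (fun x => (L + B + 1)^-1 * h (g n x)) =
      (L + B + 1)^-1 * supp_int (X_ n) (h \o g n).
    apply: supp_intZ; exists L, B; split=> // [x _|x y _ _] /=; first exact: hB.
    by rewrite -gi; exact: hL.
  rewrite -mulrBr normrM gtr0_norm ?invr_gt0// [leLHS]mulrC ler_pM2r ?invr_gt0// distrC.
  by apply=> x y; apply: le_trans (fgD n x y); rewrite -[leRHS]mul1r; exact: sL.
apply/cvge0P => [n|e e0]; first exact: hausdorff_dist_ge0.
pose r := Num.min e 1; have r0 : 0 < r by rewrite lt_min e0 ltr01.
have r1 : r <= 1 by rewrite ge_min lexx orbT.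
have re : r <= e by rewrite ge_min lexx.
have r2 : 0 < r / 2 by rewrite divr_gt0.
have [c c0 cX] := totally_bounded_mass_bound tb r2.
have [c' c'0 cX_] := lm r2.
pose eps := r / 2 * Num.min c c' / 2.
have m0 : 0 < Num.min c c' by rewrite lt_min c0.
have eps0 : 0 < eps by rewrite divr_gt0// mulr_gt0.
have epsm : eps < r / 2 * Num.min c c'.
  by rewrite /eps ltr_pdivrMr// ltr_pMr ?mulr_gt0// ltr1n.
have [mc mc'] : Num.min c c' <= c /\ Num.min c c' <= c' by rewrite !ge_min !lexx orbT.
near=> n.
have nC : bl_close (D n) eps by near: n; exact: DC.
have nc : mass_bound (X_ n) (r / 2) c' by near: n.
apply: hausdorff_dist_le => // [_ [y Sy <-]|_ [x Sx <-]].
  have [|x Sx xy] := bl_close_cover (bD n) nC r0 r1 nc _ Sy.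
    by apply: lt_le_trans epsm _; rewrite ler_pM2l.
  exists (f x); first by exists x.
  by rewrite metric_sym (le_trans (fgD n x y))// (le_trans xy).
have [|y Sy xy] := bl_close_cover (bridge_swap (bD n)) (bl_close_swap nC) r0 r1 cX _ Sx.
  by apply: lt_le_trans epsm _; rewrite ler_pM2l.
exists (g n y); first by exists y.
by rewrite (le_trans (fgD n x y))// (le_trans xy).
Unshelve. all: by end_near. Qed.

End GHWFromGW.

Lemma near_all_seq (T : eqType) (s : seq T) (P : T -> nat -> Prop) :
  (forall c, c \in s -> \forall n \near \oo, P c n) ->
  \forall n \near \oo, forall c, c \in s -> P c n.
Proof.
elim: s => [_|c s IH cP]; first by apply: nearW.
have h1 : \forall n \near \oo, P c n by apply: cP; rewrite mem_head.
have h2 : \forall n \near \oo, forall c, c \in s -> P c n.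
  by apply: IH => b bs; apply: cP; rewrite inE bs orbT.
by apply: filterS2 h1 h2 => n nc ns b; rewrite inE => /orP[/eqP ->//|/ns].
Qed.

Section GWFromGHW.
Context {R : realType} (X_ : nat -> mfmSpace R) (X : mfmSpace R) (E : pmetricType R).
Variables (phi_ : forall n, X_ n -> E) (phi : X -> E).
Hypothesis iso_ : forall n, isometric_on (@rooted_supp R (X_ n)) (@phi_ n).
Hypothesis phi_root_ : forall n, @phi_ n point = point.
Hypothesis iso : isometric_on (@rooted_supp R X) phi.
Hypothesis phi_root : phi point = point.
Hypothesis wc : weak_cvg (fun n => image_measure (@phi_ n)) (image_measure phi).
Hypothesis hc : hausdorff_dist (@phi_ n @` @supp R (X_ n)) (phi @` @supp R X)
  @[n --> \oo] --> 0%E.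
Hypothesis tb : totally_bounded (@supp R X).

Let supp_int_cvg f B : continuous f -> (forall x, `|f x| <= B) ->
  forall e, 0 < e -> \forall n \near \oo,
    `|supp_int (X_ n) (f \o @phi_ n) - supp_int X (f \o phi)| <= e.
Proof. by move=> cf fB; exact: (weak_cvg_image_supp_int iso_ iso wc cf fB). Qed.

Let mass_cvg : \forall n \near \oo, mass (X_ n) <= mass X + 1.
Proof.
have n1 (x : E) : `|1 : R| <= 1 by rewrite normr1.
have c1 : continuous (fun _ : E => 1 : R) by move=> x; exact: cvg_cst.
apply: filterS (supp_int_cvg c1 n1 ltr01) => {n1 c1} n.
rewrite /comp !supp_int_cst !mul1r ler_norml => /andP[_]; lra.
Qed.

Lemma lipschitz_on_comp (Y : mfmSpace R) (psi : Y -> E) f L B :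
  isometric_on (@rooted_supp R Y) psi -> lipschitz_on setT L B f ->
  lipschitz_on (@supp R Y) L B (f \o psi).
Proof.
move=> ipsi [L0 fB fL]; split=> // [x _|x y Sx Sy]; first exact: fB.
by rewrite -ipsi; [exact: fL|left|left].
Qed.

Let near_supp r : 0 < r -> \forall n \near \oo, forall y, @supp R (X_ n) y ->
  exists2 x, @supp R X x & mdist (phi_ y) (phi x) < r.
Proof.
move=> r0; have r2 : 0 < r / 2 by rewrite divr_gt0.
have := (cvge0P (fun n => hausdorff_dist_ge0 _ _)).1 hc _ r2.
apply: filterS => n nr y Sy.
have [|+ _] := @hausdorff_dist_lt R E (@phi_ n @` @supp R (X_ n)) (phi @` @supp R X) r.
  by apply: le_lt_trans nr _; rewrite lte_fin ltr_pdivrMr//; lra.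
move=> /(_ (phi_ y))[|_ [x Sx <-] yx]; first by exists y.
by exists x.
Qed.

Let near_net eta s : 0 < eta -> net (@supp R X) (eta / 2) s ->
  \forall n \near \oo, forall y, @supp R (X_ n) y ->
    exists2 c, c \in s & mdist (phi_ y) (phi c) <= eta.
Proof.
move=> eta0 [sS sn]; have e2 : 0 < eta / 2 by rewrite divr_gt0.
apply: filterS (near_supp e2) => n nr y /nr[x Sx yx]; have [c cs xc] := sn x Sx.
exists c => //; apply: le_trans (metric_triangle _ (phi x) _) _.
rewrite iso; [|by left|by left; exact: sS].
by rewrite (splitr eta) lerD// ltW.
Qed.

(** Hats around the finitely many points of a net of supp X have integrals bounded
below, first for X and then, by weak convergence, for X_ n; around each support
point of X_ n lies the support of one of these hats. *)
Lemma ghw_mass_bound d : 0 < d ->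
  exists2 c : R, 0 < c & \forall n \near \oo, mass_bound (X_ n) d c.
Proof.
move=> d0; pose eta := d / 3; have eta0 : 0 < eta by rewrite divr_gt0.
have [s sn] := tb (divr_gt0 eta0 (ltr0Sn R 1)); have [sS _] := sn.
pose h c (z : E) := Num.max 0 (2 * eta - mdist (phi c) z).
have e20 : 0 < 2 * eta by rewrite mulr_gt0.
have lh c := @lipschitz_on_mdist R E setT (phi c) (2 * eta) (ltW e20).
have [c0 [c00 c0s]] : exists c0 : R, 0 < c0 /\ forall c, c \in s -> c0 <= supp_int X (h c \o phi).
  have [|c0 ? ?] := @positive_lower_bound R _ s (fun c => supp_int X (h c \o phi)).
    move=> c cs; apply: (@supp_int_gt0 _ _ _ c).
    - by exists 1, (2 * eta); apply: lipschitz_on_comp => //; exact: lh.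
    - by move=> y _ /=; rewrite le_max lexx.
    - exact: sS.
    - by rewrite /= /h mdistxx subr0 lt_max e20 orbT.
  by exists c0.
exists (c0 / 2 / (2 * eta)); first by rewrite !divr_gt0.
near=> n.
have nS : forall y, @supp R (X_ n) y -> exists2 c, c \in s & mdist (phi_ y) (phi c) <= eta.
  by near: n; exact: near_net.
have nh : forall c, c \in s ->
    `|supp_int (X_ n) (h c \o @phi_ n) - supp_int X (h c \o phi)| <= c0 / 2.
  near: n; apply: near_all_seq => c _.
  have [_ hB _] := lh c.
  apply: (@supp_int_cvg _ (2 * eta)); rewrite ?divr_gt0//; last by move=> x; exact: hB.
  exact: lipschitz_continuous (lh c).
move=> y Sy; have [c cs yc] := nS y Sy.
rewrite ler_pdivrMr// [leRHS]mulrC.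
apply: (@le_trans _ _ (supp_int (X_ n) (h c \o @phi_ n))).
  by have := nh c cs; have := c0s c cs; rewrite ler_norml => ? /andP[? _]; lra.
have [_ hB _] := lh c.
apply: supp_int_le_ball.
- by exists 1, (2 * eta); apply: lipschitz_on_comp => //; exact: lh.
- exact: measurable_cball.
- by move=> x _ _; apply: le_trans (ler_norm _) _; exact: hB.
- move=> x Sx /= nxy; rewrite /h ge_max lexx /= subr_le0 leNgt; apply/negP => cx.
  apply: nxy; rewrite /cball /= -(@iso_ n) ?(or_introl _ Sx)//; [|by left|by left].
  apply: le_trans (metric_triangle _ (phi c) _) _.
  move: yc cx; rewrite /eta; lra.
Unshelve. all: by end_near. Qed.

Let lipfun_comp (Y : mfmSpace R) (psi : Y -> E) f L B :
  isometric_on (@rooted_supp R Y) psi -> lipschitz_on setT L B f -> lipfun Y (f \o psi).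
Proof. by move=> ipsi lf; exists L, B; exact: lipschitz_on_comp ipsi lf. Qed.

(** Near the totally bounded set phi (supp X), every bounded Lipschitz function is
approximately a combination of finitely many fixed bumps, with coefficients in
[-1, 1]; hence weak convergence is uniform over these functions. *)
Lemma bl_uniform e : 0 < e -> \forall n \near \oo, forall f,
  lipschitz_on setT 1 1 f -> `|supp_int (X_ n) (f \o @phi_ n) - supp_int X (f \o phi)| <= e.
Proof.
move=> e0; pose M := mass X + 1.
have M0 := mass_ge0 X; have Mp : 0 < M by rewrite ltr_wpDl.
pose eta := e / (8 * M).
have eta0 : 0 < eta by rewrite divr_gt0// mulr_gt0.
have etaM : 4 * eta * M = e / 2 by rewrite /eta; field; rewrite lt0r_neq0.
have [s0 s0n] := tb (divr_gt0 eta0 (ltr0Sn R 1)); have [s0S s0X] := s0n.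
pose s := map phi s0.
pose th := e / (2 * ((size s)%:R + 1)).
have s1 : 0 < (size s)%:R + 1 :> R by rewrite ltr_wpDl.
have th0 : 0 < th by rewrite divr_gt0// mulr_gt0.
near=> n.
have nM : mass (X_ n) <= M by near: n; exact: mass_cvg.
have nS : forall y, @supp R (X_ n) y -> exists2 c, c \in s0 & mdist (phi_ y) (phi c) <= eta.
  by near: n; exact: near_net.
have nb : forall c, c \in s ->
    `|supp_int (X_ n) (bump s eta c \o @phi_ n) - supp_int X (bump s eta c \o phi)| <= th.
  near: n; apply: near_all_seq => c cs.
  have lb := bump_lipschitz eta0 cs; have [_ bB _] := lb.
  by apply: (@supp_int_cvg _ 1) => //; [exact: lipschitz_continuous lb|move=> x; exact: bB].
move=> f lf; have [_ fB fL] := lf.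
have approx (Y : mfmSpace R) (psi : Y -> E) : isometric_on (@rooted_supp R Y) psi ->
    (forall y, @supp R Y y -> exists2 c, c \in s & mdist (psi y) c <= eta) ->
    `|supp_int Y (f \o psi) - \sum_(c <- s) f c * supp_int Y (bump s eta c \o psi)| <=
      2 * eta * mass Y.
  move=> ipsi psis.
  pose b c (y : Y) := if c \in s then bump s eta c (psi y) else 0.
  have lb c : lipfun Y (b c).
    have [cs|cs] := boolP (c \in s).
      rewrite (_ : b c = bump s eta c \o psi); last by apply/funext => y; rewrite /b cs.
      exact: lipfun_comp ipsi (bump_lipschitz eta0 cs).
    rewrite (_ : b c = fun=> 0); first exact: lipfun_cst.
    by apply/funext => y; rewrite /b (negbTE cs).
  have [ls avs] := supp_int_sum s (fun c => lipfunZ (f c) (lb c)).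
  rewrite (_ : \sum_(c <- s) _ = supp_int Y (fun y => \sum_(c <- s) f c * b c y)); last first.
    rewrite avs big_seq [RHS]big_seq; apply: eq_bigr => c cs; rewrite supp_intZ//.
    by congr (_ * _); apply: eq_supp_int => y _; rewrite /b cs.
  apply: supp_int_dist => //; first exact: lipfun_comp ipsi lf.
  move=> y Sy; apply: convex_approx.
  - by move=> c; rewrite /b; case: ifP => // _; exact: bump_ge0.
  - rewrite -(sum_bump eta0 (psis y Sy)) big_seq [RHS]big_seq.
    by apply: eq_bigr => c cs; rewrite /b cs.
  - move=> c cs; rewrite /b cs => bc /=.
    apply: le_trans (fL _ _ I I) _; rewrite mul1r metric_sym leNgt.
    by apply: contra bc => h; rewrite bump_far// ltW.
have h1 := @approx (X_ n) (@phi_ n) (@iso_ n) _.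
have {}h1 := h1 (fun y Sy => let: ex_intro2 c cs yc := nS y Sy in
  ex_intro2 _ _ (phi c) (map_f phi cs) yc).
have h2 : `|supp_int X (f \o phi) - \sum_(c <- s) f c * supp_int X (bump s eta c \o phi)| <=
    2 * eta * mass X.
  apply: approx => // x Sx; have [c cs xc] := s0X x Sx.
  exists (phi c); first exact: map_f.
  rewrite iso; [|by left|by left; exact: s0S].
  by apply: le_trans xc _; rewrite ler_pdivrMr// ler_pMr// ler1n.
have h3 : `|\sum_(c <- s) f c * supp_int (X_ n) (bump s eta c \o @phi_ n) -
    \sum_(c <- s) f c * supp_int X (bump s eta c \o phi)| <= e / 2.
  rewrite -sumrB; apply: le_trans (ler_norm_sum _ _ _) _.
  apply: (@le_trans _ _ (\sum_(c <- s) th)).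
    rewrite big_seq [leRHS]big_seq; apply: ler_sum => c cs.
    rewrite -mulrBr normrM -[th]mul1r; apply: ler_pM => //; first exact: fB.
    exact: nb.
  rewrite big_const_seq count_predT iter_addr_0 -[th *+ _]mulr_natl.
  apply: (@le_trans _ _ (((size s)%:R + 1) * th)).
    by rewrite ler_wpM2r ?(ltW th0)// lerDl.
  rewrite [leLHS](_ : _ = e / 2)// /th; field; by rewrite lt0r_neq0.
have h4 : 2 * eta * mass (X_ n) <= 2 * eta * M by rewrite ler_wpM2l// mulr_ge0// ltW.
have h5 : 2 * eta * mass X <= 2 * eta * M by rewrite ler_wpM2l ?lerDl// mulr_ge0// ltW.
have h6 : 2 * eta * M + 2 * eta * M = e / 2 by rewrite -etaM; ring.
move: h1 h2 h3 h4 h5 h6; set a1 := supp_int _ _; set a2 := \sum_(c <- s) _; set b1 := supp_int _ _.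
set b2 := \sum_(c <- s) _; set u := 2 * eta * _; set v := 2 * eta * _; set w := 2 * eta * _.
move: a1 a2 b1 b2 u v w => a1 a2 b1 b2 u v w.
rewrite !ler_norml => /andP[? ?] /andP[? ?] /andP[? ?] ? ? ?; apply/andP; split; lra.
Unshelve. all: by end_near. Qed.

Definition nonexpansive_seq m (H : seq E -> R) :=
  (forall z, size z = m -> `|H z| <= 1) /\
  forall z w, size z = m -> size w = m -> `|H z - H w| <= dsum z w.

Lemma dsum_map (Y : mfmSpace R) (psi : Y -> E) m (z w : seq Y) :
  isometric_on (@rooted_supp R Y) psi -> seqs (@supp R Y) m z -> seqs (@supp R Y) m w ->
  dsum (map psi z) (map psi w) = dsum z w.
Proof.
move=> ipsi; elim: m z w => [|m IH] [|x z] [|y w] //= [Sx zS] [Sy wS].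
by rewrite ipsi; [rewrite IH|left|left].
Qed.

Lemma lipschitz_seq_map (Y : mfmSpace R) (psi : Y -> E) m H :
  isometric_on (@rooted_supp R Y) psi -> nonexpansive_seq m H ->
  lipschitz_seq Y m 1 1 (fun z => H (map psi z)).
Proof.
move=> ipsi [HB HL]; split=> // [z zS|z w zS wS].
  by apply: HB; rewrite size_map (seqs_size zS).
rewrite mul1r -(dsum_map ipsi zS wS); apply: HL; rewrite size_map.
  exact: seqs_size zS.
exact: seqs_size wS.
Qed.

(** The induction runs over functions on sequences in E, since these can be evaluated
at points of X and of X_ n alike: the inner integrals are compared by the induction
hypothesis for a fixed first entry t in E, and the outer ones by bl_uniform applied
to the inner integral for X as a function of t. *)
Lemma iter_int_uniform m e : 0 < e -> \forall n \near \oo, forall H, nonexpansive_seq m H ->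
  `|iter_int (X_ n) m (fun z => H (map (@phi_ n) z)) - iter_int X m (fun z => H (map phi z))| <= e.
Proof.
elim: m e => [|m IH] e e0.
  by apply: nearW => n H _ /=; rewrite subrr normr0 ltW.
pose M := mass X + 1; pose k := mass X ^+ m + 1.
have M0 := mass_ge0 X; have Mp : 0 < M by rewrite ltr_wpDl.
have kp : 0 < k by rewrite ltr_wpDl// massX_ge0.
have e1 : 0 < e / (2 * M) by rewrite divr_gt0// mulr_gt0.
have e2 : 0 < e / (2 * k) by rewrite divr_gt0// mulr_gt0.
near=> n.
have nM : mass (X_ n) <= M by near: n; exact: mass_cvg.
have nI : forall H, nonexpansive_seq m H -> `|iter_int (X_ n) m (fun z => H (map (@phi_ n) z)) -
    iter_int X m (fun z => H (map phi z))| <= e / (2 * M) by near: n; exact: IH.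
have nb : forall f, lipschitz_on setT 1 1 f ->
    `|supp_int (X_ n) (f \o @phi_ n) - supp_int X (f \o phi)| <= e / (2 * k).
  by near: n; exact: bl_uniform.
move=> H HH; have [HB HL] := HH.
have Hcons t : nonexpansive_seq m (fun z => H (t :: z)).
  split=> [z zm|z w zm wm]; first by apply: HB; rewrite /= zm.
  have := HL (t :: z) (t :: w); rewrite /= zm wm mdistxx add0r.
  by apply.
pose h t := iter_int X m (fun z => H (t :: map phi z)).
have lt_ t : lipseq X m (fun z => H (t :: map phi z)).
  by exists 1, 1; exact: lipschitz_seq_map iso (Hcons t).
have lh : lipschitz_on setT 1 1 (fun t => k^-1 * h t).
  split=> // [t _|t u _ _].
    rewrite normrM gtr0_norm ?invr_gt0// mulrC ler_pdivrMr// mul1r.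
    rewrite /h -[X in `|X|]subr0 -[X in _ - X](mul0r (mass X ^+ m)) -iter_int_cst.
    apply: (@le_trans _ _ (1 * mass X ^+ m)); last by rewrite mul1r lerDl.
    apply: iter_int_dist => //; first exact: lipseq_cst.
    by move=> z zS; rewrite subr0; apply: HB; rewrite /= size_map (seqs_size zS).
  rewrite -mulrBr normrM gtr0_norm ?invr_gt0// mulrC ler_pdivrMr// mul1r.
  apply: (@le_trans _ _ (mdist t u * mass X ^+ m)); last first.
    by rewrite ler_wpM2l ?mdist_ge0// lerDl.
  apply: iter_int_dist => //; first exact: mdist_ge0.
  move=> z zS; have zm := seqs_size zS.
  have := HL (t :: map phi z) (u :: map phi z); rewrite /= size_map zm dsumxx addr0.
  by apply.
have kK t : k * (k^-1 * h t) = h t by rewrite mulrA divff ?mul1r// lt0r_neq0.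
have lhn : lipfun (X_ n) (fun x => k^-1 * h (phi_ x)) by exact: lipfun_comp (@iso_ n) lh.
have lhX : lipfun X (fun x => k^-1 * h (phi x)) by exact: lipfun_comp iso lh.
have hE (Y : mfmSpace R) (psi : Y -> E) : lipfun Y (fun x => k^-1 * h (psi x)) ->
    supp_int Y (h \o psi) = k * supp_int Y (fun x => k^-1 * h (psi x)) /\ lipfun Y (h \o psi).
  move=> lY; rewrite -supp_intZ//; split; first by apply: eq_supp_int => x _; rewrite kK.
  rewrite (_ : h \o psi = fun x => k * (k^-1 * h (psi x))); first exact: lipfunZ.
  by apply/funext => x; rewrite kK.
have [hn lhn'] := hE _ _ lhn; have [hX _] := hE _ _ lhX.
rewrite /=.
have a1 : `|supp_int (X_ n) (fun x => iter_int (X_ n) m (fun z => H (phi_ x :: map (@phi_ n) z))) -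
    supp_int (X_ n) (h \o @phi_ n)| <= e / (2 * M) * mass (X_ n).
  apply: supp_int_dist => //.
    have := lipschitz_seq_map (@iso_ n) HH => /iter_int_lipschitz lI.
    by eexists; eexists; exact: lI.
  by move=> x _; exact: nI (Hcons (phi_ x)).
have a2 : `|supp_int (X_ n) (h \o @phi_ n) - supp_int X (h \o phi)| <= e / 2.
  rewrite hn hX -mulrBr normrM gtr0_norm//.
  apply: (@le_trans _ _ (k * (e / (2 * k)))); first by rewrite ler_pM2l//; exact: nb lh.
  by rewrite le_eqVlt; apply/orP; left; apply/eqP; field; rewrite lt0r_neq0.
have a3 : e / (2 * M) * mass (X_ n) <= e / 2.
  apply: (@le_trans _ _ (e / (2 * M) * M)); first by rewrite ler_wpM2l// ltW.
  by rewrite le_eqVlt; apply/orP; left; apply/eqP; field; rewrite lt0r_neq0.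
apply: le_trans (ler_distD (supp_int (X_ n) (h \o @phi_ n)) _ _) _.
by rewrite (splitr e) lerD// (le_trans a1).
Unshelve. all: by end_near. Qed.

Lemma distances_of_map (Y : mfmSpace R) (psi : Y -> E) m (z : seq Y) :
  isometric_on (@rooted_supp R Y) psi -> psi point = point ->
  seqs (@supp R Y) m z -> distances_of m (map psi z) = distances_of m z.
Proof.
move=> ipsi psi0 zS; have zm := seqs_size zS.
apply/funext => ij; rewrite /distances_of -psi0 -map_cons.
have lt_size (i : 'I_m.+1) : (i < size ((point : Y) :: z))%N by rewrite /= zm.
rewrite !(nth_map (point : Y)) ?lt_size// ipsi// /rooted_supp.
  case: (nat_of_ord (sval ij).1) (lt_size (sval ij).1) => [|i] /= il; first by right.
  by left; apply: (seqs_mem zS); rewrite mem_nth.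
case: (nat_of_ord (sval ij).2) (lt_size (sval ij).2) => [|i] /= il; first by right.
by left; apply: (seqs_mem zS); rewrite mem_nth.
Qed.

Lemma gromov_weak_from_ghw : gromov_weak_cvg X_ X.
Proof.
apply/gromov_weakP => m f L B [L0 fB fL] e e0.
pose N : R := 2 * #|{: index_pairs m}|%:R.
have N0 : 0 <= N by rewrite mulr_ge0.
have B0 : 0 <= B := le_trans (normr_ge0 _) (fB point).
pose k := L * N + B + 1.
have LN : 0 <= L * N by rewrite mulr_ge0.
have kp : 0 < k by rewrite ltr_wpDl// addr_ge0.
pose H (w : seq E) := k^-1 * f (distances_of m w).
have HH : nonexpansive_seq m H.
  split=> [w _|w v wm vm].
    rewrite /H normrM gtr0_norm ?invr_gt0// mulrC ler_pdivrMr// mul1r.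
    by rewrite (le_trans (fB _))// /k; lra.
  rewrite /H -mulrBr normrM gtr0_norm ?invr_gt0// mulrC ler_pdivrMr//.
  apply: le_trans (fL _ _) _.
  apply: (@le_trans _ _ (L * (N * dsum w v))).
    by apply: ler_wpM2l => //; apply: distances_of_lipschitz; rewrite wm.
  rewrite mulrA mulrC ler_wpM2l ?dsum_ge0// /k; lra.
have unfold (Y : mfmSpace R) (psi : Y -> E) : isometric_on (@rooted_supp R Y) psi ->
    psi point = point ->
    iter_int Y m (fun z => f (distances_of m z)) = k * iter_int Y m (fun z => H (map psi z)).
  move=> ipsi psi0; rewrite -iter_intZ; last by exists 1, 1; exact: lipschitz_seq_map.
  apply: eq_iter_int => z zS; rewrite /H mulrA divff ?mul1r ?lt0r_neq0//.
  by rewrite (distances_of_map ipsi psi0 zS).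
apply: filterS (iter_int_uniform m (divr_gt0 e0 kp)) => n /(_ H HH).
rewrite (unfold _ _ (@iso_ n) (@phi_root_ n)) (unfold _ _ iso phi_root).
by rewrite -mulrBr normrM (gtr0_norm kp) ler_pdivlMr// mulrC.
Qed.

End GWFromGHW.

Section Equivalences.
Context {R : realType} (X_ : nat -> mfmSpace R) (X : mfmSpace R).

Lemma liminf_lower_massP :
  (forall d : R, 0 < d -> (0 < limn_einf (fun n => lower_mass d (X_ n)))%E) <->
  (forall d : R, 0 < d -> exists2 c, 0 < c & \forall n \near \oo, mass_bound (X_ n) d c).
Proof.
split=> H d d0.
  have /limn_einf_gt0P[c c0 cn] := H d d0; exists c => //.
  by apply: filterS cn => n /lower_massP.
have [c c0 cn] := H d d0; apply/limn_einf_gt0P; exists c => //.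
by apply: filterS cn => n /lower_massP.
Qed.

(** Only the finitely many initial terms matter, and each is positive by compactness. *)
Lemma liminf_global_lower_mass : (forall n, mfm_compact (X_ n)) ->
  (forall d : R, 0 < d -> (0 < limn_einf (fun n => lower_mass d (X_ n)))%E) <->
  global_lower_mass_bound X_.
Proof.
move=> cX_; split=> H d d0; last first.
  have := H d d0; set i := ereal_inf _ => i0.
  have [c c0 ci] : exists2 c : R, 0 < c & (c%:E <= i)%E.
    move: i0; case: (i) => [r|_|//]; last by exists 1 => //; rewrite leey.
    by rewrite lte_fin => r0; exists r.
  apply/limn_einf_gt0P; exists c => //; apply: nearW => n.
  by apply: le_trans ci _; apply: ereal_inf_lbound; exists n.
have [c c0 [N _ cN]] := (liminf_lower_massP.1 H) d d0.
pose g n := projT1 (cid2 (totally_bounded_mass_bound (mfm_compact_totally_bounded (cX_ n)) d0)).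
have g0 n : 0 < g n by rewrite /g; case: cid2.
have gP n : mass_bound (X_ n) d (g n) by rewrite /g; case: cid2.
have [c' c'0 c'g] := @positive_lower_bound R _ (iota 0 N) g (fun n _ => g0 n).
apply: (@lt_le_trans _ _ (Num.min c c')%:E); first by rewrite lte_fin lt_min c0.
apply: le_ereal_inf_tmp => _ [n _ <-]; apply/lower_massP => x Sx.
have [nN|nN] := leqP N n.
  by apply: le_trans (cN n nN x Sx); rewrite ge_min lexx.
apply: le_trans (gP n x Sx); rewrite ge_min c'g ?orbT// mem_iota.
by rewrite add0n.
Qed.

End Equivalences.

Theorem theorem6p1 (R : realType) (X : mfmSpace R) (X_ : nat -> mfmSpace R) :
  ((gromov_weak_cvg X_ X /\
     forall d : R, 0 < d -> (0 < limn_einf (fun n => lower_mass d (X_ n)))%E)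
   <-> (mfm_compact X /\ ghw_cvg X_ X))
  /\
  ((forall n, mfm_compact (X_ n)) ->
   ((gromov_weak_cvg X_ X /\
      forall d : R, 0 < d -> (0 < limn_einf (fun n => lower_mass d (X_ n)))%E)
    <-> (gromov_weak_cvg X_ X /\ global_lower_mass_bound X_))).
Proof.
split; last first.
  by move=> /liminf_global_lower_mass h; split=> -[gw /h].
split=> [[gw /liminf_lower_massP lm]|[cX [E [phi_ [phi [iso_ [iso root] wc hc]]]]]].
  split; first exact: support_compact (gw_totally_bounded gw lm).
  exact: ghw_from_gromov_weak.
have tb := mfm_compact_totally_bounded cX.
have i_ n : isometric_on (@rooted_supp R (X_ n)) (phi_ n) := (iso_ n).1.
have r_ n : phi_ n point = point := (iso_ n).2.
split; first exact: gromov_weak_from_ghw i_ r_ iso root wc hc tb.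
by apply/liminf_lower_massP => d; exact: ghw_mass_bound i_ iso wc hc tb _.
Qed.
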